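(* Let $0<\beta<\alpha<1$ be constants independent of $n$, and let $k=\beta n$, $m=\alpha n$. Let $A$ be an $m\times n$ matrix with i.i.d. standard normal components, and let $\xi_{uric}=\max_{\mathbf{x}\in S_{ric}}\|A\mathbf{x}\|_2$. Then $$\limsup_{n\rightarrow\infty}\frac{E\,\xi_{uric}}{\sqrt{m}}\leq 1+\frac{1}{\sqrt{\alpha}}\sqrt{\beta+\frac{2\,\mathrm{erfinv}(1-\beta)}{\sqrt{\pi}\,e^{(\mathrm{erfinv}(1-\beta))^2}}}.$$ Moreover, let $\xi_{uric}^{(u)}$ be a constant such that $$1+\frac{1}{\sqrt{\alpha}}\sqrt{\beta+\frac{2\,\mathrm{erfinv}(1-\beta)}{\sqrt{\pi}\,e^{(\mathrm{erfinv}(1-\beta))^2}}}<\xi_{uric}^{(u)}.$$ Then $$\lim_{n\rightarrow\infty}P\left(\xi_{uric}\leq \xi_{uric}^{(u)}\sqrt{m}\right)=1,\quad\text{equivalently}\quad \lim_{n\rightarrow\infty}P\left(\xi_{uric}^2\leq (\xi_{uric}^{(u)})^2 m\right)=1.$$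
   Context: $S_{ric}=\{\mathbf{x}\in S^{n-1} : \|\mathbf{x}\|_{\ell_0}=k\}$, where $S^{n-1}$ is the Euclidean unit sphere in $\mathbb{R}^n$ and $\|\mathbf{x}\|_{\ell_0}$ is the number of nonzero components of $\mathbf{x}$. The maximum over $S_{ric}$ is understood as a supremum. The relations $k=\beta n$, $m=\alpha n$ are understood up to rounding to integers (e.g. $k=\lfloor\beta n\rfloor$, $m=\lfloor\alpha n\rfloor$). $\mathrm{erfinv}$ is the inverse of $\mathrm{erf}(x)=\frac{2}{\sqrt{\pi}}\int_0^x e^{-t^2}dt$. *)

(* Defs.v *)
From HB Require Import structures.
From mathcomp Require Import all_boot all_order all_algebra.
From mathcomp Require Import all_classical all_reals all_analysis.
Set Implicit Arguments.
Unset Strict Implicit.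
Unset Printing Implicit Defensive.
Import Order.TTheory GRing.Theory Num.Theory.
Import numFieldNormedType.Exports.
Local Open Scope classical_set_scope.
Local Open Scope ring_scope.

(* The second integral makes the integral from 0 to x oriented: it is over the
   empty set for x > 0 and carries the sign for x < 0. *)
Definition erf (R : realType) (x : R) : R :=
  2 / Num.sqrt pi *
  (\int[lebesgue_measure]_(t in `[0, x]) expR (- t ^+ 2)
   - \int[lebesgue_measure]_(t in `[x, 0]) expR (- t ^+ 2)).

(* Total function; only meaningful on the range ]-1, 1[ of erf. *)
Definition erfinv (R : realType) : R -> R := 'pinv_(fun=> 0) setT (@erf R).

(* The library norm on matrices is the sup norm, hence these two. *)
Definition l2norm (R : realType) (n : nat) (x : 'cV[R]_n) : R :=
  Num.sqrt (\sum_i x i 0 ^+ 2).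

Definition l0norm (R : realType) (n : nat) (x : 'cV[R]_n) : nat :=
  #|[set i | x i 0 != 0]%SET|.

Definition Sric (R : realType) (n k : nat) : set 'cV[R]_n :=
  [set x | l2norm x = 1 /\ l0norm x = k].

(* Events B i = setT give the product rule for every subfamily. *)
Definition mutually_independent (R : realType) (d : measure_display)
    (T : measurableType d) (P : probability T R) (I : finType)
    (X : I -> {RV P >-> R}) : Prop :=
  forall B : I -> set R, (forall i, measurable (B i)) ->
    P (\bigcap_i (X i @^-1` B i)) = (\prod_i P (X i @^-1` B i))%E.

Definition iid_std_normal (R : realType) (d : measure_display)
    (T : measurableType d) (P : probability T R) (m n : nat)
    (A : 'I_m -> 'I_n -> {RV P >-> R}) : Prop :=
  (forall i j (B : set R), measurable B ->
     distribution P (A i j) B = normal_prob 0 1 B) /\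
  mutually_independent (fun ij : 'I_m * 'I_n => A ij.1 ij.2).

Definition xi_uric (R : realType) (d : measure_display)
    (T : measurableType d) (P : probability T R) (k m n : nat)
    (A : 'I_m -> 'I_n -> {RV P >-> R}) (w : T) : R :=
  sup [set l2norm ((\matrix_(i, j) A i j w) *m x) | x in @Sric R n k].

Definition uric_bound (R : realType) (alpha beta : R) : R :=
  1 + (Num.sqrt alpha)^-1 *
      Num.sqrt (beta + 2 * erfinv (1 - beta) /
                       (Num.sqrt pi * expR (erfinv (1 - beta) ^+ 2))).

(* Main.v *)
Require Import Defs.
From HB Require Import structures.
From mathcomp Require Import all_boot all_order all_algebra.
From mathcomp Require Import all_classical all_reals all_analysis.
From mathcomp Require Import measurable_realfun.
From mathcomp Require Import ring lra.
Set Implicit Arguments.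
Unset Strict Implicit.
Unset Printing Implicit Defensive.
Import Order.TTheory GRing.Theory Num.Theory.
Import numFieldNormedType.Exports.
Local Open Scope classical_set_scope.
Local Open Scope ring_scope.

(** The supremum of [y^T A x] over unit vectors [y] and over unit vectors [x]
    with [k] nonzero coordinates is the quantity to be bounded.  After one common
    Gaussian variable is added, this Gaussian process has the same variances as,
    and larger covariances than, the decoupled process [g^T y + h^T x] with
    independent standard Gaussian vectors [g] and [h]; hence its maximum tends to
    be smaller.  The maximum of the decoupled process is the norm of [g], about
    [Num.sqrt (alpha * n)], plus the norm of the [k] largest coordinates of [h].
    For large [n] these are the coordinates that exceed the threshold [t] of
    two-sided tail probability [beta], and their sum of squares is about [n] times
    the second moment of a Gaussian on that tail.  Divided by [Num.sqrt m], the
    sum of the two norms is [uric_bound alpha beta].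

    The comparison ([gauss_comparison], [slepian_soft_step]) is carried out for
    [soft_step], a smooth substitute for the indicator that all coordinates stay
    below a level.  Both Gaussian vectors are cut into many small independent
    increments, which are exchanged one after the other; by the Taylor expansion
    of [soft_step] an exchange costs a third order error beyond a second order
    term that depends on the covariance only and has the right sign.
    [integral_weighted_sum] identifies iterated one dimensional Gaussian integrals
    with expectations under the given probability.

    For the decoupled process, [g * e <= g ^+ 2 / (2 * c) + c / 2 * e ^+ 2] in
    each coordinate bounds all points at once, and the exponential moment
    factors into one dimensional integrals ([exceed_bound]).  A small
    exponential parameter then shows that exceeding the expected value by the
    fraction [eta] of [Num.sqrt n] has exponentially small probability
    ([xi_tail_exp]).  The bound is the same for all finite sets of points, so it
    passes to the supremum through rational vectors ([xi_exceed], [xi_tail]).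

    Both limits follow.  The probability is immediate, and the mean is at most the
    level plus a bounded error, because the second moment grows only
    polynomially ([xi_mean_le], [mean_xi_le]). *)

(** * Rotation invariance of the standard Gaussian measure *)

Section gauss.
Variable R : realType.
Local Notation mu := (@lebesgue_measure R).
Local Notation gam := (@normal_prob R 0 1).
Local Notation phi := (@normal_pdf R 0 1).

(** The density is almost everywhere equal to the Radon-Nikodym derivative,
    because both have the same integrals. *)
Lemma ge0_integral_normal_prob (f : R -> \bar R) :
  measurable_fun setT f -> (forall x, 0 <= f x)%E ->
  (\int[gam]_x f x = \int[mu]_x (f x * (phi x)%:E))%E.
Proof.
move=> mf f0.
have dom : gam `<< mu by exact: normal_prob_dominates.
rewrite -(Radon_Nikodym_SigmaFinite.change_of_variables dom)//.
have mg : mu.-integrable setT (Radon_Nikodym_SigmaFinite.f gam mu).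
  exact: Radon_Nikodym_SigmaFinite.f_integrable.
apply: ae_eq_integral => //.
- apply: emeasurable_funM => //; exact: measurable_int mg.
- apply: emeasurable_funM => //; apply/measurable_EFinP.
  exact: measurable_normal_pdf.
- apply: ae_eqe_mul2l => /=.
  apply: integral_ae_eq => //=.
    apply/measurable_EFinP; exact: measurable_normal_pdf.
  move=> E _ mE; rewrite -Radon_Nikodym_SigmaFinite.f_integral//=.
Qed.

Lemma std_normal_pdfE (x : R) : phi x = (Num.sqrt (pi *+ 2))^-1 * expR (- (x ^+ 2) / 2).
Proof.
by rewrite normal_pdfE ?oner_neq0// /normal_peak /normal_fun expr1n mul1r subr0.
Qed.

(** Completing the square: the two exponents differ by a multiple of
    [1 - (a ^+ 2 + b ^+ 2)]. *)
Lemma normal_pdf_rotation (a b s r : R) : 0 < b -> a ^+ 2 + b ^+ 2 = 1 ->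
  phi s * (phi ((r - a * s) / b) / b) = phi r * normal_pdf (a * r) b s.
Proof.
move=> b0 ab; rewrite !std_normal_pdfE normal_pdfE ?gt_eqF//.
rewrite /normal_peak /normal_fun.
have -> : Num.sqrt (b ^+ 2 * pi *+ 2) = b * Num.sqrt (pi *+ 2) :> R.
  by rewrite -mulrnAr sqrtrM ?sqr_ge0// sqrtr_sqr gtr0_norm.
set k := Num.sqrt _; rewrite invfM.
transitivity (k^-1 * k^-1 * b^-1 * expR (- s ^+ 2 / 2 + - ((r - a * s) / b) ^+ 2 / 2)).
  by rewrite expRD; ring.
transitivity (k^-1 * k^-1 * b^-1 * expR (- r ^+ 2 / 2 + - (s - a * r) ^+ 2 / (b ^+ 2 *+ 2))).
  congr (_ * expR _).
  have bn : b != 0 by rewrite gt_eqF.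
  apply/eqP; rewrite -subr_eq0; apply/eqP.
  transitivity ((1 - (a ^+ 2 + b ^+ 2)) * (s ^+ 2 - r ^+ 2) / (b ^+ 2 *+ 2)).
    by field.
  by rewrite ab subrr !mul0r.
by rewrite expRD; ring.
Qed.

Lemma ge0_integral_normal_prob_affine (f : R -> R) (a b s : R) :
  0 < b -> continuous f -> (forall x, 0 <= f x) ->
  (\int[gam]_t (f (a * s + b * t))%:E =
   \int[mu]_r (f r * (phi ((r - a * s) / b) / b))%:E)%E.
Proof.
move=> b0 cf f0.
have cphi : continuous phi by apply: continuous_normal_pdf; rewrite oner_neq0.
have mf : measurable_fun [set: R] f by exact: continuous_measurable_fun.
have cG : continuous (fun r => f r * (phi ((r - a * s) / b) / b)).
  move=> r; apply: cvgM; first exact: cf.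
  apply: cvgM; last exact: cvg_cst.
  apply: (cvg_comp (fun r => (r - a * s) / b) phi); last exact: cphi.
  apply: cvgM; last exact: cvg_cst.
  by apply: cvgB; [exact: cvg_id|exact: cvg_cst].
rewrite ge0_integral_normal_prob/=; last 2 first.
  apply/measurable_EFinP; apply: measurableT_comp => //.
  by apply: measurable_funD => //; exact: measurable_funM.
  by move=> x; rewrite lee_fin.
pose F t := a * s + b * t.
have dF (x : R) : is_derive x 1 F b.
  by rewrite /F; apply: is_derive_eq; rewrite add0r mul1r [LHS]mulr1.
have F'E : F^`()%classic = cst b.
  by apply/funext => x; rewrite derive1E derive_val.
rewrite (@increasing_ge0_integration_by_substitutionT R F _ _ _ _ _ _ _ _ cG).
- apply: eq_integral => t _ /=; rewrite F'E !fctE -EFinM; congr EFin.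
  have -> : (F t - a * s) / b = t.
    by rewrite /F addrAC subrr add0r mulrAC divff ?mul1r// gt_eqF.
  by rewrite -mulrA -mulrA mulVf ?mulr1// gt_eqF.
- by move=> x y xy; rewrite /F ltrD2l ltr_pM2l.
- by rewrite F'E => x; exact: cvg_cst.
- by rewrite F'E; exact: is_cvg_cst.
- by rewrite F'E; exact: is_cvg_cst.
- by move=> x.
- apply/cvgrNyPle => A; near=> x.
  by rewrite /F -lerBrDl [b * x]mulrC -ler_pdivlMr//.
- apply/cvgryPge => A; near=> x.
  by rewrite /F -lerBlDl [b * x]mulrC -ler_pdivrMr//.
- by move=> x; rewrite mulr_ge0// divr_ge0 ?normal_pdf_ge0// ltW.
Unshelve. all: by end_near. Qed.

(** The inner integral is moved to the variable [a * s + b * t] and the square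
    is completed, which leaves a normal density in [s] of integral one. *)
Lemma ge0_integral_normal_prob_rotation (f : R -> R) (a b : R) :
  0 < b -> a ^+ 2 + b ^+ 2 = 1 -> continuous f -> (forall x, 0 <= f x) ->
  (\int[gam]_s \int[gam]_t (f (a * s + b * t))%:E = \int[gam]_x (f x)%:E)%E.
Proof.
move=> b0 ab cf f0.
have mf : measurable_fun [set: R] f by exact: continuous_measurable_fun.
have mphi : measurable_fun [set: R] phi by exact: measurable_normal_pdf.
pose K (z : R * R) := f z.2 * (phi ((z.2 - a * z.1) / b) / b) * phi z.1.
have mK : measurable_fun [set: R * R] (EFin \o K).
  apply/measurable_EFinP; apply: measurable_funM; last exact: measurableT_comp.
  apply: measurable_funM; first exact: measurableT_comp.
  apply: measurable_funM => //; apply: measurableT_comp => //.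
  apply: measurable_funM => //; apply: measurable_funB => //.
  exact: measurable_funM.
have K0 z : (0 <= (EFin \o K) z)%E.
  by rewrite lee_fin !mulr_ge0 ?normal_pdf_ge0// invr_ge0 ltW.
transitivity (\int[mu]_s \int[mu]_r (EFin \o K) (s, r))%E; last first.
  rewrite fubini_tonelli// [RHS]ge0_integral_normal_prob; last 2 first.
    exact/measurable_EFinP.
    by move=> x; rewrite lee_fin.
  apply: eq_integral => r _ /=.
  under eq_integral => s _.
    rewrite /K/= -mulrA [_ * phi s]mulrC normal_pdf_rotation// mulrA EFinM.
    over.
  rewrite integralZl//; last exact: integrable_normal_pdf.
  by rewrite integral_normal_pdf mule1.
rewrite ge0_integral_normal_prob; last 2 first.
  apply: (@measurable_fun_fubini_tonelli_F _ _ _ _ _ gam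
            (fun z : R * R => (f (a * z.1 + b * z.2))%:E)).
    apply/measurable_EFinP; apply: measurableT_comp => //.
    by apply: measurable_funD; exact: measurable_funM.
  by move=> z; rewrite lee_fin.
  by move=> s; apply: integral_ge0 => t _; rewrite lee_fin.
apply: eq_integral => s _.
rewrite ge0_integral_normal_prob_affine// -ge0_integralZr//=; last 3 first.
- apply/measurable_EFinP; apply: measurable_funM => //.
  apply: measurable_funM => //; apply: measurableT_comp => //.
  by apply: measurable_funM => //; exact: measurable_funB.
- by move=> r _; rewrite lee_fin mulr_ge0// divr_ge0 ?normal_pdf_ge0// ltW.
- by rewrite lee_fin normal_pdf_ge0.
Qed.

End gauss.

(** * Iterated Gaussian averages *)

Section bounded_integrals.
Context d (T : measurableType d) (R : realType) (P : probability T R).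
Implicit Types f g : T -> R.

Lemma bounded_integrable f M : measurable_fun setT f ->
  (forall x, `|f x| <= M) -> P.-integrable setT (EFin \o f).
Proof.
move=> mf fM; apply: measurable_bounded_integrable => //.
  by rewrite (le_lt_trans (probability_le1 P measurableT)) ?ltry.
by exists M; split; [exact: num_real|move=> t Mt y _; exact: le_trans (fM y) (ltW Mt)].
Qed.

Lemma Rintegral_cst_prob (c : R) : \int[P]_x c = c.
Proof. by rewrite Rintegral_cst// [X in fine X](probability_setT P) mulr1. Qed.

Lemma integrable_cst_prob (c : R) : P.-integrable setT (EFin \o cst c).
Proof. exact: finite_measure_integrable_cst. Qed.

Lemma norm_Rintegral_le f M : measurable_fun setT f ->
  (forall x, `|f x| <= M) -> `|\int[P]_x f x| <= M.
Proof.
move=> mf fM; have fi := bounded_integrable mf fM.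
rewrite (le_trans (le_normr_Rintegral _ fi))// -[leRHS]Rintegral_cst_prob.
apply: le_Rintegral => //; last exact: integrable_cst_prob.
apply: (@bounded_integrable _ M); first exact: measurableT_comp.
by move=> x; rewrite normr_id.
Qed.

End bounded_integrals.

Lemma measurable_floor_eq (R : realType) (c : R) (j : int) : 0 < c ->
  measurable [set x : R | Num.floor (x * c) = j].
Proof.
move=> c0; have -> : [set x : R | Num.floor (x * c) = j] =
  `[j%:~R / c, (j + 1)%:~R / c[%classic.
  apply/seteqP; split => x /=; rewrite in_itv/= ler_pdivrMr// ltr_pdivlMr//.
    by move=> <-; exact: floor_itv.
  by move/floor_def.
exact: measurable_itv.
Qed.

Section caratheodory.
Context d (T : measurableType d) (R : realType).

(** Superposition of a Caratheodory function: rounding [X] to a grid leaves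
    countably many sections of [g], and refining the grid converges. *)
Lemma measurable_fun_caratheodory (g : R -> T -> R) (X : T -> R) :
  measurable_fun setT X -> (forall s, measurable_fun setT (g s)) ->
  (forall w, continuous (g ^~ w)) -> measurable_fun setT (fun w => g (X w) w).
Proof.
move=> mX mg cg.
pose r (k : nat) (x : R) : R := (Num.floor (x * k.+1%:R))%:~R / k.+1%:R.
have r_cvg x : r k x @[k --> \oo] --> x.
  have h1 : x - harmonic k @[k --> \oo] --> x.
    by rewrite -[X in _ --> X]subr0; apply: cvgB; [exact: cvg_cst|exact: cvg_harmonic].
  apply: (squeeze_cvgr _ h1 (cvg_cst x)); near=> k.
  have k0 : 0 < k.+1%:R :> R by [].
  have /andP[fl fu] := floor_itv (x * k.+1%:R).
  rewrite /r ler_pdivrMr// fl andbT /harmonic ler_pdivlMr// mulrBl mulVf ?gt_eqF//.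
  by rewrite lerBlDr -intrD1 ltW.
apply: (@measurable_fun_cvg _ _ _ _ (fun k w => g (r k (X w)) w)); last first.
  move=> w _; apply: (cvg_comp (fun k => r k (X w)) (g ^~ w)); last exact: cg.
  exact: r_cvg.
move=> k _ Y mY; rewrite setTI.
have -> : (fun w => g (r k (X w)) w) @^-1` Y =
    \bigcup_(i : int) ((X @^-1` [set x | Num.floor (x * k.+1%:R) = i]) `&`
                       (g (i%:~R / k.+1%:R) @^-1` Y)).
  apply/seteqP; split => w /=; first by exists (Num.floor (X w * k.+1%:R)).
  by move=> [i _ [/= <-]].
apply: countable_bigcupT_measurable => [|i]; first exact: countableP.
apply: measurableI; last by rewrite -[X in measurable X]setTI; exact: mg.
rewrite -[X in measurable X]setTI; apply: mX => //.
exact: measurable_floor_eq.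
Unshelve. all: by end_near. Qed.

End caratheodory.

Section gauss_average.
Variables (R : realType) (V : lmodType R).
Local Notation gam := (@normal_prob R 0 1).
Implicit Types (f g : V -> R) (v w z : V).

(** The class on which Gaussian averages are computed.  It is stable under them
    and under products, and its members are continuous along lines, which
    yields measurability.  The constant depends on the direction [v], so that
    [V] may be any module. *)
Definition bounded_lipschitz f :=
  (exists M, forall z, `|f z| <= M) /\
  (forall v, exists L, forall z s, `|f (z + s *: v) - f z| <= L * `|s|).

(** The heat operator in the single direction [v]. *)
Definition gauss_avg v f z : R := \int[gam]_s f (z + s *: v).

Lemma lipschitz_continuous (h : R -> R) L :
  (forall x y, `|h x - h y| <= L * `|x - y|) -> continuous h.
Proof.
move=> hL x; apply/cvgrPdist_le => e e0; near=> y.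
rewrite (le_trans (hL _ _))// (@le_trans _ _ ((`|L| + 1) * `|x - y|))//.
  by rewrite ler_wpM2r// (le_trans (ler_norm L))// lerDl.
rewrite mulrC -ler_pdivlMr ?ltr_pwDr//.
by near: y; apply: (@cvgr_dist_le _ _ _ _ _ id) => //; rewrite divr_gt0 ?ltr_pwDr.
Unshelve. all: by end_near. Qed.

Lemma bl_line_continuous f z v : bounded_lipschitz f ->
  continuous (fun s : R => f (z + s *: v) : R).
Proof.
move=> [_ /(_ v)[L fL]]; apply: (@lipschitz_continuous _ L) => x y.
have -> : z + x *: v = z + y *: v + (x - y) *: v by rewrite -addrA -scalerDl subrKC.
exact: fL.
Qed.

Lemma bl_line_measurable f z v : bounded_lipschitz f ->
  measurable_fun setT (fun s : R => f (z + s *: v)).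
Proof. by move=> fbl; apply: continuous_measurable_fun; exact: bl_line_continuous. Qed.

Lemma bl_line_integrable f z v : bounded_lipschitz f ->
  gam.-integrable setT (EFin \o (fun s : R => f (z + s *: v))).
Proof.
move=> fbl; have [[M fM] _] := fbl.
by apply: (@bounded_integrable _ _ _ _ _ M) => //; exact: bl_line_measurable.
Qed.

Lemma bl_cst c : bounded_lipschitz (fun=> c).
Proof.
split; first by exists `|c|.
by move=> v; exists 0 => z s; rewrite subrr normr0 mul0r.
Qed.

Lemma blD f g : bounded_lipschitz f -> bounded_lipschitz g ->
  bounded_lipschitz (fun z => f z + g z).
Proof.
move=> [[M fM] fL] [[N gN] gL]; split.
  by exists (M + N) => z; rewrite (le_trans (ler_normD _ _))// lerD.
move=> v; have [L {}fL] := fL v; have [K {}gL] := gL v; exists (L + K) => z s.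
by rewrite opprD addrACA (le_trans (ler_normD _ _))// mulrDl lerD.
Qed.

Lemma blM f g : bounded_lipschitz f -> bounded_lipschitz g ->
  bounded_lipschitz (fun z => f z * g z).
Proof.
move=> [[M fM] fL] [[N gN] gL]; split.
  by exists (M * N) => z; rewrite normrM ler_pM.
move=> v; have [L {}fL] := fL v; have [K {}gL] := gL v; exists (M * K + L * N) => z s.
have -> : f (z + s *: v) * g (z + s *: v) - f z * g z =
  f (z + s *: v) * (g (z + s *: v) - g z) + (f (z + s *: v) - f z) * g z by ring.
have -> : (M * K + L * N) * `|s| = M * (K * `|s|) + L * `|s| * N by ring.
rewrite (le_trans (ler_normD _ _))// !normrM.
by rewrite lerD// ler_pM.
Qed.

Lemma blZ c f : bounded_lipschitz f -> bounded_lipschitz (fun z => c * f z).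
Proof. by move=> fbl; apply: blM => //; exact: bl_cst. Qed.

Lemma blN f : bounded_lipschitz f -> bounded_lipschitz (fun z => - f z).
Proof. by move=> /(blZ (-1)); congr bounded_lipschitz; apply/funext => z; rewrite mulN1r. Qed.

Lemma blB f g : bounded_lipschitz f -> bounded_lipschitz g ->
  bounded_lipschitz (fun z => f z - g z).
Proof. by move=> fbl gbl; apply: blD => //; exact: blN. Qed.

Lemma bl_sum (I : Type) (r : seq I) (F : I -> V -> R) :
  (forall i, bounded_lipschitz (F i)) ->
  bounded_lipschitz (fun z => \sum_(i <- r) F i z).
Proof.
move=> Fbl; elim: r => [|i r ih].
  by under eq_fun do rewrite big_nil; exact: bl_cst.
by under eq_fun do rewrite big_cons; exact: blD.
Qed.

Lemma gauss_avg_cst v c : gauss_avg v (fun=> c) = (fun=> c).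
Proof. by apply/funext => z; rewrite /gauss_avg Rintegral_cst_prob. Qed.

Lemma gauss_avgD v f g z : bounded_lipschitz f -> bounded_lipschitz g ->
  gauss_avg v (fun z => f z + g z) z = gauss_avg v f z + gauss_avg v g z.
Proof.
by move=> fbl gbl; rewrite /gauss_avg RintegralD//; exact: bl_line_integrable.
Qed.

Lemma gauss_avgB v f g z : bounded_lipschitz f -> bounded_lipschitz g ->
  gauss_avg v (fun z => f z - g z) z = gauss_avg v f z - gauss_avg v g z.
Proof.
by move=> fbl gbl; rewrite /gauss_avg RintegralB//; exact: bl_line_integrable.
Qed.

Lemma le_gauss_avg v f g z : bounded_lipschitz f -> bounded_lipschitz g ->
  (forall z, f z <= g z) -> gauss_avg v f z <= gauss_avg v g z.
Proof.
by move=> fbl gbl fg; apply: le_Rintegral => //; exact: bl_line_integrable.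
Qed.

Lemma norm_gauss_avg_le v f M z : bounded_lipschitz f ->
  (forall z, `|f z| <= M) -> `|gauss_avg v f z| <= M.
Proof.
by move=> fbl fM; apply: norm_Rintegral_le => //; exact: bl_line_measurable.
Qed.

Lemma bl_shift f v : bounded_lipschitz f -> bounded_lipschitz (fun z => f (z + v)).
Proof.
move=> [[M fM] fL]; split; first by exists M.
by move=> w; have [L {}fL] := fL w; exists L => z s; rewrite addrAC.
Qed.

Lemma gauss_avg_shift v f z w : gauss_avg v f (z + w) = gauss_avg v (fun z => f (z + w)) z.
Proof. by rewrite /gauss_avg; apply: eq_Rintegral => s _; rewrite addrAC. Qed.

Lemma bl_gauss_avg v f : bounded_lipschitz f -> bounded_lipschitz (gauss_avg v f).
Proof.
move=> fbl; have [[M fM] fL] := fbl; split.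
  by exists M => z; exact: norm_gauss_avg_le.
move=> w; have [L {}fL] := fL w; exists L => z s.
rewrite gauss_avg_shift -gauss_avgB//; last exact: bl_shift.
by apply: norm_gauss_avg_le => //; apply: blB => //; exact: bl_shift.
Qed.

Lemma bl_plane_measurable f z v w : bounded_lipschitz f ->
  measurable_fun setT (fun p : R * R => f (z + p.1 *: v + p.2 *: w)).
Proof.
move=> fbl.
apply: (@measurable_fun_caratheodory _ _ _ (fun s (p : R * R) => f (z + s *: v + p.2 *: w))).
- exact: measurable_fst.
- move=> s; exact: (measurableT_comp (bl_line_measurable (z + s *: v) w fbl) measurable_snd).
- move=> p; under eq_fun do rewrite addrAC.
  exact: bl_line_continuous.
Qed.

Lemma EFin_gauss_avg v f z : bounded_lipschitz f ->
  (gauss_avg v f z)%:E = (\int[gam]_s (f (z + s *: v))%:E)%E.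
Proof.
by move=> fbl; rewrite fineK//; apply: integrable_fin_num => //; exact: bl_line_integrable.
Qed.

(** Tonelli's theorem, after a constant is added to make [f] nonnegative. *)
Lemma gauss_avgC v w f z : bounded_lipschitz f ->
  gauss_avg v (gauss_avg w f) z = gauss_avg w (gauss_avg v f) z.
Proof.
move=> fbl; have [[M fM] _] := fbl.
have ge0_avgC g : bounded_lipschitz g -> (forall z, 0 <= g z) ->
    gauss_avg v (gauss_avg w g) z = gauss_avg w (gauss_avg v g) z.
  move=> gbl g0; apply: EFin_inj.
  rewrite !EFin_gauss_avg; [|exact: bl_gauss_avg..].
  under eq_integral do rewrite EFin_gauss_avg//.
  under [RHS]eq_integral do rewrite EFin_gauss_avg//.
  have -> := @fubini_tonelli _ _ _ _ R gam gam
    (fun p : R * R => (g (z + p.1 *: v + p.2 *: w))%:E).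
  - by apply: eq_integral => t _; apply: eq_integral => s _; rewrite /= addrAC.
  - by apply/measurable_EFinP; exact: bl_plane_measurable.
  - by move=> p; rewrite lee_fin.
have fE u x : gauss_avg u f x = gauss_avg u (fun z => f z + M) x - M.
  by rewrite gauss_avgD ?gauss_avg_cst ?addrK//; exact: bl_cst.
have bl1 : bounded_lipschitz (fun z => f z + M) by apply: blD => //; exact: bl_cst.
have -> : gauss_avg v f = fun x => gauss_avg v (fun z => f z + M) x - M by apply/funext.
have -> : gauss_avg w f = fun x => gauss_avg w (fun z => f z + M) x - M by apply/funext.
rewrite !gauss_avgB ?gauss_avg_cst; try exact: bl_gauss_avg; try exact: bl_cst.
rewrite ge0_avgC// => x; rewrite -lerBlDr sub0r.
by have := fM x; rewrite ler_norml => /andP[].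
Qed.

(** Independent Gaussian steps along one line add up to a Gaussian step whose
    variance is the sum of theirs. *)
Lemma gauss_avg_rotation a b v f z : 0 < b -> a ^+ 2 + b ^+ 2 = 1 ->
  bounded_lipschitz f ->
  gauss_avg (a *: v) (gauss_avg (b *: v) f) z = gauss_avg v f z.
Proof.
move=> b0 ab fbl; have [[M fM] _] := fbl.
have ge0_avg g : bounded_lipschitz g -> (forall z, 0 <= g z) ->
    gauss_avg (a *: v) (gauss_avg (b *: v) g) z = gauss_avg v g z.
  move=> gbl g0; apply: EFin_inj.
  rewrite !EFin_gauss_avg//; last exact: bl_gauss_avg.
  rewrite -[RHS](ge0_integral_normal_prob_rotation b0 ab)//; last exact: bl_line_continuous.
  apply: eq_integral => s _; rewrite EFin_gauss_avg//; apply: eq_integral => t _.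
  by congr (g _)%:E; rewrite -addrA !scalerA -scalerDl [s * a]mulrC [t * b]mulrC.
have fE u x : gauss_avg u f x = gauss_avg u (fun z => f z + M) x - M.
  by rewrite gauss_avgD ?gauss_avg_cst ?addrK//; exact: bl_cst.
have bl1 : bounded_lipschitz (fun z => f z + M) by apply: blD => //; exact: bl_cst.
have -> : gauss_avg (b *: v) f = fun x => gauss_avg (b *: v) (fun z => f z + M) x - M.
  exact/funext.
rewrite gauss_avgB ?gauss_avg_cst ?fE; [|exact: bl_gauss_avg|exact: bl_cst].
rewrite ge0_avg// => x; rewrite -lerBlDr sub0r.
by have := fM x; rewrite ler_norml => /andP[].
Qed.

(** Expectation of [f (z + \sum_(v <- l) s_v *: v)] over independent standard
    normal weights [s_v]. *)
Definition gauss_avgs (l : seq V) f := foldr gauss_avg f l.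

Lemma bl_gauss_avgs l f : bounded_lipschitz f -> bounded_lipschitz (gauss_avgs l f).
Proof. by move=> fbl; elim: l => //= v l; exact: bl_gauss_avg. Qed.

Lemma gauss_avgsB l f g : bounded_lipschitz f -> bounded_lipschitz g ->
  gauss_avgs l (fun z => f z - g z) = (fun z => gauss_avgs l f z - gauss_avgs l g z).
Proof.
move=> fbl gbl; elim: l => //= v l ->; apply/funext => z.
by rewrite gauss_avgB//; exact: bl_gauss_avgs.
Qed.

Lemma gauss_avgsD l f g : bounded_lipschitz f -> bounded_lipschitz g ->
  gauss_avgs l (fun z => f z + g z) = (fun z => gauss_avgs l f z + gauss_avgs l g z).
Proof.
move=> fbl gbl; elim: l => //= v l ->; apply/funext => z.
by rewrite gauss_avgD//; exact: bl_gauss_avgs.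
Qed.

Lemma gauss_avgs_cst l c : gauss_avgs l (fun=> c) = (fun=> c).
Proof. by elim: l => //= v l ->; exact: gauss_avg_cst. Qed.

Lemma le_gauss_avgs l f g z : bounded_lipschitz f -> bounded_lipschitz g ->
  (forall z, f z <= g z) -> gauss_avgs l f z <= gauss_avgs l g z.
Proof.
move=> fbl gbl fg; elim: l z => //= v l ih z.
by apply: le_gauss_avg => //; exact: bl_gauss_avgs.
Qed.

Lemma gauss_avgsCl v l f : bounded_lipschitz f ->
  gauss_avg v (gauss_avgs l f) = gauss_avgs l (gauss_avg v f).
Proof.
move=> fbl; elim: l => //= w l <-; apply/funext => z.
by rewrite gauss_avgC//; exact: bl_gauss_avgs.
Qed.

Lemma gauss_avgsC l1 l2 f : bounded_lipschitz f ->
  gauss_avgs l1 (gauss_avgs l2 f) = gauss_avgs l2 (gauss_avgs l1 f).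
Proof.
move=> fbl; elim: l1 => //= v l1 ->.
by rewrite gauss_avgsCl//; exact: bl_gauss_avgs.
Qed.

End gauss_average.

(** * Gaussian moments *)

Section exp_bounds.
Variable R : realType.
Implicit Types t x : R.

Lemma norm_expRB1_le t : `|expR t - 1| <= `|t| * expR `|t|.
Proof.
have h s : 0 <= s -> `|expR s - 1| <= s * expR s.
  move=> s0; rewrite ger0_norm; last by rewrite subr_ge0 -expR0 ler_expR.
  have /(ler_wpM2r (expR_ge0 s)) := expR_ge1Dx (- s).
  by rewrite expRN mulVf ?gt_eqF ?expR_gt0// mulrDl mulNr mul1r; lra.
have [t0|t0] := leP 0 t; first by rewrite [in leRHS](ger0_norm t0) h.
rewrite ltr0_norm; last by rewrite subr_lt0 -expR0 ltr_expR.
rewrite (ltr0_norm t0) opprB.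
have := expR_ge1Dx t; have : - t <= - t * expR (- t).
  by rewrite ler_peMr ?oppr_ge0 ?ltW// -expR0 ltr_expR oppr_gt0.
lra.
Qed.

Lemma norm_expRB2_le t : `|expR t - 1 - t| <= t ^+ 2 * expR `|t|.
Proof.
rewrite ger0_norm; last by have := expR_ge1Dx t; lra.
have h : expR t - 1 - t <= t * (expR t - 1).
  have /(ler_wpM2r (expR_ge0 t)) := expR_ge1Dx (- t).
  by rewrite expRN mulVf ?gt_eqF ?expR_gt0// mulrDl mulNr mul1r; lra.
rewrite (le_trans h)// (le_trans (ler_norm _))// normrM -(real_normK (num_real t)) expr2.
by rewrite -mulrA ler_wpM2l// norm_expRB1_le.
Qed.

Lemma norm_expRB3_le t : `|expR t - 1 - t - t ^+ 2 / 2| <= `|t| ^+ 3 * expR `|t|.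
Proof.
pose F x : R := expR x - 1 - x - x ^+ 2 / 2.
have dF x : is_derive x 1 F (expR x - 1 - x).
  rewrite /F; apply: is_derive_eq.
  by rewrite !scaler0 add0r /GRing.scale/=; field.
have mvt x y : x <= y -> exists2 c, x <= c <= y & F y - F x = (expR c - 1 - c) * (y - x).
  move=> xy; have [|c] := @MVT_segment R F (fun x => expR x - 1 - x) x y xy.
  - by apply: derivable_within_continuous => z _; exact: (@ex_derive _ _ _ _ _ _ _ (dF z)).
  - by rewrite in_itv/= => ? ?; exists c.
have F0 : F 0 = 0 by rewrite /F expR0; lra.
have bound c : `|c| <= `|t| -> `|(expR c - 1 - c) * t| <= `|t| ^+ 3 * expR `|t|.
  move=> ct; rewrite normrM exprSr mulrAC ler_wpM2r//.
  rewrite (le_trans (norm_expRB2_le _))// ler_pM ?sqr_ge0 ?expR_ge0 ?ler_expR//.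
  by rewrite -(real_normK (num_real c)) lerXn2r// nnegrE.
rewrite -/(F t); have [t0|t0] := leP 0 t.
  have [c /andP[c0 ct]] := mvt _ _ t0; rewrite F0 !subr0 => ->.
  by apply: bound; rewrite !ger0_norm.
have [c /andP[c0 ct]] := mvt _ _ (ltW t0); rewrite F0 !sub0r mulrN => /oppr_inj ->.
by apply: bound; rewrite !ler0_norm ?lerN2// ltW.
Qed.
End exp_bounds.

Section real_integrable.
Context d (T : measurableType d) (R : realType) (m : {measure set T -> \bar R}).
Implicit Types f g : T -> R.

Lemma integrable_EFinZ f (c : R) : m.-integrable setT (EFin \o f) ->
  m.-integrable setT (EFin \o (fun x => c * f x)).
Proof. by move=> fi; exact: (@integrableZl _ _ _ _ _ measurableT c _ fi). Qed.

Lemma integrable_EFinD f g : m.-integrable setT (EFin \o f) ->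
  m.-integrable setT (EFin \o g) -> m.-integrable setT (EFin \o (fun x => f x + g x)).
Proof. by move=> fi gi; exact: (integrableD measurableT fi gi). Qed.

Lemma integrable_EFinB f g : m.-integrable setT (EFin \o f) ->
  m.-integrable setT (EFin \o g) -> m.-integrable setT (EFin \o (fun x => f x - g x)).
Proof. by move=> fi gi; exact: (integrableB measurableT fi gi). Qed.

End real_integrable.

Section gauss_moments.
Variable R : realType.
Local Notation gam := (@normal_prob R 0 1).
Local Notation mu := (@lebesgue_measure R).

Lemma normal_prob_mgf (c : R) :
  (\int[gam]_x (expR (c * x))%:E = (expR (c ^+ 2 / 2))%:E)%E.
Proof.
rewrite ge0_integral_normal_prob; last 2 first.
- by apply/measurable_EFinP; apply: measurableT_comp => //; exact: measurable_funM.
- by move=> x; rewrite lee_fin expR_ge0.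
transitivity (\int[mu]_x ((expR (c ^+ 2 / 2))%:E * (normal_pdf c 1 x)%:E))%E.
  apply: eq_integral => x _; rewrite -!EFinM; congr EFin.
  rewrite !normal_pdfE ?oner_neq0// /normal_peak /normal_fun.
  rewrite mulrCA [RHS]mulrCA -!expRD; congr (_ * expR _).
  by rewrite !expr1n; field.
by rewrite integralZl//; [rewrite integral_normal_pdf mule1|exact: integrable_normal_pdf].
Qed.

Lemma normal_prob_sqr_mgf (c : R) : 0 <= c < 1 ->
  (\int[gam]_x (expR (c / 2 * x ^+ 2))%:E = (Num.sqrt (1 - c))^-1%:E)%E.
Proof.
move=> /andP[c0 c1].
have c1' : 0 < 1 - c by rewrite subr_gt0.
have s0 : 0 < Num.sqrt (1 - c) by rewrite sqrtr_gt0.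
rewrite ge0_integral_normal_prob; last 2 first.
- apply/measurable_EFinP; apply: measurableT_comp => //.
  by apply: measurable_funM => //; exact: exprn_measurable.
- by move=> x; rewrite lee_fin expR_ge0.
set s := (Num.sqrt _)^-1; have sn : s != 0 by rewrite invr_eq0 gt_eqF.
transitivity (\int[mu]_x (s%:E * (normal_pdf 0 s x)%:E))%E.
  apply: eq_integral => x _; rewrite -!EFinM; congr EFin.
  rewrite !normal_pdfE ?oner_neq0// /normal_peak /normal_fun.
  rewrite mulrCA [RHS]mulrA -expRD; congr (_ * expR _).
    rewrite expr1n mul1r -[in RHS]mulrnAr sqrtrM ?sqr_ge0// sqrtr_sqr gtr0_norm ?invr_gt0//.
    by rewrite invfM mulrA divff// mul1r.
  rewrite subr0 expr1n /s exprVn sqr_sqrtr ?ltW//; field.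
  by rewrite gt_eqF.
by rewrite integralZl//; [rewrite integral_normal_pdf mule1|exact: integrable_normal_pdf].
Qed.

Lemma normal_prob_integrable_expR (c : R) :
  gam.-integrable setT (EFin \o (fun x => expR (c * x))).
Proof.
apply/integrableP; split.
  by apply/measurable_EFinP; apply: measurableT_comp => //; exact: measurable_funM.
under eq_integral do rewrite /= ger0_norm ?expR_ge0//.
by rewrite normal_prob_mgf ltry.
Qed.

Lemma normal_prob_integrable_expR_sqr (c : R) : c < 1 / 2 ->
  gam.-integrable setT (EFin \o (fun x => expR (c * x ^+ 2))).
Proof.
move=> c2; have mf (k : R) : measurable_fun setT (fun x : R => expR (k * x ^+ 2)).
  apply: measurableT_comp => //.
  by apply: measurable_funM => //; exact: exprn_measurable.
have h (k : R) : 0 <= k < 1 -> gam.-integrable setT (EFin \o (fun x : R => expR (k / 2 * x ^+ 2))).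
  move=> k01; apply/integrableP; split; first by apply/measurable_EFinP; exact: mf.
  under eq_integral do rewrite /= ger0_norm ?expR_ge0//.
  by rewrite normal_prob_sqr_mgf// ltry.
have [c0|c0] := leP 0 c.
  have := h (c * 2); rewrite mulfK//; apply; apply/andP; split; lra.
apply: le_integrable (h 0 _) => //; first by apply/measurable_EFinP; exact: mf.
- move=> x _; rewrite /= !ger0_norm ?expR_ge0// lee_fin ler_expR mul0r mul0r.
  by rewrite nmulr_rle0// sqr_ge0.
- by rewrite lexx ltr01.
Qed.

Lemma normal_prob_integrable_le_expR (f : R -> R) (K c : R) :
  measurable_fun setT f -> (forall x, `|f x| <= K * expR (c * `|x|)) ->
  gam.-integrable setT (EFin \o f).
Proof.
move=> mf fK.
have ig : gam.-integrable setT
    (EFin \o (fun x => `|K| * (expR (`|c| * x) + expR (- `|c| * x)))).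
  rewrite (_ : _ \o _ = fun x => (`|K|%:E *
    ((EFin \o (fun x => expR (`|c| * x))) x + (EFin \o (fun x => expR (- `|c| * x))) x))%E)//.
  apply: integrableZl => //; apply: integrableD => //; exact: normal_prob_integrable_expR.
apply: le_integrable ig => //; first exact/measurable_EFinP.
move=> x _; rewrite lee_fin (le_trans (fK x))// ger0_norm; last first.
  by rewrite mulr_ge0// addr_ge0 ?expR_ge0.
apply: (@le_trans _ _ (`|K| * expR (c * `|x|))); first by rewrite ler_wpM2r ?ler_norm ?expR_ge0.
rewrite ler_wpM2l//.
have [x0|x0] := leP 0 x.
  apply: (@le_trans _ _ (expR (`|c| * x))); last by rewrite lerDl expR_ge0.
  by rewrite ler_expR ger0_norm// ler_wpM2r ?ler_norm.
apply: (@le_trans _ _ (expR (- `|c| * x))); last by rewrite lerDr expR_ge0.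
by rewrite ler_expR ltr0_norm// mulrN mulNr lerN2 ler_wnM2r ?ler_norm// ltW.
Qed.

Lemma cube_le_expR (x : R) : 0 <= x -> x ^+ 3 <= 27 * expR x.
Proof.
move=> x0; have h : x / 3 <= expR (x / 3) by have := expR_ge1Dx (x / 3); lra.
have -> : expR x = expR (x / 3) ^+ 3 by rewrite -expRM_natl; congr expR; field.
have -> : x ^+ 3 = 27 * (x / 3) ^+ 3 by field.
by rewrite ler_pM2l// lerXn2r// nnegrE ?expR_ge0//; lra.
Qed.

Lemma normal_prob_integrable_id : gam.-integrable setT (EFin \o (id : R -> R)).
Proof.
apply: (@normal_prob_integrable_le_expR _ 1 1) => // x; rewrite !mul1r.
by have := expR_ge1Dx `|x|; rewrite /=; lra.
Qed.

Lemma normal_prob_integrable_sqr : gam.-integrable setT (EFin \o (fun x : R => x ^+ 2)).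
Proof.
apply: (@normal_prob_integrable_le_expR _ 4 1) => [|x]; first exact: exprn_measurable.
rewrite mul1r ger0_norm ?sqr_ge0// -(real_normK (num_real x)).
set y := `|x|; have y0 : 0 <= y by exact: normr_ge0.
have h : y / 2 <= expR (y / 2) by have := expR_ge1Dx (y / 2); lra.
have -> : expR y = expR (y / 2) ^+ 2 by rewrite -expRM_natl; congr expR; field.
have -> : y ^+ 2 = 4 * (y / 2) ^+ 2 by field.
by rewrite ler_pM2l// lerXn2r// nnegrE ?expR_ge0//; lra.
Qed.

(** The first moment is the derivative at the origin of the moment generating
    function [expR (c ^+ 2 / 2)], which [expR_ge1Dx] bounds from both sides. *)
Lemma normal_prob_mean : \int[gam]_x x = 0.
Proof.
have ii := normal_prob_integrable_id.
have h c : 1 + c * (\int[gam]_x x) <= expR (c ^+ 2 / 2).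
  have -> : expR (c ^+ 2 / 2) = \int[gam]_x expR (c * x).
    by rewrite /Rintegral normal_prob_mgf.
  rewrite -RintegralZl// -[X in X + _](@Rintegral_cst_prob _ _ _ gam 1) -RintegralD//; last 2 first.
  - exact: integrable_cst_prob.
  - exact: integrable_EFinZ.
  apply: le_Rintegral => //; last by move=> x _; exact: expR_ge1Dx.
  - by apply: integrable_EFinD; [exact: integrable_cst_prob|exact: integrable_EFinZ].
  - exact: normal_prob_integrable_expR.
set m := \int[gam]_x x in h *.
(* For this [c] the bound becomes [2 * b * c ^+ 2 <= c ^+ 2] with [b >= 1],
   which forces [c = 0]. *)
pose b := `|m| + 1; have b1 : 1 <= b by rewrite lerDr.
pose c := m / (b + b).
have c1 : c ^+ 2 <= 1 / 4.
  have -> : c ^+ 2 = `|m| ^+ 2 / (b + b) ^+ 2 by rewrite /c expr_div_n real_normK// num_real.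
  rewrite ler_pdivrMr ?exprn_gt0//; last by lra.
  by have := normr_ge0 m; rewrite /b; nra.
have cm : c * m <= c ^+ 2.
  have := h c; have /(ler_wpM2r (expR_ge0 (c ^+ 2 / 2))) := expR_ge1Dx (- (c ^+ 2 / 2)).
  by rewrite expRN mulVf ?gt_eqF ?expR_gt0//; set e := expR _; have := sqr_ge0 c; nra.
have mE : m = c * (b + b) by rewrite /c divfK// gt_eqF//; lra.
have c0 : c ^+ 2 = 0 by move: cm; rewrite {1}mE mulrA -expr2; have := sqr_ge0 c; nra.
by apply/eqP; rewrite mE mulf_eq0 -sqrf_eq0 c0 eqxx.
Qed.

(** The inequality [1 + y <= expR y] compares the second moment with the moment
    generating function of the square, which is explicit. *)
Lemma normal_prob_second_moment_le1 : \int[gam]_x (x ^+ 2) <= 1.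
Proof.
set M := \int[gam]_x _; rewrite leNgt; apply/negP => M1.
(* A small [c]: to first order in [c] the comparison reads [M <= 1]. *)
pose c := (M - 1) / (2 * M).
have cM : 2 * M * c = M - 1 by rewrite /c mulrC divfK// gt_eqF//; lra.
have /andP[c0 c1] : 0 < c < 1.
  by rewrite /c divr_gt0 ?ltr_pdivrMr ?mul1r//=; lra.
have ii := normal_prob_integrable_sqr.
have : 1 + c / 2 * M <= (Num.sqrt (1 - c))^-1.
  have -> : (Num.sqrt (1 - c))^-1 = \int[gam]_x expR (c / 2 * x ^+ 2).
    by rewrite /Rintegral normal_prob_sqr_mgf// ltW.
  rewrite -RintegralZl// -[X in X + _](@Rintegral_cst_prob _ _ _ gam 1) -RintegralD//; last 2 first.
  - exact: integrable_cst_prob.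
  - exact: integrable_EFinZ.
  apply: le_Rintegral => //; last by move=> x _; exact: expR_ge1Dx.
  - by apply: integrable_EFinD; [exact: integrable_cst_prob|exact: integrable_EFinZ].
  - by apply: normal_prob_integrable_expR_sqr; lra.
have s0 : 0 < Num.sqrt (1 - c) by rewrite sqrtr_gt0 subr_gt0.
have s2 : Num.sqrt (1 - c) ^+ 2 = 1 - c by rewrite sqr_sqrtr// subr_ge0 ltW.
rewrite -[leRHS]div1r ler_pdivlMr// => h.
have : (1 + c / 2 * M) ^+ 2 * (1 - c) <= 1.
  by rewrite -s2 -exprMn exprn_ile1// mulr_ge0 ?ltW//; nra.
nra.
Qed.

End gauss_moments.

(** * Second order expansion of a smooth step function *)

Section soft_step.
Variables (R : realType) (N : nat) (a b : R).
Hypothesis b0 : 0 < b.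
Local Notation V := 'rV[R]_N.
Local Notation gam := (@normal_prob R 0 1).
Implicit Types (z v : V) (s : R).

(** A smooth version of the indicator that all coordinates of [z] stay below
    the level [a]; it sharpens as [b] grows. *)
Definition soft_step z : R := (1 + \sum_i expR (b * (z 0 i - a)))^-1.

(** The gradient of [soft_step] is [- b * soft_step z] times these weights. *)
Definition gibbs i z : R := expR (b * (z 0 i - a)) * soft_step z.

Lemma soft_step_gt0 z : 0 < soft_step z.
Proof. by rewrite invr_gt0 ltr_pwDl// sumr_ge0// => i _; exact: expR_ge0. Qed.

Lemma soft_step_le1 z : soft_step z <= 1.
Proof.
rewrite invf_le1 ?lerDl ?ltr_pwDl//; apply: sumr_ge0 => i _; exact: expR_ge0.
Qed.

Lemma gibbs_ge0 i z : 0 <= gibbs i z.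
Proof. by rewrite mulr_ge0 ?expR_ge0// ltW// soft_step_gt0. Qed.

Lemma sum_gibbs z : soft_step z + \sum_i gibbs i z = 1.
Proof.
rewrite -mulr_suml -{1}[soft_step z]mul1r -mulrDl divff// gt_eqF//.
by have := soft_step_gt0 z; rewrite invr_gt0.
Qed.

Lemma sum_gibbs_le1 z : \sum_i gibbs i z <= 1.
Proof. by have := sum_gibbs z; have := soft_step_gt0 z; lra. Qed.

Lemma gibbs_le1 i z : gibbs i z <= 1.
Proof.
apply: le_trans (sum_gibbs_le1 z); rewrite (bigD1 i)//= lerDl.
by apply: sumr_ge0 => j _; exact: gibbs_ge0.
Qed.

(** The denominator of [soft_step] at [z + s *: v], divided by the one at [z].
    In this form all estimates along the line are uniform in [z]. *)
Definition gibbs_ratio z v s := soft_step z + \sum_i gibbs i z * expR (b * s * v 0 i).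

Lemma soft_step_line z v s : soft_step (z + s *: v) = soft_step z / gibbs_ratio z v s.
Proof.
have E : 1 + \sum_i expR (b * ((z + s *: v) 0 i - a)) = gibbs_ratio z v s / soft_step z.
  rewrite /gibbs_ratio mulrDl divff ?gt_eqF ?soft_step_gt0//; congr +%R.
  rewrite mulr_suml; apply: eq_bigr => i _.
  rewrite mulrAC /gibbs mulfK ?gt_eqF ?soft_step_gt0//.
  by rewrite -expRD !mxE; congr expR; ring.
by rewrite {1}/soft_step E invf_div.
Qed.

Section direction.
Variables (v : V) (K : R).
Hypotheses (K0 : 0 <= K) (vK : forall i, `|v 0 i| <= K).

Lemma tilt_bound s i : `|b * s * v 0 i| <= b * `|s| * K.
Proof. by rewrite !normrM (gtr0_norm b0) ler_wpM2l// mulr_ge0// ltW. Qed.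

Lemma gibbs_ratio_ge z s : expR (- (b * `|s| * K)) <= gibbs_ratio z v s.
Proof.
rewrite -[leLHS]mul1r -(sum_gibbs z) mulrDl mulr_suml lerD//.
  have e1 : expR (- (b * `|s| * K)) <= 1.
    by rewrite -expR0 ler_expR oppr_le0 !mulr_ge0// ltW.
  by rewrite ler_piMr// ltW// soft_step_gt0.
apply: ler_sum => i _; rewrite ler_wpM2l ?gibbs_ge0// ler_expR.
by have := tilt_bound s i; rewrite ler_norml => /andP[].
Qed.

Lemma gibbs_ratio_gt0 z s : 0 < gibbs_ratio z v s.
Proof. exact: lt_le_trans (expR_gt0 _) (gibbs_ratio_ge z s). Qed.

Lemma soft_step_line_le z s : soft_step (z + s *: v) <= expR (b * K * `|s|) * soft_step z.
Proof.
rewrite soft_step_line mulrC ler_wpM2r//; first exact/ltW/soft_step_gt0.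
rewrite -[expR _]invrK lef_pV2 ?posrE ?gibbs_ratio_gt0 ?invr_gt0 ?expR_gt0//.
by rewrite -expRN mulrAC gibbs_ratio_ge.
Qed.

Lemma gibbs_line_le i z s : gibbs i (z + s *: v) <= expR (2 * (b * K) * `|s|) * gibbs i z.
Proof.
have -> : 2 * (b * K) * `|s| = b * K * `|s| + b * K * `|s| by ring.
rewrite /gibbs expRD mulrACA ler_pM ?expR_ge0 ?soft_step_line_le//.
  exact/ltW/soft_step_gt0.
rewrite -expRD ler_expR !mxE; have := tilt_bound s i; rewrite ler_norml => /andP[_].
lra.
Qed.

(** A logarithmic Lipschitz bound for a function with values in [0, 1] gives a
    Lipschitz bound: apply it in both directions along the segment. *)
Lemma lipschitz_of_ratio (f : V -> R) c : 0 <= c -> (forall z, 0 <= f z <= 1) ->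
  (forall z s, f (z + s *: v) <= expR (c * `|s|) * f z) ->
  forall z s, `|f (z + s *: v) - f z| <= c * `|s|.
Proof.
move=> c0 f01 fc.
have half z s : f (z + s *: v) - f z <= c * `|s|.
  have /(ler_wpM2l (expR_ge0 (- (c * `|s|)))) := fc z s.
  rewrite mulrA -expRD addNr expR0 mul1r.
  have := expR_ge1Dx (- (c * `|s|)); have /andP[] := f01 z; have /andP[] := f01 (z + s *: v).
  have : 0 <= c * `|s| by rewrite mulr_ge0.
  by set e := expR _; set y := c * _; nra.
move=> z s; rewrite ler_norml half andbT.
have := half (z + s *: v) (- s); rewrite normrN scaleNr addrK; lra.
Qed.

End direction.

Lemma coord_bound v : exists2 K, 0 <= K & forall i, `|v 0 i| <= K.
Proof.
exists (\sum_i `|v 0 i|) => [|i]; first exact: sumr_ge0.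
by rewrite (bigD1 i)//= lerDl sumr_ge0.
Qed.

Lemma bl_soft_step : bounded_lipschitz soft_step.
Proof.
split.
  exists 1 => z; rewrite ger0_norm ?soft_step_le1//; exact/ltW/soft_step_gt0.
move=> v; have [K K0 vK] := coord_bound v; exists (b * K).
apply: lipschitz_of_ratio => [|z|z s].
- by rewrite mulr_ge0// ltW.
- by rewrite soft_step_le1 ltW// soft_step_gt0.
- exact: soft_step_line_le.
Qed.

Lemma bl_gibbs i : bounded_lipschitz (gibbs i).
Proof.
split.
  by exists 1 => z; rewrite ger0_norm ?gibbs_le1// gibbs_ge0.
move=> v; have [K K0 vK] := coord_bound v; exists (2 * (b * K)).
apply: lipschitz_of_ratio => [|z|z s].
- by rewrite !mulr_ge0// ltW.
- by rewrite gibbs_le1 gibbs_ge0.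
- exact: gibbs_line_le.
Qed.

Definition gibbs_mean v z := \sum_i v 0 i * gibbs i z.
Definition gibbs_sqr v z := \sum_i v 0 i ^+ 2 * gibbs i z.

(** Half the second derivative of [soft_step] along [v], divided by [b ^+ 2]. *)
Definition soft_step2 v z := soft_step z * (gibbs_mean v z ^+ 2 - gibbs_sqr v z / 2).

Lemma bl_soft_step2 v : bounded_lipschitz (soft_step2 v).
Proof.
apply: blM; first exact: bl_soft_step.
have b1 : bounded_lipschitz (gibbs_mean v) by apply: bl_sum => i; apply: blZ; exact: bl_gibbs.
have b2 : bounded_lipschitz (gibbs_sqr v) by apply: bl_sum => i; apply: blZ; exact: bl_gibbs.
apply: blB; first exact: blM.
by under eq_fun do rewrite mulrC; exact: blZ.
Qed.

Lemma weighted_sum_le (F : 'I_N -> R) z B : (forall i, `|F i| <= B) -> 0 <= B ->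
  `|\sum_i gibbs i z * F i| <= B.
Proof.
move=> FB B0; rewrite (le_trans (ler_norm_sum _ _ _))//.
apply: (@le_trans _ _ (\sum_i gibbs i z * B)).
  by apply: ler_sum => i _; rewrite normrM ger0_norm ?gibbs_ge0// ler_wpM2l ?gibbs_ge0.
by rewrite -mulr_suml ler_piMl// sum_gibbs_le1.
Qed.

(** Here [h] is [1 + p + q] up to third order, with [p] of order [x] and [q] of
    order [x ^+ 2]; an algebraic identity isolates the third order remainder of
    [h^-1]. *)
Lemma inverse_taylor (h p q x E : R) : 0 <= x -> 1 <= E ->
  E^-1 <= h -> `|p| <= x -> `|h - 1 - p| <= x ^+ 2 * E -> `|h - 1| <= x * E ->
  `|h - 1 - p - q| <= x ^+ 3 * E ->
  `|h^-1 - (1 - p - q + p ^+ 2)| <= 4 * x ^+ 3 * E ^+ 4.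
Proof.
move=> x0 E1 hE px h2 h1 h3.
have E0 : 0 < E by exact: lt_le_trans E1.
have h0 : 0 < h by apply: lt_le_trans hE; rewrite invr_gt0.
have -> : h^-1 - (1 - p - q + p ^+ 2) =
  - (h - 1 - p - q) + (h - 1 - p) * (h - 1 + p) - (h - 1) ^+ 3 / h.
  by field; rewrite gt_eqF.
have x30 : 0 <= x ^+ 3 by rewrite exprn_ge0.
have t1 : `|- (h - 1 - p - q)| <= x ^+ 3 * E ^+ 4.
  by rewrite normrN (le_trans h3)// ler_wpM2l// ler_eXnr.
have t2 : `|(h - 1 - p) * (h - 1 + p)| <= 2 * (x ^+ 3 * E ^+ 4).
  have h4 : `|h - 1 + p| <= 2 * x * E.
    by rewrite (le_trans (ler_normD _ _))//; nra.
  rewrite normrM (@le_trans _ _ (x ^+ 2 * E * (2 * x * E)))//; first exact: ler_pM.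
  have -> : x ^+ 2 * E * (2 * x * E) = 2 * (x ^+ 3 * E ^+ 2) by ring.
  by rewrite ler_wpM2l// ler_wpM2l// ler_weXn2l.
have t3 : `|(h - 1) ^+ 3 / h| <= x ^+ 3 * E ^+ 4.
  rewrite normrM normrX normfV (gtr0_norm h0) (_ : _ * E ^+ 4 = (x * E) ^+ 3 * E); last by ring.
  rewrite ler_pM ?exprn_ge0 ?invr_ge0 ?(ltW h0)//.
    by rewrite lerXn2r// nnegrE mulr_ge0// ltW.
  by rewrite -[leRHS]invrK lef_pV2 ?posrE ?invr_gt0.
rewrite (le_trans (ler_normB _ _))// (@le_trans _ _ (3 * (x ^+ 3 * E ^+ 4) + x ^+ 3 * E ^+ 4))//.
  rewrite lerD// (le_trans (ler_normD _ _))//; lra.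
by lra.
Qed.

(** The remainder is uniform in [z], and its growth in [s] is integrable for the
    Gaussian measure. *)
Lemma soft_step_taylor v K z s : 0 <= K -> (forall i, `|v 0 i| <= K) ->
  `|soft_step (z + s *: v) - soft_step z
    + b * s * (soft_step z * gibbs_mean v z) - (b * s) ^+ 2 * soft_step2 v z|
  <= 4 * (b * `|s| * K) ^+ 3 * expR (4 * (b * `|s| * K)).
Proof.
move=> K0 vK; set x := b * `|s| * K.
have x0 : 0 <= x by rewrite !mulr_ge0// ltW.
have E1 : 1 <= expR x by rewrite -expR0 ler_expR.
have u0 := soft_step_gt0 z; have u1 := soft_step_le1 z.
pose h := gibbs_ratio z v s.
pose p := b * s * gibbs_mean v z; pose q := (b * s) ^+ 2 / 2 * gibbs_sqr v z.
have hB1 : h - 1 = \sum_i gibbs i z * (expR (b * s * v 0 i) - 1).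
  rewrite /h /gibbs_ratio -{1}(sum_gibbs z) opprD addrACA subrr add0r -sumrB.
  by apply: eq_bigr => i _; rewrite mulrBr mulr1.
have pE : p = \sum_i gibbs i z * (b * s * v 0 i).
  by rewrite /p mulr_sumr; apply: eq_bigr => i _; ring.
have qE : q = \sum_i gibbs i z * ((b * s * v 0 i) ^+ 2 / 2).
  by rewrite /q mulr_sumr; apply: eq_bigr => i _; field.
have tb i := tilt_bound vK s i.
have Eb i : expR `|b * s * v 0 i| <= expR x by rewrite ler_expR.
have := @inverse_taylor h p q x (expR x) x0 E1.
rewrite -expRN gibbs_ratio_ge// => /(_ isT).
have -> : `|p| <= x by rewrite pE; exact: weighted_sum_le.
have -> : `|h - 1 - p| <= x ^+ 2 * expR x.
  rewrite hB1 pE -sumrB; under eq_bigr do rewrite -mulrBr.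
  apply: weighted_sum_le; last by rewrite mulr_ge0 ?expR_ge0 ?sqr_ge0.
  move=> i; rewrite (le_trans (norm_expRB2_le _))// ler_pM ?sqr_ge0 ?expR_ge0//.
  by rewrite -(real_normK (num_real _)) lerXn2r ?nnegrE.
have -> : `|h - 1| <= x * expR x.
  rewrite hB1; apply: weighted_sum_le; last by rewrite mulr_ge0 ?expR_ge0.
  by move=> i; rewrite (le_trans (norm_expRB1_le _))// ler_pM ?expR_ge0.
have -> : `|h - 1 - p - q| <= x ^+ 3 * expR x.
  rewrite hB1 pE qE -!sumrB; under eq_bigr do rewrite -!mulrBr.
  apply: weighted_sum_le; last by rewrite mulr_ge0 ?expR_ge0 ?exprn_ge0.
  move=> i; rewrite (le_trans (norm_expRB3_le _))// ler_pM ?exprn_ge0 ?expR_ge0//.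
  by rewrite lerXn2r ?nnegrE.
move=> /(_ isT isT isT isT); rewrite -expRM_natl => main.
rewrite soft_step_line -/h.
have -> : soft_step z / h - soft_step z + b * s * (soft_step z * gibbs_mean v z) -
  (b * s) ^+ 2 * soft_step2 v z = soft_step z * (h^-1 - (1 - p - q + p ^+ 2)).
  have h0 : h != 0 by rewrite gt_eqF// (gibbs_ratio_gt0 K0 vK).
  by rewrite /p /q /soft_step2; field.
rewrite normrM gtr0_norm// (le_trans (ler_piMl _ u1))//.
Qed.

End soft_step.

(** * Comparison of Gaussian averages *)

Section heat_semigroup.
Variables (R : realType) (V : lmodType R).
Implicit Types (f : V -> R) (v : V) (l : seq V).

Lemma bl_iter (A : (V -> R) -> V -> R) n f :
  (forall g, bounded_lipschitz g -> bounded_lipschitz (A g)) ->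
  bounded_lipschitz f -> bounded_lipschitz (iter n A f).
Proof. by move=> Abl fbl; elim: n => //= n; exact: Abl. Qed.

(** Variances of independent Gaussian steps add up. *)
Lemma iter_gauss_avg n v f : bounded_lipschitz f ->
  iter n.+1 (gauss_avg v) f = gauss_avg (Num.sqrt n.+1%:R *: v) f.
Proof.
move=> fbl; elim: n => [|n ih]; first by rewrite sqrtr1 scale1r.
pose q : R := Num.sqrt n.+2%:R.
have q0 : 0 < q by rewrite sqrtr_gt0.
pose a := Num.sqrt n.+1%:R / q; pose b := q^-1.
have ab : a ^+ 2 + b ^+ 2 = 1.
  rewrite /a /b expr_div_n exprVn !sqr_sqrtr// -[X in _ + X]mul1r -mulrDl.
  by rewrite natr1 divff// pnatr_eq0.
apply/funext => z; rewrite iterS ih.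
have b0 : 0 < b by rewrite invr_gt0.
have qn : q != 0 by rewrite gt_eqF.
have vE : b *: (q *: v) = v by rewrite scalerA mulVf// scale1r.
have wE : a *: (q *: v) = Num.sqrt n.+1%:R *: v by rewrite scalerA divfK.
have := gauss_avg_rotation (q *: v) z b0 ab fbl; rewrite vE wE => <-.
exact: gauss_avgC.
Qed.

Lemma iter_comp_comm (A B : (V -> R) -> V -> R) n f :
  (forall g, bounded_lipschitz g -> bounded_lipschitz (A g)) ->
  (forall g, bounded_lipschitz g -> bounded_lipschitz (B g)) ->
  (forall g, bounded_lipschitz g -> A (B g) = B (A g)) ->
  bounded_lipschitz f -> iter n (A \o B) f = iter n A (iter n B f).
Proof.
move=> Abl Bbl AB fbl.
have AnB m g : bounded_lipschitz g -> iter m A (B g) = B (iter m A g).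
  by move=> gbl; elim: m => //= m ->; rewrite AB//; exact: bl_iter.
elim: n => //= n ->; rewrite -AnB; last by apply: bl_iter => //; exact: bl_iter.
by [].
Qed.

Lemma iter_gauss_avgs n l f : bounded_lipschitz f ->
  iter n.+1 (gauss_avgs l) f = gauss_avgs (map ( *:%R (Num.sqrt n.+1%:R)) l) f.
Proof.
move=> fbl; elim: l => [|v l ih].
  by rewrite [RHS]/=; elim: n.+1 => //= k ->.
rewrite [gauss_avgs (v :: l)](_ : _ = gauss_avg v \o gauss_avgs l)//.
rewrite iter_comp_comm ?ih ?iter_gauss_avg//; first exact: bl_gauss_avgs.
- by move=> g; exact: bl_gauss_avg.
- by move=> g; exact: bl_gauss_avgs.
- by move=> g gbl; rewrite gauss_avgsCl.
Qed.

End heat_semigroup.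

Section comparison.
Variables (R : realType) (N : nat) (a b : R).
Hypothesis b0 : 0 < b.
Local Notation V := 'rV[R]_N.
Local Notation gam := (@normal_prob R 0 1).
Local Notation u := (@soft_step R N a b).
Local Notation u2 := (@soft_step2 R N a b).
Implicit Types (z v : V) (s e : R) (l : seq V).

Let var : R := \int[gam]_x (x ^+ 2).

Lemma bl_soft_step2_sum l : bounded_lipschitz (fun z => \sum_(w <- l) u2 w z).
Proof. by apply: bl_sum => w; exact: bl_soft_step2. Qed.

(** The linear term of the Taylor expansion has mean zero, so the average and the
    function itself differ only at second order. *)
Lemma gauss_avg_soft_step v : exists2 C, 0 <= C & forall e z, 0 <= e <= 1 ->
  `|gauss_avg (e *: v) u z - u z - e ^+ 2 * (var * b ^+ 2 * u2 v z)| <= C * e ^+ 3.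
Proof.
have [K K0 vK] := coord_bound v.
pose k := b * K; have k0 : 0 <= k by rewrite mulr_ge0// ltW.
pose G (s : R) := 4 * (k * `|s|) ^+ 3 * expR (4 * (k * `|s|)).
have Gm : measurable_fun setT G.
  apply: measurable_funM; last first.
    by apply: measurableT_comp => //; do 2 apply: measurable_funM => //.
  apply: measurable_funM => //; apply: measurable_funX.
  by apply: measurable_funM.
have Gi : gam.-integrable setT (EFin \o G).
  apply: (@normal_prob_integrable_le_expR _ _ (4 * 27) (5 * k)) => // s.
  have ks : 0 <= k * `|s| by rewrite mulr_ge0.
  rewrite ger0_norm; last by rewrite mulr_ge0 ?expR_ge0// mulr_ge0// exprn_ge0.
  have -> : 5 * k * `|s| = k * `|s| + 4 * (k * `|s|) by ring.
  by rewrite expRD mulrA ler_wpM2r ?expR_ge0// -[leRHS]mulrA ler_wpM2l// cube_le_expR.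
exists (\int[gam]_s G s).
  apply: Rintegral_ge0 => s _; rewrite mulr_ge0 ?expR_ge0// mulr_ge0// exprn_ge0//.
  by rewrite mulr_ge0.
move=> e z /andP[e0 e1].
have ubl := bl_soft_step N a b0.
pose p := - (b * e * (u z * gibbs_mean a b v z)).
pose q := (b * e) ^+ 2 * u2 v z.
have I2 := normal_prob_integrable_sqr R; have I1 := normal_prob_integrable_id R.
pose T (s : R) := u z + p * s + q * s ^+ 2.
have Ti : gam.-integrable setT (EFin \o T).
  apply: integrable_EFinD; last exact: integrable_EFinZ.
  by apply: integrable_EFinD; [exact: integrable_cst_prob|exact: integrable_EFinZ].
have IT : \int[gam]_s T s = u z + e ^+ 2 * (var * b ^+ 2 * u2 v z).
  have i1 : gam.-integrable setT (EFin \o (fun s => p * s)) by exact: integrable_EFinZ.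
  have i2 : gam.-integrable setT (EFin \o (fun s => q * s ^+ 2)) by exact: integrable_EFinZ.
  have i0 : gam.-integrable setT (EFin \o (fun _ : R => u z)) by exact: integrable_cst_prob.
  rewrite /T (RintegralD measurableT (integrable_EFinD i0 i1) i2) (RintegralD measurableT i0 i1).
  rewrite !RintegralZl// Rintegral_cst_prob normal_prob_mean mulr0 addr0.
  by rewrite -/var /q; ring.
rewrite -addrA -opprD -IT /gauss_avg -RintegralB//; last exact: bl_line_integrable.
rewrite (le_trans (le_normr_Rintegral _ _))//.
  by apply: integrable_EFinB => //; exact: bl_line_integrable.
rewrite -RintegralZr//; apply: le_Rintegral => //.
- apply: (integrable_abse (f := EFin \o _)).
  by apply: integrable_EFinB => //; exact: bl_line_integrable.
- by under eq_fun do rewrite mulrC; exact: integrable_EFinZ.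
move=> s _; rewrite scalerA.
have -> : u (z + (s * e) *: v) - T s = u (z + (s * e) *: v) - u z
    + b * (s * e) * (u z * gibbs_mean a b v z) - (b * (s * e)) ^+ 2 * u2 v z.
  by rewrite /T /p /q; ring.
rewrite (le_trans (soft_step_taylor _ _ _ _ K0 vK))//.
have ks : 0 <= k * `|s| by rewrite mulr_ge0.
have -> : b * `|s * e| * K = k * `|s| * e by rewrite normrM (ger0_norm e0) /k; ring.
rewrite /G [leRHS]mulrAC.
have -> : 4 * (k * `|s| * e) ^+ 3 = 4 * (k * `|s|) ^+ 3 * e ^+ 3 by rewrite exprMn mulrA.
rewrite ler_wpM2l//.
  by rewrite mulr_ge0 ?exprn_ge0// mulr_ge0// exprn_ge0.
by rewrite ler_expR ler_wpM2l// ler_piMr.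
Qed.

(** The second order terms of the directions add up: averaging such a term over a
    further step of size [e] moves it by [O(e)] only, as it is Lipschitz. *)
Lemma gauss_avgs_soft_step l : exists2 C, 0 <= C & forall e z, 0 <= e <= 1 ->
  `|gauss_avgs (map ( *:%R e) l) u z - u z
    - e ^+ 2 * (var * b ^+ 2 * \sum_(v <- l) u2 v z)| <= C * e ^+ 3.
Proof.
have ubl := bl_soft_step N a b0.
have I1 := normal_prob_integrable_id R.
elim: l => [|v l [C C0 ih]].
  by exists 0 => // e z _; rewrite /= big_nil !mulr0 subrr subr0 normr0 mul0r.
have [D D0 hD] := gauss_avg_soft_step v.
have [_ /(_ v)[L qL]] := bl_soft_step2_sum l.
set q := fun z => \sum_(w <- l) u2 w z in qL.
have qbl : bounded_lipschitz q by exact: bl_soft_step2_sum.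
pose B := `|var * b ^+ 2| * (`|L| * \int[gam]_s `|s|).
have B0 : 0 <= B by rewrite !mulr_ge0// Rintegral_ge0.
exists (C + D + B) => [|e z e01]; first by rewrite !addr_ge0.
have /andP[e0 e1] := e01.
set f := gauss_avgs (map ( *:%R e) l) u.
have fbl : bounded_lipschitz f by exact: bl_gauss_avgs.
pose c := e ^+ 2 * (var * b ^+ 2).
have r1 : `|gauss_avg (e *: v) (fun x => f x - u x - c * q x) z| <= C * e ^+ 3.
  apply: norm_gauss_avg_le; first by apply: blB; [exact: blB|exact: blZ].
  by move=> x; rewrite /c -mulrA; exact: ih.
have r2 : `|gauss_avg (e *: v) (fun x => q x - q z) z| <= `|L| * e * \int[gam]_s `|s|.
  have I1' : gam.-integrable setT (EFin \o (fun s : R => `|s|)) by exact: integrable_abse I1.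
  rewrite -RintegralZl// (le_trans (le_normr_Rintegral _ _))//.
    apply: (bl_line_integrable z (e *: v) (f := fun x => q x - q z)).
    by apply: blB => //; exact: bl_cst.
  apply: le_Rintegral => //.
  - apply: (integrable_abse (f := EFin \o _)).
    apply: (bl_line_integrable z (e *: v) (f := fun x => q x - q z)).
    by apply: blB => //; exact: bl_cst.
  - exact: integrable_EFinZ.
  move=> s _; rewrite scalerA (le_trans (qL _ _))// normrM (ger0_norm e0).
  by rewrite -mulrA [e * _]mulrC ler_wpM2r ?ler_norm// mulr_ge0.
have E : gauss_avgs (map ( *:%R e) (v :: l)) u z - u z
    - e ^+ 2 * (var * b ^+ 2 * \sum_(w <- v :: l) u2 w z) =
  gauss_avg (e *: v) (fun x => f x - u x - c * q x) z +
  (gauss_avg (e *: v) u z - u z - e ^+ 2 * (var * b ^+ 2 * u2 v z)) +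
  c * gauss_avg (e *: v) (fun x => q x - q z) z.
  rewrite big_cons [gauss_avgs _ u]/= -/f !gauss_avgB ?gauss_avg_cst//; try exact: bl_cst.
    rewrite -/(q z) /c.
    have -> : gauss_avg (e *: v) (fun x => e ^+ 2 * (var * b ^+ 2) * q x) z =
        e ^+ 2 * (var * b ^+ 2) * gauss_avg (e *: v) q z.
      by rewrite /gauss_avg RintegralZl//; exact: bl_line_integrable.
    by ring.
  all: try exact: blB; try exact: blZ.
rewrite E !mulrDl (le_trans (ler_normD _ _))// lerD//.
  by rewrite (le_trans (ler_normD _ _))// lerD// hD.
rewrite normrM (@le_trans _ _ (`|c| * (`|L| * e * \int[gam]_s `|s|)))// ?ler_wpM2l//.
rewrite /c normrM (ger0_norm (sqr_ge0 e)) /B.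
by rewrite le_eqVlt; apply/orP; left; apply/eqP; ring.
Qed.

(** Gaussian comparison, by replacing one small increment after another: when
    the first increment list has pointwise the larger second order term, each
    of the [n.+1] swaps costs only [O(n.+1%:R ^ (-3/2))]. *)
Lemma gauss_comparison l1 l2 z :
  (forall x, \sum_(v <- l2) u2 v x <= \sum_(v <- l1) u2 v x) ->
  gauss_avgs l2 u z <= gauss_avgs l1 u z.
Proof.
move=> l12; have ubl := bl_soft_step N a b0.
have [C C0 hC] := gauss_avgs_soft_step l1; have [D D0 hD] := gauss_avgs_soft_step l2.
pose A e l := gauss_avgs (map ( *:%R e) l) : (V -> R) -> V -> R.
have Abl e l f : bounded_lipschitz f -> bounded_lipschitz (A e l f) by exact: bl_gauss_avgs.
have AD e l f c : bounded_lipschitz f -> A e l (fun x => f x + c) = (fun x => A e l f x + c).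
  by move=> fbl; rewrite /A gauss_avgsD ?gauss_avgs_cst//; exact: bl_cst.
have step e x : 0 <= e <= 1 -> A e l2 u x <= A e l1 u x + (C + D) * e ^+ 3.
  move=> e01; have := hC e x e01; have := hD e x e01.
  have : e ^+ 2 * (var * b ^+ 2 * \sum_(v <- l2) u2 v x) <=
      e ^+ 2 * (var * b ^+ 2 * \sum_(v <- l1) u2 v x).
    rewrite ler_wpM2l ?sqr_ge0// ler_wpM2l// mulr_ge0 ?sqr_ge0//.
    by apply: Rintegral_ge0 => s _; exact: sqr_ge0.
  rewrite mulrDl -/(A e l1) -/(A e l2) !ler_norml => h /andP[h1 h2] /andP[h3 h4]; lra.
have iterate n e x : 0 <= e <= 1 ->
    iter n (A e l2) u x <= iter n (A e l1) u x + n%:R * ((C + D) * e ^+ 3).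
  move=> e01; elim: n x => [|n ih] x; first by rewrite mul0r addr0.
  have i1 : bounded_lipschitz (iter n (A e l1) u) by apply: bl_iter => // g; exact: Abl.
  have i2 : bounded_lipschitz (iter n (A e l2) u) by apply: bl_iter => // g; exact: Abl.
  pose k := (C + D) * e ^+ 3; have kbl c : bounded_lipschitz (fun _ : V => c) by exact: bl_cst.
  rewrite iterS (@le_trans _ _ (A e l2 (fun x => iter n (A e l1) u x + n%:R * k) x))//.
    by apply: le_gauss_avgs => //; exact: blD.
  rewrite AD//.
  have comm m : A e l2 (iter m (A e l1) u) = iter m (A e l1) (A e l2 u).
    elim: m => //= m <-; rewrite /A gauss_avgsC//.
    by apply: bl_iter => // g; exact: Abl.
  rewrite [A e l2 _ x](congr1 (fun g => g x) (comm n)).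
  have -> : iter n.+1 (A e l1) u x + n.+1%:R * k =
      iter n (A e l1) (fun x => A e l1 u x + k) x + n%:R * k.
    rewrite -natr1 mulrDl mul1r [n%:R * k + k]addrC addrA iterSr; congr (_ + _).
    have -> : iter n (A e l1) (fun x => A e l1 u x + k) =
        (fun x => iter n (A e l1) (A e l1 u) x + k).
      elim: n {ih i1 i2} => //= n ->; rewrite AD//.
      by apply: bl_iter => [g|]; [exact: Abl|exact: Abl].
    by [].
  rewrite lerD2r; elim: n x {ih i1 i2} => [|n ihn] x /=; first exact: step.
  apply: le_gauss_avgs => //; (apply: bl_iter; first by move=> g; exact: Abl).
    exact: Abl.
  by apply: blD => //; exact: Abl.
apply/ler_addgt0Pr => r r0.
(* Splitting every increment into [n.+1] steps of relative size
   [n.+1%:R ^ (-1/2)] leaves a total error of [(C + D) / Num.sqrt n.+1%:R]. *)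
pose n := Num.bound (((C + D) / r) ^+ 2).
pose e := (Num.sqrt n.+1%:R : R)^-1.
have s0 : 0 < Num.sqrt n.+1%:R :> R by rewrite sqrtr_gt0.
have s1 : 1 <= Num.sqrt n.+1%:R :> R by rewrite -[leLHS]sqrtr1 ler_wsqrtr// ler1n.
have e01 : 0 <= e <= 1 by rewrite /e invr_ge0 ltW//= invf_le1.
have AE l : iter n.+1 (A e l) u = gauss_avgs l u.
  rewrite /A iter_gauss_avgs// -map_comp map_id_in// => v _ /=.
  by rewrite scalerA divff ?gt_eqF// scale1r.
have := iterate n.+1 e z e01; rewrite !AE => /le_trans; apply; rewrite lerD2l.
have s2 : Num.sqrt n.+1%:R ^+ 2 = n.+1%:R :> R by rewrite sqr_sqrtr.
have -> : n.+1%:R * ((C + D) * e ^+ 3) = (C + D) / Num.sqrt n.+1%:R.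
  by rewrite -[X in X * _]s2 /e; field; rewrite gt_eqF.
rewrite ler_pdivrMr// mulrC -ler_pdivrMr//.
rewrite -[leLHS]ger0_norm ?divr_ge0 ?addr_ge0 ?(ltW r0)// -sqrtr_sqr ler_wsqrtr//.
rewrite (le_trans (ltW (archi_boundP _)))//; first exact: sqr_ge0.
by rewrite ler_nat.
Qed.

End comparison.

(** * The law of a linear combination of independent Gaussian variables *)

Section grid.
Variables (R : realType) (n : nat).
Local Notation gam := (@normal_prob R 0 1).
Implicit Types x : R.

Let k : R := n.+1%:R.
Let k0 : 0 < k. Proof. by []. Qed.

(** Cells of mesh [1 / k], indexed so that together they cover [-k, k[. *)
Definition cell (i : 'I_(n.+1 ^ 2 * 2)) : set R :=
  [set x | Num.floor (x * k) = (i : nat)%:Z - (n.+1 ^ 2)%N%:Z].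
Definition cell_pt (i : 'I_(n.+1 ^ 2 * 2)) : R := ((i : nat)%:R - k ^+ 2) / k.

Definition covered : set R := [set x | - k <= x < k].

Lemma measurable_cell i : measurable (cell i).
Proof. exact: measurable_floor_eq. Qed.

Lemma measurable_covered : measurable covered.
Proof.
rewrite [covered](_ : _ = `[- k, k[%classic); first exact: measurable_itv.
by apply/seteqP; split => x /=; rewrite in_itv.
Qed.

Lemma cell_dist x i : cell i x -> `|cell_pt i - x| <= k^-1.
Proof.
rewrite /cell/=.
move=> xi; have := floor_itv (x * k); rewrite xi intrD1 => /andP[h1 h2].
have -> : cell_pt i = (((i : nat)%:Z - (n.+1 ^ 2)%N%:Z)%:~R : R) / k.
  by rewrite /cell_pt rmorphB /= -natrX.
move: h1 h2; set j : R := _%:~R => h1 h2.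
have -> : j / k - x = - ((x * k - j) / k) by field; rewrite gt_eqF.
rewrite normrN ger0_norm; last by rewrite divr_ge0 ?subr_ge0.
by rewrite ler_pdivrMr// mulVf ?gt_eqF// lerBlDl ltW.
Qed.

Lemma cell_cover x : covered x -> exists i, cell i x.
Proof.
move=> /andP[x1 x2].
have kk : (n.+1 ^ 2)%N%:Z%:~R = k * k :> R by rewrite -[RHS]expr2 -natrX.
have j1 : - (n.+1 ^ 2)%N%:Z <= Num.floor (x * k).
  by rewrite floor_ge_int rmorphN /= kk -mulNr ler_wpM2r// ltW.
have j2 : Num.floor (x * k) < (n.+1 ^ 2)%N%:Z.
  by rewrite floor_lt_int kk ltr_pM2r.
have j0 : 0 <= Num.floor (x * k) + (n.+1 ^ 2)%N%:Z by rewrite -lerBlDr sub0r.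
have jn : (absz (Num.floor (x * k) + (n.+1 ^ 2)%N%:Z)%R < n.+1 ^ 2 * 2)%N.
  by rewrite -ltz_nat gez0_abs// muln2 -addnn PoszD ltrD2r.
by exists (Ordinal jn); rewrite /cell/= gez0_abs// addrK.
Qed.

Lemma cell_inj x i j : cell i x -> cell j x -> i = j.
Proof.
rewrite /cell/= => -> /addIr ij; apply/val_inj/eqP.
by rewrite -eqz_nat ij.
Qed.

Lemma cell_covered x i : cell i x -> covered x.
Proof.
rewrite /cell/covered/= => xi.
have kk : (n.+1 ^ 2)%N%:Z%:~R = k * k :> R by rewrite -[RHS]expr2 -natrX.
have j1 : - (n.+1 ^ 2)%N%:Z <= Num.floor (x * k) by rewrite xi lerDr.
have j2 : Num.floor (x * k) < (n.+1 ^ 2)%N%:Z.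
  by rewrite xi ltrBlDr -PoszD ltz_nat addnn -muln2.
move: j1 j2; rewrite floor_ge_int floor_lt_int rmorphN /= kk -mulNr.
by rewrite ler_pM2r// ltr_pM2r// => -> ->.
Qed.

Definition grid_sum (h : R -> R) x := \sum_i h (cell_pt i) * \1_(cell i) x.

Lemma grid_sum_dist (h : R -> R) L M x : 0 <= L ->
  (forall x y, `|h x - h y| <= L * `|x - y|) -> (forall x, `|h x| <= M) ->
  `|grid_sum h x - h x| <= L / k + M * \1_(~` covered) x.
Proof.
move=> L0 hL hM; rewrite /grid_sum.
have M0 : 0 <= M by exact: le_trans (hM 0).
have [xc|xc] := pselect (covered x); last first.
  rewrite big1 ?sub0r ?normrN => [|i _]; last first.
    by rewrite indicE memNset ?mulr0// => /cell_covered.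
  rewrite indicE mem_set// mulr1 (le_trans (hM _))// lerDr.
  by rewrite divr_ge0// ltW.
have [i xi] := cell_cover xc.
rewrite (bigD1 i)//= big1 => [|j ji]; last first.
  rewrite indicE memNset ?mulr0// => xj.
  by move: ji; rewrite (cell_inj xj xi) eqxx.
rewrite addr0 indicE mem_set// mulr1 (le_trans (hL _ _))//.
rewrite (@le_trans _ _ (L / k))// ?ler_wpM2l// ?cell_dist// lerDl.
by rewrite mulr_ge0.
Qed.

Lemma normal_prob_uncovered : fine (gam (~` covered)) <= (\int[gam]_x `|x|) / k.
Proof.
have mC : measurable (~` covered) by apply: measurableC; exact: measurable_covered.
have -> : fine (gam (~` covered)) = \int[gam]_x \1_(~` covered) x.
  by rewrite /Rintegral integral_indic// setIT.
have I1 : gam.-integrable setT (EFin \o (fun x : R => `|x|)).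
  exact: integrable_abse (normal_prob_integrable_id R).
rewrite -RintegralZr//; apply: le_Rintegral => //.
- exact: integrable_indic.
- by under eq_fun do rewrite mulrC; exact: integrable_EFinZ.
move=> x _; rewrite indicE; have [|_] := boolP (x \in _); last by rewrite divr_ge0.
rewrite inE /covered/= => xc; rewrite mulr1n ler_pdivlMr// mul1r leNgt.
by apply/negP; rewrite ltr_norml => /andP[h1 h2]; apply: xc; rewrite h2 ltW.
Qed.

End grid.

Lemma Rintegral_sum d (T : measurableType d) (R : realType)
    (m : {measure set T -> \bar R}) (J : Type) (r : seq J) (F : J -> T -> R) :
  (forall i, m.-integrable setT (EFin \o F i)) ->
  m.-integrable setT (EFin \o (fun x => \sum_(i <- r) F i x)) /\
  \int[m]_x (\sum_(i <- r) F i x) = \sum_(i <- r) \int[m]_x F i x.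
Proof.
move=> Fi; elim: r => [|i r [ih1 ih2]].
  rewrite (_ : (fun x => _) = cst 0); last by apply/funext => x; rewrite big_nil.
  by rewrite big_nil /Rintegral integral0; split; first exact: integrable0.
rewrite (_ : (fun x => \sum_(j <- i :: r) F j x) =
             (fun x => F i x + \sum_(j <- r) F j x)); last first.
  by apply/funext => x; rewrite big_cons.
by rewrite big_cons -ih2 -RintegralD//; split; first exact: integrable_EFinD.
Qed.

Section law.
Context d (T : measurableType d) (R : realType) (P : probability T R).
Variables (I : finType) (X : I -> {RV P >-> R}) (V : lmodType R) (dir : I -> V).
Local Notation gam := (@normal_prob R 0 1).
Hypothesis X_law : forall e (B : set R), measurable B -> distribution P (X e) B = gam B.
Hypothesis X_indep : mutually_independent X.
Implicit Types (f : V -> R) (s : seq I) (B : I -> set R).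

Definition weighted_sum s w : V := \sum_(e <- s) X e w *: dir e.

Lemma measurable_weighted_sum s f z : bounded_lipschitz f ->
  measurable_fun setT (fun w => f (z + weighted_sum s w)).
Proof.
move=> fbl; elim: s z => [|e s ih] z.
  by under eq_fun do rewrite /weighted_sum big_nil; exact: measurable_cst.
under eq_fun do rewrite /weighted_sum big_cons addrA.
apply: (measurable_fun_caratheodory (g := fun t w => f (z + t *: dir e + weighted_sum s w))).
- by [].
- by move=> t; exact: ih.
- by move=> w; under eq_fun do rewrite addrAC; exact: bl_line_continuous.
Qed.

(** The indicators for the weights outside [s]: they carry the independence of
    these weights while those in [s] are integrated out. *)
Definition box s B w : R := \prod_(e | e \notin s) \1_(B e) (X e w).

Lemma measurable_box s B : (forall e, measurable (B e)) -> measurable_fun setT (box s B).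
Proof.
move=> mB; rewrite /box; under eq_fun do rewrite -big_filter.
apply: measurable_prod => e _.
by apply: measurableT_comp => //; exact: measurable_indic.
Qed.

Lemma box_bounds s B w : 0 <= box s B w <= 1.
Proof.
apply/andP; split; first by apply: prodr_ge0 => e _; rewrite indicE.
by apply: prodr_ile1 => e _; rewrite indicE ler0n lern1 leq_b1.
Qed.

Lemma integral_box B : (forall e, measurable (B e)) ->
  \int[P]_w box [::] B w = \prod_e fine (gam (B e)).
Proof.
move=> mB.
have boxE : box [::] B = \1_(\bigcap_e (X e @^-1` B e)).
  apply/funext => w; rewrite /box indicE; have [|] := boolP (w \in _).
    rewrite inE => h; rewrite big1// => e _; rewrite indicE mem_set//; exact: h.
  rewrite notin_setE => h.
  have [e he] : exists e, ~ B e (X e w) by apply/existsNP => h'; apply: h => e _; exact: h'.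
  by rewrite (bigD1 e)//= indicE memNset// mul0r.
have mE : measurable (\bigcap_e (X e @^-1` B e)).
  by apply/(measurable_indicP R); rewrite -boxE; exact: measurable_box.
rewrite boxE /Rintegral integral_indic// setIT.
transitivity (fine (\prod_i P (X i @^-1` B i))%E); first by congr fine; exact: X_indep.
have -> : (\prod_i P (X i @^-1` B i) = \prod_i (fine (gam (B i)))%:E)%E.
  apply: eq_bigr => e _; rewrite fineK; first exact: (X_law e (mB e)).
  by apply: fin_num_measure; exact: mB.
by rewrite prodEFin.
Qed.

Lemma box_cons e s B C w : e \notin s ->
  box s (fun i => if i == e then C else B i) w = \1_C (X e w) * box (e :: s) B w.
Proof.
move=> es; rewrite /box (bigD1 e)//= eqxx; congr (_ * _).
apply: eq_big => [i|i /andP[_ /negbTE ->]//].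
by rewrite in_cons negb_or andbC.
Qed.

Lemma law_bound (L M k : R) (U : set R) (g : T -> R) e : measurable U ->
  0 <= L -> 0 <= M -> 0 < k -> measurable_fun setT g ->
  (forall w, `|g w| <= L / k + M * \1_U (X e w)) ->
  `|\int[P]_w g w| <= L / k + M * fine (gam U).
Proof.
move=> mU L0 M0 k0 mg gle.
have iU : P.-integrable setT (EFin \o (fun w => \1_U (X e w) : R)).
  apply: (@bounded_integrable _ _ _ _ _ 1).
    by apply: measurableT_comp => //; exact: measurable_indic.
  by move=> w; rewrite indicE ger0_norm// lern1 leq_b1.
have ig : P.-integrable setT (EFin \o g).
  apply: (@bounded_integrable _ _ _ _ _ (L / k + M)) => // w.
  by rewrite (le_trans (gle w))// lerD2l ler_piMr// indicE lern1 leq_b1.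
rewrite (le_trans (le_normr_Rintegral _ ig))//.
have -> : fine (gam U) = \int[P]_w \1_U (X e w).
  have -> : gam U = P (X e @^-1` U) by exact/esym/(X_law e mU).
  have mXU : measurable (X e @^-1` U) by exact: measurable_funPTI.
  rewrite /Rintegral -[X in fine (P X)]setIT -integral_indic//.
rewrite -[X in X + _](Rintegral_cst_prob P) -RintegralZl// -RintegralD//; last 2 first.
- exact: integrable_cst_prob.
- exact: integrable_EFinZ.
apply: le_Rintegral => //; first exact: (integrable_abse ig).
by apply: integrable_EFinD; [exact: integrable_cst_prob|exact: integrable_EFinZ].
Qed.

(** The independent weights are integrated out one at a time.  The indicators
    in [box] keep the remaining ones in product form, and discretising the
    weight to be removed turns it into one more such indicator. *)
Lemma integral_weighted_sum s f z B : uniq s -> bounded_lipschitz f ->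
  (forall e, measurable (B e)) ->
  \int[P]_w (f (z + weighted_sum s w) * box s B w) =
  gauss_avgs (map dir s) f z * \prod_(e | e \notin s) fine (gam (B e)).
Proof.
elim: s z B => [|e s ih] z B.
  move=> _ fbl mB /=; have -> : \prod_(e | e \notin [::]) fine (gam (B e)) = \prod_e fine (gam (B e)).
    by apply: eq_bigl.
  rewrite -integral_box// -RintegralZl//.
    by apply: eq_Rintegral => w _; rewrite /weighted_sum big_nil addr0.
  apply: (@bounded_integrable _ _ _ _ _ 1); first exact: measurable_box.
  by move=> w; have /andP[b0 b1] := box_bounds [::] B w; rewrite ger0_norm.
move=> /= /andP[es us] fbl mB.
pose C := \prod_(i | i \notin e :: s) fine (gam (B i)).
pose h w t := f (z + t *: dir e + weighted_sum s w).
pose H t := gauss_avgs (map dir s) f (z + t *: dir e).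
have [[M fM] /(_ (dir e))[L fL]] := fbl.
have [[M' HM] /(_ (dir e))[L' HL]] := bl_gauss_avgs (map dir s) fbl.
have line_lip (g : V -> R) (K : R) (x : V) (t t' : R) :
    (forall (y : V) (r : R), `|g (y + r *: dir e) - g y| <= K * `|r|) ->
    `|g (x + t *: dir e) - g (x + t' *: dir e)| <= K * `|t - t'|.
  move=> gK; have -> : x + t *: dir e = x + t' *: dir e + (t - t') *: dir e.
    by rewrite -addrA -scalerDl subrKC.
  exact: gK.
have M0 : 0 <= M by exact: le_trans (fM 0).
have M'0 : 0 <= M' by exact: le_trans (HM 0).
have C01 : 0 <= C <= 1.
  apply/andP; split; first by apply: prodr_ge0 => i _; exact: fine_ge0.
  apply: prodr_ile1 => i _; rewrite fine_ge0//=.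
  rewrite -lee_fin fineK; first by apply: probability_le1; exact: mB.
  by apply: fin_num_measure; exact: mB.
have C0 : 0 <= C by case/andP: C01.
pose A := \int[gam]_x `|x|.
have A0 : 0 <= A by exact: Rintegral_ge0.
have mhX : measurable_fun setT (fun w => h w (X e w)).
  apply: (measurable_fun_caratheodory (g := fun t w => h w t)) => //.
    by move=> t; exact: measurable_weighted_sum.
  move=> w; under eq_fun do rewrite /h addrAC; exact: bl_line_continuous.
have boxb w : `|box (e :: s) B w| <= 1.
  by have /andP[b0 b1] := box_bounds (e :: s) B w; rewrite ger0_norm.
have mboxe : measurable_fun setT (box (e :: s) B) by exact: measurable_box.
have Hi : gam.-integrable setT (EFin \o H) by exact: (bl_line_integrable z (dir e) (bl_gauss_avgs (map dir s) fbl)).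
have approx n : `|\int[P]_w (h w (X e w) * box (e :: s) B w) - (\int[gam]_t H t) * C| <=
    ((`|L| + `|L'|) + (M + M') * A) / n.+1%:R.
  (* [g i] replaces the weight [X e] by a point of the cell that contains it. *)
  pose k : R := n.+1%:R; have k0 : 0 < k by [].
  pose g (i : 'I_(n.+1 ^ 2 * 2)) w := f ((z + cell_pt R i *: dir e) + weighted_sum s w) *
    box s (fun j => if j == e then cell i else B j) w.
  have mBC i j : measurable (if j == e then @cell R n i else B j).
    by case: ifP => // _; exact: measurable_cell.
  have gi i : P.-integrable setT (EFin \o g i).
    apply: (@bounded_integrable _ _ _ _ _ M).
      by apply: measurable_funM; [exact: measurable_weighted_sum|exact: measurable_box].
    move=> w; rewrite normrM -[leRHS]mulr1 ler_pM//.
    by have /andP[b0 b1] := box_bounds s (fun j => if j == e then cell i else B j) w; rewrite ger0_norm.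
  have [gsi gsE] := Rintegral_sum (index_enum _) gi.
  have gridE w : \sum_i g i w = grid_sum n (h w) (X e w) * box (e :: s) B w.
    by rewrite mulr_suml; apply: eq_bigr => i _; rewrite /g box_cons// mulrA.
  have gI i : \int[P]_w g i w = H (cell_pt R i) * fine (gam (cell i)) * C.
    rewrite ih// (bigD1 e)//= eqxx mulrA; congr (_ * _).
    apply: eq_big => [j|j /andP[_ /negbTE ->]//].
    by rewrite in_cons negb_or andbC.
  pose q (i : 'I_(n.+1 ^ 2 * 2)) t : R := H (cell_pt R i) * \1_(@cell R n i) t.
  have qi i : gam.-integrable setT (EFin \o q i).
    by apply: integrable_EFinZ; apply: integrable_indic; exact: measurable_cell.
  have [qsi qsE] := Rintegral_sum (index_enum _) qi.
  have qI i : \int[gam]_t q i t = H (cell_pt R i) * fine (gam (cell i)).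
    rewrite RintegralZl//; last by apply: integrable_indic; exact: measurable_cell.
    by rewrite /Rintegral integral_indic ?setIT//; exact: measurable_cell.
  have E : \int[P]_w (\sum_i g i w) = (\int[gam]_t \sum_i q i t) * C.
    by rewrite gsE qsE mulr_suml; apply: eq_bigr => i _; rewrite gI qI.
  have e1 : `|\int[P]_w (\sum_i g i w - h w (X e w) * box (e :: s) B w)| <=
      `|L| / k + M * fine (gam (~` @covered R n)).
    apply: law_bound => //.
    - by apply: measurableC; exact: measurable_covered.
    - apply: measurable_funB; last exact: measurable_funM.
      by have /integrableP[/measurable_EFinP] := gsi.
    move=> w; rewrite gridE -mulrBl normrM.
    rewrite (@le_trans _ _ `|grid_sum n (h w) (X e w) - h w (X e w)|)// ?ler_piMr//.
    apply: grid_sum_dist => // [t t'|t]; last exact: fM.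
    rewrite /h addrAC [X in _ - f X]addrAC (le_trans (line_lip _ _ _ _ _ fL))//.
    by rewrite ler_wpM2r// ler_norm.
  have e2 : `|\int[gam]_t (\sum_i q i t) - \int[gam]_t H t| <= (`|L'| + M' * A) / k.
    have dist t : `|\sum_i q i t - H t| <= `|L'| / k + M' * \1_(~` @covered R n) t.
      apply: (@grid_sum_dist R n H) => // [r r'|r]; last exact: HM.
      by rewrite (le_trans (line_lip _ _ _ _ _ HL))// ler_wpM2r// ler_norm.
    have mU : measurable (~` @covered R n) by apply: measurableC; exact: measurable_covered.
    have iU : gam.-integrable setT (EFin \o (\1_(~` @covered R n) : R -> R)) by exact: integrable_indic.
    rewrite -RintegralB// (le_trans (le_normr_Rintegral _ _))//; first exact: integrable_EFinB.
    rewrite (@le_trans _ _ (\int[gam]_t (`|L'| / k + M' * \1_(~` @covered R n) t)))//.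
      apply: le_Rintegral => //.
      - by apply: (integrable_abse (f := EFin \o _)); exact: integrable_EFinB.
      - by apply: integrable_EFinD; [exact: integrable_cst_prob|exact: integrable_EFinZ].
    rewrite RintegralD//; [|exact: integrable_cst_prob|exact: integrable_EFinZ].
    rewrite Rintegral_cst_prob RintegralZl// mulrDl lerD2l -mulrA ler_wpM2l//.
    rewrite (le_trans _ (@normal_prob_uncovered R n))//.
    by rewrite /Rintegral integral_indic// setIT.
  have hi : P.-integrable setT (EFin \o (fun w => h w (X e w) * box (e :: s) B w)).
    apply: (@bounded_integrable _ _ _ _ _ M); first exact: measurable_funM.
    by move=> w; rewrite normrM -[leRHS]mulr1 ler_pM// fM.
  have e1' : `|\int[P]_w (\sum_i g i w) - \int[P]_w (h w (X e w) * box (e :: s) B w)| <=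
      (`|L| + M * A) / k.
    rewrite -RintegralB// (le_trans e1)// mulrDl lerD2l -mulrA ler_wpM2l//.
    exact: normal_prob_uncovered.
  move: e1'; rewrite E distrC => e1'.
  have e2' : `|(\int[gam]_t \sum_i q i t) * C - (\int[gam]_t H t) * C| <= (`|L'| + M' * A) / k.
    rewrite -mulrBl normrM (ger0_norm C0) (le_trans _ e2)// ler_piMr//.
    by case/andP: C01.
  rewrite (le_trans (ler_distD ((\int[gam]_t \sum_i q i t) * C) _ _))//.
  rewrite (le_trans (lerD e1' e2'))// -mulrDl ler_pM2r ?invr_gt0//; lra.
have LHSE : \int[P]_w (f (z + weighted_sum (e :: s) w) * box (e :: s) B w) =
    \int[P]_w (h w (X e w) * box (e :: s) B w).
  by apply: eq_Rintegral => w _; rewrite /weighted_sum big_cons addrA.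
rewrite LHSE -/C [gauss_avg _ _ _](_ : _ = \int[gam]_t H t)//.
apply/eqP; rewrite -subr_eq0 -normr_le0; apply/ler_addgt0Pr => r r0; rewrite add0r.
pose D := (`|L| + `|L'|) + (M + M') * A.
have D0 : 0 <= D by rewrite !addr_ge0// mulr_ge0// addr_ge0.
rewrite (le_trans (approx (Num.bound (D / r))))// -/D.
rewrite ler_pdivrMr// mulrC -ler_pdivrMr// (le_trans (ltW (archi_boundP _)))//.
  by rewrite divr_ge0// ltW.
by rewrite ler_nat.
Qed.

End law.

(** * Tail bound for the supremum over finitely many points *)

Section covariance_comparison.
Variables (R : realType) (N : nat) (a b : R).
Hypothesis b0 : 0 < b.
Local Notation V := 'rV[R]_N.
Local Notation u := (@soft_step R N a b).
Local Notation u2 := (@soft_step2 R N a b).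
Implicit Types (z v : V) (l : seq V).

(** Covariance of the coordinates of [\sum_(v <- l) s_v *: v] for independent
    standard normal weights [s_v]. *)
Definition cov l i j : R := \sum_(v <- l) v 0 i * v 0 j.

(** The increments enter the second order term only through their covariance,
    which is why covariances alone decide the comparison. *)
Lemma sum_soft_step2 l z : \sum_(v <- l) u2 v z =
  u z * (\sum_i \sum_j gibbs a b i z * gibbs a b j z * cov l i j -
         (\sum_i gibbs a b i z * cov l i i) / 2).
Proof.
rewrite /soft_step2 -mulr_sumr sumrB -mulr_suml; congr (_ * (_ - _ / _)).
- under [RHS]eq_bigr do under eq_bigr do rewrite mulr_sumr.
  under [RHS]eq_bigr do rewrite exchange_big/=.
  rewrite [RHS]exchange_big/=; apply: eq_bigr => v _.
  rewrite expr2 mulr_suml; apply: eq_bigr => i _.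
  by rewrite mulr_sumr; apply: eq_bigr => j _; ring.
- under [RHS]eq_bigr do rewrite mulr_sumr.
  rewrite [RHS]exchange_big/=; apply: eq_bigr => v _.
  by apply: eq_bigr => i _; ring.
Qed.

(** Gaussian comparison of Slepian type: with equal variances, a larger
    covariance makes it more likely that all coordinates stay small. *)
Lemma slepian_soft_step l1 l2 z : (forall i, cov l1 i i = cov l2 i i) ->
  (forall i j, cov l2 i j <= cov l1 i j) ->
  gauss_avgs l2 u z <= gauss_avgs l1 u z.
Proof.
move=> diag off; apply: gauss_comparison => // x; rewrite !sum_soft_step2.
rewrite ler_wpM2l//; first exact/ltW/soft_step_gt0.
rewrite lerB//; last by under eq_bigr do rewrite diag.
apply: ler_sum => i _; apply: ler_sum => j _.
by rewrite ler_wpM2l// mulr_ge0// gibbs_ge0.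
Qed.

End covariance_comparison.

Section product_bound.
Variables (R : realType) (V : lmodType R) (J : eqType) (dir : J -> V) (c : J -> R -> R).
Local Notation gam := (@normal_prob R 0 1).
Hypothesis c_int : forall j, gam.-integrable setT (EFin \o c j).
Hypothesis c_ge0 : forall j t, 0 <= c j t.

(** The weights are independent: a bound that factors over them integrates to a
    product of one dimensional integrals. *)
Lemma gauss_avgs_le_prod (r : seq J) f z K : uniq r -> bounded_lipschitz f -> 0 <= K ->
  (forall t : J -> R, f (z + \sum_(j <- r) t j *: dir j) <= K * \prod_(j <- r) c j (t j)) ->
  gauss_avgs (map dir r) f z <= K * \prod_(j <- r) \int[gam]_t c j t.
Proof.
elim: r z K => [|j r ih] z K /=.
  by move=> _ fbl K0 /(_ (fun=> 0)); rewrite !big_nil addr0.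
move=> /andP[jr ur] fbl K0 fK.
have i1 := bl_line_integrable z (dir j) (bl_gauss_avgs (map dir r) fbl).
rewrite big_cons mulrCA -RintegralZr//; apply: le_Rintegral => //.
  by under eq_fun do rewrite mulrC; exact: integrable_EFinZ.
move=> s _; rewrite mulrA [_ * K]mulrC; apply: ih => //; first by rewrite mulr_ge0.
move=> t; have := fK (fun i => if i == j then s else t i).
rewrite !big_cons eqxx addrA mulrA.
rewrite (eq_big_seq (fun i => t i *: dir i)); last first.
  by move=> i ir; case: eqP => // ij; rewrite -ij ir in jr.
rewrite [X in _ * X](eq_big_seq (fun i => c i (t i)))// => i ir.
by case: eqP => // ij; rewrite -ij ir in jr.
Qed.

End product_bound.

Section excess.
Variable R : realType.
Local Notation gam := (@normal_prob R 0 1).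
Implicit Types (c v x : R).

(** By [le_excess], [k] squares cost at most [k * v] plus the excesses of all
    coordinates, whichever coordinates are chosen; this replaces a union bound
    over supports. *)
Definition excess v x : R := Num.max (x ^+ 2 - v) 0.

Lemma excess_ge0 v x : 0 <= excess v x.
Proof. by rewrite le_max lexx orbT. Qed.

Lemma le_excess v x : x ^+ 2 <= v + excess v x.
Proof. by rewrite -lerBlDl le_max lexx. Qed.

Lemma excess_le v x : 0 <= v -> excess v x <= x ^+ 2.
Proof. by move=> v0; rewrite ge_max sqr_ge0 andbT lerBlDr lerDl. Qed.

Lemma excess0 x : excess 0 x = x ^+ 2.
Proof. by rewrite /excess subr0; apply/max_idPl; exact: sqr_ge0. Qed.

Lemma measurable_excess v : measurable_fun setT (excess v).
Proof.
by apply: measurable_maxr => //; apply: measurable_funB => //; exact: exprn_measurable.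
Qed.

Definition excess_mgf c v : R := \int[gam]_x expR (c * excess v x).

Lemma integrable_expR_excess c v : 0 <= c < 1 / 2 -> 0 <= v ->
  gam.-integrable setT (EFin \o (fun x => expR (c * excess v x))).
Proof.
move=> /andP[c0 c2] v0.
apply: le_integrable (normal_prob_integrable_expR_sqr c2) => //.
  apply/measurable_EFinP; apply: measurableT_comp => //.
  by apply: measurable_funM => //; exact: measurable_excess.
move=> x _; rewrite /= !ger0_norm ?expR_ge0// lee_fin ler_expR.
by rewrite ler_wpM2l// excess_le.
Qed.

(** A positive lower bound for the probability that the common Gaussian pushes
    all coordinates upwards, see [exceed_le_soft_step]. *)
Definition kappa : R := fine (gam `[0, 1]).

Lemma kappa_gt0 : 0 < kappa.
Proof.
have phi1 : 0 < normal_pdf 0 1 (1 : R).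
  by rewrite std_normal_pdfE mulr_gt0 ?expR_gt0// invr_gt0 sqrtr_gt0 mulrn_wgt0// pi_gt0.
have : ((normal_pdf 0 1 (1 : R))%:E <= gam `[0%R, 1%R])%E.
  rewrite /normal_prob.
  have -> : ((normal_pdf 0 1 (1 : R))%:E = \int[@lebesgue_measure R]_(x in `[0%R, 1%R]) (normal_pdf 0 1 (1 : R))%:E)%E.
    by rewrite integral_cst//= lebesgue_measure_itv/= lte_fin ltr01 oppr0 adde0 mule1.
  apply: ge0_le_integral => //=.
  - by move=> x _; rewrite lee_fin ltW.
  - by apply/measurable_funTS/measurable_EFinP; exact: measurable_normal_pdf.
  move=> x; rewrite in_itv/= => /andP[x0 x1]; rewrite lee_fin !std_normal_pdfE.
  rewrite ler_wpM2l ?invr_ge0// ler_expR ler_wpM2r// lerN2.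
  by rewrite lerXn2r// nnegrE.
rewrite -[gam _]fineK; last by apply: fin_num_measure.
by rewrite lee_fin; exact: lt_le_trans.
Qed.

End excess.

Lemma big_enumT (S : Type) (idx : S) (op : S -> S -> S) (K : finType) (F : K -> S) :
  \big[op/idx]_(i <- enum {: K}) F i = \big[op/idx]_(i : K) F i.
Proof. by rewrite enumT. Qed.

Section finite_supremum.
Context d (T : measurableType d) (R : realType) (P : probability T R).
Variables (m n k N : nat) (A : 'I_m -> 'I_n -> {RV P >-> R}).
Hypothesis A_iid : iid_std_normal A.
Variables (x : 'I_N -> 'cV[R]_n) (y : 'I_N -> 'cV[R]_m).
Hypotheses (x1 : forall i, l2norm (x i) = 1) (y1 : forall i, l2norm (y i) = 1).
Hypothesis xk : forall i, (l0norm (x i) <= k)%N.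
Local Notation gam := (@normal_prob R 0 1).
Local Notation V := 'rV[R]_N.

Definition dot p (u v : 'cV[R]_p) : R := \sum_i u i 0 * v i 0.

Lemma sqr_l2norm p (u : 'cV[R]_p) : l2norm u ^+ 2 = \sum_i u i 0 ^+ 2.
Proof. by rewrite sqr_sqrtr// sumr_ge0// => i _; exact: sqr_ge0. Qed.

Lemma dot_unit_le1 p (u v : 'cV[R]_p) : l2norm u = 1 -> l2norm v = 1 -> dot u v <= 1.
Proof.
move=> u1 v1; have : 0 <= \sum_i (u i 0 - v i 0) ^+ 2 by rewrite sumr_ge0// => i _; exact: sqr_ge0.
have -> : \sum_i (u i 0 - v i 0) ^+ 2 = \sum_i u i 0 ^+ 2 + \sum_i v i 0 ^+ 2 - 2 * dot u v.
  by rewrite mulr_sumr -big_split -sumrB; apply: eq_bigr => i _ /=; ring.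
by rewrite -!sqr_l2norm u1 v1; lra.
Qed.

Lemma dot_unit_self p (u : 'cV[R]_p) : l2norm u = 1 -> dot u u = 1.
Proof.
move=> u1; transitivity (l2norm u ^+ 2); last by rewrite u1 expr1n.
by rewrite sqr_l2norm; apply: eq_bigr => i _; rewrite expr2.
Qed.

(** The coordinates of [z] are the values at the [N] points of two Gaussian
    processes: the bilinear one, [y^T A x], to which [bilinear_dirs] adds one
    Gaussian common to all points, and the decoupled one, [g^T y + h^T x]. *)
Definition bilinear_dir (e : 'I_m * 'I_n) : V := \row_i (y i e.1 0 * x i e.2 0).
Definition decoupled_dir (e : 'I_m + 'I_n) : V :=
  \row_i match e with inl p => y i p 0 | inr q => x i q 0 end.

Definition bilinear_dirs := const_mx 1 :: map bilinear_dir (enum {: 'I_m * 'I_n}).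
Definition decoupled_dirs := map decoupled_dir (enum {: 'I_m + 'I_n}).

Lemma cov_bilinear i j : cov bilinear_dirs i j = 1 + dot (y i) (y j) * dot (x i) (x j).
Proof.
rewrite /cov big_cons !mxE mulr1 big_map big_enumT/=; congr (_ + _).
rewrite /dot mulr_suml; under [RHS]eq_bigr do rewrite mulr_sumr.
by rewrite pair_bigA/=; apply: eq_bigr => e _; rewrite !mxE; ring.
Qed.

Lemma cov_decoupled i j : cov decoupled_dirs i j = dot (y i) (y j) + dot (x i) (x j).
Proof.
rewrite /cov big_map big_enumT/= big_sumType/=.
by congr (_ + _); apply: eq_bigr => p _; rewrite !mxE.
Qed.

(** The common Gaussian makes all variances equal to 2.  The covariances of two
    points then differ by [(1 - dot y y') * (1 - dot x x')], which is
    nonnegative for unit vectors. *)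
Lemma bilinear_comparison a b z : 0 < b ->
  gauss_avgs decoupled_dirs (soft_step a b) z <= gauss_avgs bilinear_dirs (soft_step a b) z.
Proof.
move=> b0; apply: slepian_soft_step => // [i|i j]; rewrite cov_bilinear cov_decoupled.
  by rewrite !dot_unit_self// mulr1.
rewrite -subr_ge0.
have -> : 1 + dot (y i) (y j) * dot (x i) (x j) - (dot (y i) (y j) + dot (x i) (x j)) =
  (1 - dot (y i) (y j)) * (1 - dot (x i) (x j)) by ring.
by rewrite mulr_ge0// subr_ge0 dot_unit_le1.
Qed.

Definition bilin_value i w : R := \sum_p \sum_q y i p 0 * A p q w * x i q 0.
Definition exceed a : set T := [set w | exists i, a < bilin_value i w].

Let W w : V := weighted_sum (fun e => A e.1 e.2) bilinear_dir (enum {: 'I_m * 'I_n}) w.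

Lemma weighted_sum_bilinear w i : W w 0 i = bilin_value i w.
Proof.
rewrite /W /weighted_sum big_enumT/= summxE /bilin_value pair_bigA/=.
by apply: eq_bigr => e _; rewrite !mxE; ring.
Qed.

Lemma measurable_exceed a : measurable (exceed a).
Proof.
have -> : exceed a = \bigcup_(i : 'I_N) [set w | a < bilin_value i w].
  by apply/seteqP; split => w /=; [move=> [i iw]; exists i|move=> [i _ iw]; exists i].
apply: countable_bigcupT_measurable => [|i]; first exact: countableP.
have mb : measurable_fun setT (bilin_value i).
  apply: measurable_sum => p; apply: measurable_sum => q.
  by apply: measurable_funM => //; exact: measurable_funM.
by rewrite -[X in measurable X]setTI; apply: measurable_fun_ltr => //; exact: measurable_cst.
Qed.

Lemma law_bilinear f z : bounded_lipschitz f ->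
  gauss_avgs (map bilinear_dir (enum {: 'I_m * 'I_n})) f z = \int[P]_w f (z + W w).
Proof.
move=> fbl; have [A_law A_ind] := A_iid.
have := @integral_weighted_sum _ _ _ P _ (fun e => A e.1 e.2) _ bilinear_dir
  (fun e => A_law e.1 e.2) A_ind (enum {: 'I_m * 'I_n}) f z (fun=> setT)
  (enum_uniq _) fbl (fun=> measurableT).
rewrite big_pred0 => [|e]; last by rewrite mem_enum.
rewrite mulr1 => <-; apply: eq_Rintegral => w _.
by rewrite /box big_pred0 ?mulr1// => e; rewrite mem_enum.
Qed.

(** When the common Gaussian lies in [0, 1], it pushes an exceeding coordinate
    further above the level, and there [soft_step] is at most one half. *)
Lemma exceed_le_soft_step a b : 0 < b ->
  kappa R / 2 * fine (P (exceed a)) <= gauss_avgs bilinear_dirs (fun z => 1 - soft_step a b z) 0.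
Proof.
move=> b0; set f := fun z => _; set pe := fine _.
have ubl := bl_soft_step N a b0.
have fbl : bounded_lipschitz f by apply: blB => //; exact: bl_cst.
have mev := measurable_exceed a.
have f0 z : 0 <= f z by rewrite subr_ge0 soft_step_le1.
have half t w : 0 <= t -> exceed a w -> 1 / 2 <= f (0 + t *: const_mx 1 + W w).
  move=> t0 [i iw]; rewrite /f /soft_step; set S := \sum_i _.
  have S1 : 1 <= S.
    rewrite /S (bigD1 i)//= -[leLHS]addr0 lerD//; last first.
      by apply: sumr_ge0 => j _; exact: expR_ge0.
    rewrite -[leLHS]expR0 ler_expR mulr_ge0 ?(ltW b0)// !mxE weighted_sum_bilinear; lra.
  rewrite lerBrDr -lerBrDl (@le_trans _ _ 2^-1)//; last by lra.
  by rewrite lef_pV2 ?posrE//; lra.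
have peE : pe = \int[P]_w \1_(exceed a) w.
  by rewrite /Rintegral integral_indic// setIT.
have kE : kappa R = \int[gam]_t \1_(`[0, 1]) t.
  by rewrite /Rintegral integral_indic// setIT.
have iI : gam.-integrable setT (EFin \o (\1_(`[0, 1]) : R -> R)) by exact: integrable_indic.
have iE : P.-integrable setT (EFin \o (\1_(exceed a) : T -> R)) by exact: integrable_indic.
rewrite mulrAC -mulrA mulrC kE -RintegralZl// [gauss_avgs _ f 0]/= /gauss_avg.
apply: le_Rintegral => //.
- exact: integrable_EFinZ.
- exact: (bl_line_integrable 0 (const_mx 1) (bl_gauss_avgs _ fbl)).
move=> t _; rewrite -/(gauss_avgs _ f) law_bilinear// indicE.
have [|_] := boolP (t \in _); last first.
  by rewrite mulr0; apply: Rintegral_ge0.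
rewrite inE /= in_itv/= => /andP[t0 t1]; rewrite mulr1 peE mulrC -RintegralZl//.
apply: le_Rintegral => //.
- exact: integrable_EFinZ.
- have [[M fM] _] := fbl.
  by apply: (@bounded_integrable _ _ _ _ _ M) => //; exact: measurable_weighted_sum.
move=> w _; rewrite indicE; have [|_] := boolP (w \in _); last by rewrite mulr0.
by rewrite inE mulr1 => wE; have := half t w t0 wE; rewrite div1r.
Qed.

(** The inequality [g * e <= g ^+ 2 / (2 * c) + c / 2 * e ^+ 2] is applied to each
    coordinate, with [c = r] for [y] and, on the support of [x], [c = s].  As [x]
    and [y] are unit vectors, the bound no longer depends on the point, except
    through the size of the support. *)
Lemma coord_decoupled (t : 'I_m + 'I_n -> R) (r s v : R) i : 0 < r -> 0 < s -> 0 <= v ->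
  (0 + \sum_(j <- enum {: 'I_m + 'I_n}) t j *: decoupled_dir j) 0 i <=
  (r / 2 + s / 2 + k%:R * v / (2 * s)) +
  ((\sum_p excess 0 (t (inl p))) / (2 * r) + (\sum_q excess v (t (inr q))) / (2 * s)).
Proof.
move=> r0 s0 v0; rewrite add0r big_enumT/= summxE big_sumType/=.
have amgm (c g e : R) : 0 < c -> g * e <= g ^+ 2 / (2 * c) + c / 2 * e ^+ 2.
  move=> c0; rewrite -subr_ge0.
  have -> : g ^+ 2 / (2 * c) + c / 2 * e ^+ 2 - g * e = (g - c * e) ^+ 2 / (2 * c).
    by field; rewrite gt_eqF.
  by rewrite divr_ge0 ?sqr_ge0// mulr_ge0// ltW.
have hy : \sum_p (t (inl p) *: decoupled_dir (inl p)) 0 i <=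
    (\sum_p excess 0 (t (inl p))) / (2 * r) + r / 2.
  apply: (@le_trans _ _ (\sum_p (excess 0 (t (inl p)) / (2 * r) + r / 2 * y i p 0 ^+ 2))).
    by apply: ler_sum => p _; rewrite !mxE excess0 amgm.
  by rewrite big_split/= -mulr_suml -mulr_sumr -sqr_l2norm y1 expr1n mulr1.
have hx : \sum_q (t (inr q) *: decoupled_dir (inr q)) 0 i <=
    (\sum_q excess v (t (inr q))) / (2 * s) + k%:R * v / (2 * s) + s / 2.
  apply: (@le_trans _ _ (\sum_q (excess v (t (inr q)) / (2 * s) +
      (if x i q 0 != 0 then v / (2 * s) else 0) + s / 2 * x i q 0 ^+ 2))).
    apply: ler_sum => q _; rewrite !mxE; case: eqP => [->|_] /=.
      rewrite mulr0 expr0n mulr0 !addr0 divr_ge0 ?excess_ge0// mulr_ge0// ltW//.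
    rewrite (le_trans (amgm s _ _ s0))// lerD2r -mulrDl ler_pM2r ?invr_gt0 ?mulr_gt0//.
    by rewrite addrC le_excess.
  rewrite !big_split/= -mulr_suml -mulr_sumr -sqr_l2norm x1 expr1n mulr1 lerD2r lerD2l.
  rewrite -big_mkcond/= sumr_const -[leLHS]mulr_natl mulrA ler_pM2r ?invr_gt0 ?mulr_gt0//.
  rewrite ler_wpM2r// ler_nat (leq_trans _ (xk i))// /l0norm cardsE//.
by rewrite (le_trans (lerD hy hx))//; lra.
Qed.

(** The left side is at most 1 and at most [S], hence at most the power [p] of any
    upper bound for [S]. *)
Lemma saturated_le (S L p : R) : 0 <= S -> S <= expR L -> 0 <= p <= 1 ->
  1 - (1 + S)^-1 <= expR (p * L).
Proof.
move=> S0 SL /andP[p0 p1]; have S10 : 0 < 1 + S by lra.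
have [L0|L0] := leP 0 L.
  rewrite (@le_trans _ _ 1)//; first by rewrite lerBlDr lerDl invr_ge0 ltW.
  by rewrite -expR0 ler_expR mulr_ge0.
rewrite (@le_trans _ _ S)//.
  have -> : 1 - (1 + S)^-1 = S / (1 + S) by field; rewrite gt_eqF.
  by rewrite ler_pdivrMr// ler_peMr// lerDl.
by rewrite (le_trans SL)// ler_expR; nra.
Qed.

(** Independence turns the bound of [coord_decoupled], common to all points, into
    a product of one dimensional exponential moments. *)
Lemma decoupled_bound a lam r s v : 0 < lam -> 0 < r -> 0 < s -> 0 <= v ->
  lam < r -> lam < s ->
  gauss_avgs decoupled_dirs (fun z => 1 - soft_step a (lam * N.+1%:R) z) 0 <=
  expR (1 + lam * (r / 2 + s / 2 + k%:R * v / (2 * s) - a)) *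
  (excess_mgf (lam / (2 * r)) 0 ^+ m * excess_mgf (lam / (2 * s)) v ^+ n).
Proof.
move=> lam0 r0 s0 v0 lr ls; set b := lam * _.
have b0 : 0 < b by rewrite mulr_gt0.
pose c (j : 'I_m + 'I_n) (t : R) := match j with
  | inl _ => expR (lam / (2 * r) * excess 0 t) | inr _ => expR (lam / (2 * s) * excess v t) end.
have rate q : 0 < q -> lam < q -> 0 <= lam / (2 * q) < 1 / 2.
  move=> q0 lq; rewrite divr_ge0 ?mulr_ge0 ?ltW//= ltr_pdivrMr ?mulr_gt0//; lra.
have ci j : gam.-integrable setT (EFin \o c j).
  by case: j => j; apply: integrable_expR_excess => //; exact: rate.
have := @gauss_avgs_le_prod R V _ decoupled_dir c ci _ (enum {: 'I_m + 'I_n})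
  (fun z => 1 - soft_step a b z) 0 (expR (1 + lam * (r / 2 + s / 2 + k%:R * v / (2 * s) - a))).
rewrite big_enumT/= big_sumType/= !prodr_const !card_ord; apply => //.
- by case=> j t; exact: expR_ge0.
- exact: enum_uniq.
- by apply: blB; [exact: bl_cst|exact: bl_soft_step].
move=> t; set z := 0 + _.
pose E := (\sum_p excess 0 (t (inl p))) / (2 * r) + (\sum_q excess v (t (inr q))) / (2 * s).
pose M := r / 2 + s / 2 + k%:R * v / (2 * s) + E.
have zM i : z 0 i <= M by exact: coord_decoupled.
have -> : \prod_(j <- enum {: 'I_m + 'I_n}) c j (t j) = expR (lam * E).
  rewrite big_enumT/= big_sumType/= -!expR_sum -!mulr_sumr -expRD /E; congr expR.
  by field; rewrite !gt_eqF.
rewrite -expRD; set S := \sum_i expR (b * (z 0 i - a)).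
have SE : S <= expR (N%:R + b * (M - a)).
  rewrite expRD (@le_trans _ _ (N%:R * expR (b * (M - a))))//; last first.
    rewrite ler_wpM2r ?expR_ge0//; have := expR_ge1Dx (N%:R : R); lra.
  rewrite /S (@le_trans _ _ (\sum_(i < N) expR (b * (M - a))))//.
    by apply: ler_sum => i _; rewrite ler_expR ler_wpM2l ?(ltW b0)// lerD2r.
  by rewrite sumr_const card_ord mulr_natl.
have S0 : 0 <= S by apply: sumr_ge0 => i _; exact: expR_ge0.
(* The sum has [N] terms: the power [N.+1%:R^-1], which the sharpness
   [b = lam * N.+1%:R] allows, reduces this factor to at most [expR 1]. *)
have N1 : 0 < N.+1%:R :> R by [].
have p01 : 0 <= (N.+1%:R : R)^-1 <= 1 by rewrite invr_ge0 ltW//= invf_le1// ler1n.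
rewrite (le_trans (saturated_le S0 SE p01))// ler_expR mulrDr.
have -> : N.+1%:R^-1 * (b * (M - a)) = lam * (M - a) by rewrite /b; field; rewrite gt_eqF.
have -> : 1 + lam * (r / 2 + s / 2 + k%:R * v / (2 * s) - a) + lam * E = 1 + lam * (M - a).
  by rewrite /M; ring.
by rewrite lerD2r mulrC ler_pdivrMr// mul1r ler_nat.
Qed.

(** The bound does not involve the number of points, so it passes to countable
    families. *)
Lemma exceed_bound a lam r s v : 0 < lam -> 0 < r -> 0 < s -> 0 <= v ->
  lam < r -> lam < s ->
  fine (P (exceed a)) <= 2 / kappa R *
  (expR (1 + lam * (r / 2 + s / 2 + k%:R * v / (2 * s) - a)) *
   (excess_mgf (lam / (2 * r)) 0 ^+ m * excess_mgf (lam / (2 * s)) v ^+ n)).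
Proof.
move=> lam0 r0 s0 v0 lr ls; have k0 := kappa_gt0 R.
have b0 : 0 < lam * N.+1%:R by rewrite mulr_gt0.
have := exceed_le_soft_step a b0.
have := decoupled_bound a lam0 r0 s0 v0 lr ls.
have := bilinear_comparison a 0 b0.
have ubl := bl_soft_step N a b0.
have cbl : bounded_lipschitz (fun _ : V => 1 : R) by exact: bl_cst.
rewrite !gauss_avgsB// !gauss_avgs_cst; set B := expR _ * _.
set x1' := gauss_avgs _ _ _; set x2 := gauss_avgs _ _ _ => h1 h2 h3.
have : kappa R / 2 * fine (P (exceed a)) <= B by lra.
have -> : 2 / kappa R * B = B / (kappa R / 2) by field; rewrite gt_eqF.
by rewrite ler_pdivlMr ?divr_gt0// mulrC.
Qed.

End finite_supremum.

(** * Reduction of the supremum to countably many points *)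

Section rational_points.
Variable R : realType.

Lemma cvg_sumr (I : Type) (r : seq I) (F : I -> nat -> R) (L : I -> R) :
  (forall i, F i t @[t --> \oo] --> L i) ->
  \sum_(i <- r) F i t @[t --> \oo] --> \sum_(i <- r) L i.
Proof.
move=> FL; elim: r => [|i r ih].
  by rewrite big_nil; under eq_fun do rewrite big_nil; exact: cvg_cst.
by rewrite big_cons; under eq_fun do rewrite big_cons; exact: cvgD.
Qed.

Lemma rat_approximation (r : R) : exists q : nat -> rat,
  (ratr (q t) : R) @[t --> \oo] --> r /\ forall t, (q t == 0) = (r == 0).
Proof.
have [->|r0] := eqVneq r 0.
  by exists (fun=> 0); split=> [|t]; rewrite ?eqxx// raddf0; exact: cvg_cst.
have pos (p : R) : 0 < p -> exists q : nat -> rat,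
    (ratr (q t) : R) @[t --> \oo] --> p /\ forall t, q t != 0.
  move=> p0; have ex t : exists q : rat, p < ratr q < p + harmonic t.
    have : p < p + harmonic t by rewrite ltrDl /harmonic invr_gt0.
    by move=> /rat_in_itvoo[q]; rewrite in_itv/= => ?; exists q.
  have [q qP] := choice ex; exists q; split; last first.
    move=> t; have /andP[h _] := qP t; apply: contraTneq h => ->.
    by rewrite raddf0 -leNgt ltW.
  have h1 : p + harmonic t @[t --> \oo] --> p.
    by rewrite -[X in _ --> X]addr0; apply: cvgD; [exact: cvg_cst|exact: cvg_harmonic].
  apply: (squeeze_cvgr _ (cvg_cst p) h1); near=> t.
  by have /andP[/ltW -> /ltW ->] := qP t.
have [rp|rn|re] := ltrgt0P r; last by rewrite re eqxx in r0.
  have [q [qr q0]] := pos r rp; exists q; split=> // t.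
  exact: negbTE (q0 t).
have [|q [qr q0]] := pos (- r); first by rewrite oppr_gt0.
exists (fun t => - q t); split.
  by rewrite -[r]opprK; under eq_fun do rewrite raddfN; exact: cvgN.
by move=> t; rewrite oppr_eq0; exact: negbTE (q0 t).
Unshelve. all: by end_near. Qed.

Definition ratv p (v : 'cV[rat]_p) : 'cV[R]_p := map_mx ratr v.

(** Zero coordinates are approximated by zero, so that supports are preserved. *)
Lemma rat_vector_approximation p (u : 'cV[R]_p) : exists q : nat -> 'cV[rat]_p,
  (forall i, ratv (q t) i 0 @[t --> \oo] --> u i 0) /\
  forall t i, (ratv (q t) i 0 == 0) = (u i 0 == 0).
Proof.
have [q qP] := choice (fun i : 'I_p => rat_approximation (u i 0)).
exists (fun t => \col_i q i t); split=> [i|t i].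
  by under eq_fun do rewrite !mxE; exact: (qP i).1.
by rewrite !mxE fmorph_eq0 (qP i).2.
Qed.

Lemma l2norm_ge0 p (u : 'cV[R]_p) : 0 <= l2norm u. Proof. exact: sqrtr_ge0. Qed.

Lemma cvg_l2norm p (F : nat -> 'cV[R]_p) (u : 'cV[R]_p) : (forall i, F t i 0 @[t --> \oo] --> u i 0) ->
  l2norm (F t) @[t --> \oo] --> l2norm u.
Proof.
move=> Fu; apply: (cvg_comp (fun t => \sum_i F t i 0 ^+ 2) Num.sqrt); last exact: sqrt_continuous.
by apply: cvg_sumr => i; under eq_fun do rewrite expr2; rewrite expr2; apply: cvgM.
Qed.

Lemma dot_le_l2norm p (u v : 'cV[R]_p) : l2norm u = 1 -> dot u v <= l2norm v.
Proof.
move=> u1; set D := dot u v; have : 0 <= \sum_i (v i 0 - D * u i 0) ^+ 2.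
  by apply: sumr_ge0 => i _; exact: sqr_ge0.
have -> : \sum_i (v i 0 - D * u i 0) ^+ 2 =
    \sum_i (v i 0 ^+ 2 - 2 * D * (u i 0 * v i 0) + D ^+ 2 * u i 0 ^+ 2).
  by apply: eq_bigr => i _; ring.
rewrite big_split/= sumrB -!mulr_sumr -/(dot u v) -/D.
rewrite -!sqr_l2norm u1 expr1n mulr1 => h.
have [d0|d0] := leP 0 D; last exact: le_trans (ltW d0) (l2norm_ge0 v).
rewrite -(@ler_pXn2r _ 2)// ?nnegrE ?l2norm_ge0//; lra.
Qed.

Definition unitv p (u : 'cV[R]_p) := (l2norm u)^-1 *: u.

Lemma l2normZ p (c : R) (u : 'cV[R]_p) : l2norm (c *: u) = `|c| * l2norm u.
Proof.
rewrite /l2norm -sqrtr_sqr -sqrtrM ?sqr_ge0//; congr Num.sqrt.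
by rewrite mulr_sumr; apply: eq_bigr => i _; rewrite mxE exprMn.
Qed.

Lemma l2norm_unitv p (u : 'cV[R]_p) : l2norm u != 0 -> l2norm (unitv u) = 1.
Proof. by move=> u0; rewrite l2normZ ger0_norm ?invr_ge0 ?l2norm_ge0// mulVf. Qed.

Lemma l0normZ p (c : R) (u : 'cV[R]_p) : c != 0 -> l0norm (c *: u) = l0norm u.
Proof.
move=> c0; rewrite /l0norm; apply: eq_card => i.
by rewrite !inE mxE mulf_eq0 negb_or c0.
Qed.

End rational_points.

Section operator.
Variables (R : realType) (k m n : nat).
Implicit Types (B : 'M[R]_(m, n)) (a : R).

Definition gains B := [set l2norm (B *m x) | x in @Sric R n k].

Definition bform (u : 'cV[R]_m) B (v : 'cV[R]_n) : R := \sum_p \sum_q u p 0 * B p q * v q 0.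

Lemma bformE u B v : bform u B v = dot u (B *m v).
Proof.
apply: eq_bigr => p _; rewrite !mxE mulr_sumr.
by apply: eq_bigr => q _; rewrite mulrA.
Qed.

Lemma coord_unit_le1 p (u : 'cV[R]_p) i : l2norm u = 1 -> `|u i 0| <= 1.
Proof.
move=> u1; rewrite -(@ler_pXn2r _ 2)// ?nnegrE// expr1n real_normK ?num_real//.
rewrite -[leRHS](expr1n _ 2) -u1 sqr_l2norm (bigD1 i)//= lerDl.
by apply: sumr_ge0 => j _; exact: sqr_ge0.
Qed.

Lemma has_ubound_gains B : has_ubound (gains B).
Proof.
exists (Num.sqrt (\sum_p (\sum_q `|B p q|) ^+ 2)) => _ [x [x1 _] <-].
rewrite ler_wsqrtr//; apply: ler_sum => p _.
rewrite -(real_normK (num_real _)) lerXn2r ?nnegrE ?sumr_ge0// !mxE.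
rewrite (le_trans (ler_norm_sum _ _ _))//; apply: ler_sum => q _.
by rewrite normrM ler_piMr// coord_unit_le1.
Qed.

Definition admissible (uv : 'cV[R]_m * 'cV[R]_n) :=
  [/\ l2norm uv.1 = 1, l2norm uv.2 = 1 & l0norm uv.2 = k].

Definition rat_pair (uv : 'cV[rat]_m * 'cV[rat]_n) : 'cV[R]_m * 'cV[R]_n :=
  (unitv (ratv R uv.1), unitv (ratv R uv.2)).

(** If [x] nearly realises the supremum, the pair [(B x, x)], normalised, has a
    large bilinear value, and by continuity so have rational pairs close to it
    with the same support. *)
Lemma lt_sup_gains B a : 0 <= a -> a < sup (gains B) ->
  exists2 uv, admissible (rat_pair uv) & a < bform (rat_pair uv).1 B (rat_pair uv).2.
Proof.
move=> a0 aS.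
have Sn0 : gains B !=set0.
  apply/set0P/eqP => S0; move: aS; rewrite S0 sup0; lra.
have [_ [x [x1 x0] <-] ax] := sup_gt Sn0 aS.
set z := B *m x in ax.
have [p [pz p0]] := rat_vector_approximation z.
have [q [qx q0]] := rat_vector_approximation x.
pose H t := bform (ratv R (p t)) B (ratv R (q t)) - a * (l2norm (ratv R (p t)) * l2norm (ratv R (q t))).
have Hcvg : H t @[t --> \oo] --> bform z B x - a * (l2norm z * l2norm x).
  apply: cvgB.
    apply: cvg_sumr => i; apply: cvg_sumr => j.
    by apply: cvgM; [apply: cvgM; [exact: pz|exact: cvg_cst]|exact: qx].
  by apply: cvgM; [exact: cvg_cst|apply: cvgM; exact: cvg_l2norm].
have H0 : 0 < bform z B x - a * (l2norm z * l2norm x).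
  rewrite bformE -/z x1 mulr1.
  have -> : dot z z = l2norm z ^+ 2 by rewrite sqr_l2norm; apply: eq_bigr => i _; rewrite expr2.
  by rewrite expr2 -mulrBl mulr_gt0 ?subr_gt0//; exact: le_lt_trans ax.
have [t _ /(_ t (leqnn t)) Ht] := cvgr_gt _ Hcvg 0 H0.
have neq0 d (u : 'cV[R]_d) : l2norm u = 0 -> u = 0.
  move=> /eqP; rewrite sqrtr_eq0 => h; apply/matrixP => i j; rewrite ord1 mxE.
  apply/eqP; rewrite -sqrf_eq0 -normr_le0 ger0_norm ?sqr_ge0// (le_trans _ h)//.
  by rewrite (bigD1 i)//= lerDl sumr_ge0// => l _; exact: sqr_ge0.
have bnz (u : 'cV[R]_m) (v : 'cV[R]_n) : 0 < bform u B v - a * (l2norm u * l2norm v) ->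
    l2norm u != 0 /\ l2norm v != 0.
  move=> uv; split; apply/eqP => /neq0 E; move: uv; rewrite E.
    rewrite /bform big1 ?sub0r ?oppr_gt0 ?ltNge ?mulr_ge0 ?l2norm_ge0// => i _.
    by rewrite big1// => j _; rewrite mxE !mul0r.
  rewrite /bform big1 ?sub0r ?oppr_gt0 ?ltNge ?mulr_ge0 ?l2norm_ge0// => i _.
  by rewrite big1// => j _; rewrite mxE mulr0.
have [u0 v0] := bnz _ _ Ht.
exists (p t, q t); first split => /=.
- exact: l2norm_unitv.
- exact: l2norm_unitv.
- rewrite l0normZ ?invr_eq0// -x0 /l0norm; apply: eq_card => i.
  by rewrite !inE q0.
have up : 0 < l2norm (ratv R (p t)) by rewrite lt_neqAle eq_sym u0 l2norm_ge0.
have vp : 0 < l2norm (ratv R (q t)) by rewrite lt_neqAle eq_sym v0 l2norm_ge0.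
have -> : bform (rat_pair (p t, q t)).1 B (rat_pair (p t, q t)).2 =
  bform (ratv R (p t)) B (ratv R (q t)) / (l2norm (ratv R (p t)) * l2norm (ratv R (q t))).
  rewrite /bform mulr_suml; apply: eq_bigr => i _; rewrite mulr_suml; apply: eq_bigr => j _.
  by rewrite !mxE invfM; ring.
by rewrite ltr_pdivlMr ?mulr_gt0// -subr_gt0.
Qed.

Lemma bform_le_sup_gains B uv : admissible uv -> bform uv.1 B uv.2 <= sup (gains B).
Proof.
move=> [u1 v1 v0]; rewrite bformE (le_trans (dot_le_l2norm _ u1))//.
by apply: ub_le_sup; [exact: has_ubound_gains|exists uv.2].
Qed.

Lemma sup_gains_ge0 B : 0 <= sup (gains B).
Proof.
have [->|/set0P[y Sy]] := eqVneq (gains B) set0; first by rewrite sup0.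
apply: (@le_trans _ _ y); last by apply: ub_le_sup => //; exact: has_ubound_gains.
by case: Sy => x _ <-; exact: l2norm_ge0.
Qed.

End operator.

Section tail.
Context d (T : measurableType d) (R : realType) (P : probability T R).
Variables (k m n : nat) (A : 'I_m -> 'I_n -> {RV P >-> R}).
Local Notation xi := (xi_uric k A).
Implicit Types a : R.

Lemma xi_ge0 w : 0 <= xi w.
Proof. exact: sup_gains_ge0. Qed.

(** The admissible normalised rational pairs are listed by [pickle]; an index that
    codes none of them repeats a fixed one. *)
Lemma xi_exceed a : 0 <= a -> [set w | a < xi w] = set0 \/
  exists uv : nat -> 'cV[R]_m * 'cV[R]_n, (forall i, admissible k (uv i)) /\
    [set w | a < xi w] =
    \bigcup_N exceed A (fun i : 'I_N => (uv i).2) (fun i : 'I_N => (uv i).1) a.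
Proof.
move=> a0; pose B w : 'M[R]_(m, n) := \matrix_(i, j) A i j w.
have [[uv0 uv0P]|noadm] := pselect (exists uv, admissible k (@rat_pair R m n uv)); last first.
  left; apply/seteqP; split => // w /= /(lt_sup_gains a0)[uv uvP _].
  by apply: noadm; exists uv.
right; pose pt i := if unpickle i is Some uv then
  (if `[< admissible k (@rat_pair R m n uv) >] then rat_pair R uv else rat_pair R uv0) else rat_pair R uv0.
have ptP i : admissible k (pt i).
  by rewrite /pt; case: unpickle => // uv; case: asboolP.
have bE i w : \sum_p \sum_q (pt i).1 p 0 * A p q w * (pt i).2 q 0 = bform (pt i).1 (B w) (pt i).2.
  by apply: eq_bigr => p _; apply: eq_bigr => q _; rewrite !mxE.
exists pt; split => //; apply/seteqP; split => w /=.
  move=> /(lt_sup_gains a0)[uv uvP]; rewrite -/(B w) => auv.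
  have ptE : pt (pickle uv) = rat_pair R uv by rewrite /pt pickleK; case: asboolP.
  exists (pickle uv).+1 => //; exists ord_max.
  by rewrite -[bilin_value _ _ _ _ _]/(\sum_p \sum_q (pt (pickle uv)).1 p 0 * A p q w *
    (pt (pickle uv)).2 q 0) bE ptE.
move=> [N _ [i]]; rewrite -[bilin_value _ _ _ _ _]/(\sum_p \sum_q (pt i).1 p 0 * A p q w *
  (pt i).2 q 0) bE => /lt_le_trans; apply.
exact: (bform_le_sup_gains (B w) (ptP i)).
Qed.

Lemma measurable_exceed_xi a : measurable [set w | a < xi w].
Proof.
have [a0|a0] := leP 0 a; last first.
  rewrite (_ : [set w | _] = setT)//; apply/seteqP; split => // w _ /=.
  exact: lt_le_trans a0 (xi_ge0 w).
have [->//|[uv [_ ->]]] := xi_exceed a0.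
by apply: bigcup_measurable => N _; exact: measurable_exceed.
Qed.

Lemma measurable_xi : measurable_fun setT xi.
Proof.
apply: (measurability _ (RGenOInfty.measurableE R)).
move=> _ [_ [a ->] <-]; rewrite setTI.
rewrite (_ : _ @^-1` _ = [set w | a < xi w]); first exact: measurable_exceed_xi.
by apply/seteqP; split => w /=; rewrite in_itv/= andbT.
Qed.

Lemma xi_tail a C : 0 <= a -> 0 <= C ->
  (forall N (uv : 'I_N -> 'cV[R]_m * 'cV[R]_n), (forall i, admissible k (uv i)) ->
    fine (P (exceed A (fun i => (uv i).2) (fun i => (uv i).1) a)) <= C) ->
  fine (P [set w | a < xi w]) <= C.
Proof.
move=> a0 C0 HC; have [->|[uv [uvP E]]] := xi_exceed a0; first by rewrite measure0.
set F := fun N : nat => exceed A (fun i : 'I_N => (uv i).2) (fun i : 'I_N => (uv i).1) a in E.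
have mF N : measurable (F N) by exact: measurable_exceed.
have mU : measurable (\bigcup_N F N) by exact: bigcup_measurable.
have ndF : {homo F : p q / (p <= q)%N >-> (p <= q)%O}.
  move=> p q pq; apply/subsetPset => w [i iw]; exists (widen_ord pq i); exact: iw.
have cv := @nondecreasing_cvg_mu _ _ _ P _ mF mU ndF.
rewrite E -lee_fin fineK ?fin_num_measure// -(cvg_lim _ cv)//.
apply: lime_le; first by apply/cvg_ex; eexists; exact: cv.
apply: nearW => N; rewrite /= -[leLHS]fineK ?fin_num_measure// lee_fin.
exact: (HC N (fun i => uv i)).
Qed.

End tail.

(** * The error function and the mean excess *)

Section error_function.
Variable R : realType.
Local Notation gam := (@normal_prob R 0 1).
Local Notation mu := (@lebesgue_measure R).
Local Notation phi := (@normal_pdf R 0 1).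

Definition gauss_primitive (x : R) : R := \int[mu]_(t in `[0, x]) gauss_fun t.
Local Notation I := gauss_primitive.

Lemma gauss_fun_integrable (a b : R) : mu.-integrable `[a, b] (EFin \o gauss_fun).
Proof.
apply: continuous_compact_integrable => //; first exact: segment_compact.
by apply: continuous_subspaceT; exact: continuous_gauss_fun.
Qed.

Lemma gauss_primitive_ge0 x : 0 <= I x.
Proof. by apply: Rintegral_ge0 => t _; exact: gauss_fun_ge0. Qed.

Lemma gauss_primitive0 : I 0 = 0.
Proof. by rewrite /I set_itv1 Rintegral_set1. Qed.

Lemma gauss_primitive_cvg : I x @[x --> +oo] --> Num.sqrt pi / 2.
Proof.
have : Num.sqrt (I x ^+ 2) @[x --> +oo] --> Num.sqrt (pi / 4 : R).
  apply: (cvg_comp (fun x => I x ^+ 2) Num.sqrt); last exact: sqrt_continuous.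
  exact: gauss_integral_proof.cvg_integral0_gauss_sqr.
have -> : Num.sqrt (pi / 4 : R) = Num.sqrt pi / 2.
  rewrite sqrtrM ?pi_ge0// sqrtrV//; congr (_ / _).
  by rewrite (_ : 4 = 2 ^+ 2) ?sqrtr_sqr ?ger0_norm// expr2 -natrM.
suff -> : (fun x => Num.sqrt (I x ^+ 2)) = I by [].
by apply/funext => x; rewrite sqrtr_sqr ger0_norm// gauss_primitive_ge0.
Qed.

Lemma gauss_primitive_is_derive (x : R) : 0 < x -> is_derive x 1 I (gauss_fun x).
Proof.
move=> x0; have x1 : x < x + 1 by rewrite ltrDl.
have cg : {for x, continuous (@gauss_fun R)} by exact: continuous_gauss_fun.
have [dI <-] := continuous_FTC1_closed x1 (gauss_fun_integrable 0 (x + 1)) x0 cg.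
by rewrite derive1E; split.
Qed.

Lemma erfE (x : R) : 0 <= x -> erf x = 2 / Num.sqrt pi * I x.
Proof.
move=> x0; rewrite /erf -/(I x); congr (_ * _).
suff -> : \int[mu]_(t in `[x, 0]) expR (- t ^+ 2) = 0 by rewrite subr0.
move: x0; rewrite le_eqVlt => /predU1P[<-|x0]; first by rewrite set_itv1 Rintegral_set1.
by rewrite set_itv_ge ?Rintegral_set0// bnd_simp -ltNge.
Qed.

Lemma erf_le0 (x : R) : x <= 0 -> erf x <= 0.
Proof.
move=> x0; rewrite /erf -/(I x) mulr_ge0_le0//.
rewrite subr_le0 (@le_trans _ _ 0)//; last by apply: Rintegral_ge0 => t _; exact: expR_ge0.
move: x0; rewrite le_eqVlt => /predU1P[->|x0]; first by rewrite gauss_primitive0.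
by rewrite /I set_itv_ge ?Rintegral_set0// bnd_simp -ltNge.
Qed.

(** The value [y] is attained by the intermediate value theorem, since [erf] is 0
    at 0 and tends to 1. *)
Lemma erfinvK (y : R) : 0 < y < 1 -> erf (erfinv y) = y.
Proof.
move=> /andP[y0 y1]; rewrite /erfinv pinvK// inE /=.
have sp : 0 < Num.sqrt pi :> R by rewrite sqrtr_gt0 pi_gt0.
pose c : R := Num.sqrt pi / 2.
have c0 : 0 < c by rewrite divr_gt0.
have : \forall x \near +oo, y * c < I x.
  by apply: cvgr_gt gauss_primitive_cvg _ _; rewrite -/c gtr_pMl.
move=> [M [_ HM]].
pose b := Num.max M 0 + 1.
have b0 : 0 < b by rewrite ltr_pwDr// le_max lexx orbT.
have Ib : y * c < I b by apply: HM; rewrite ltr_pwDr// le_max lexx.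
have cI : {within `[0, b], continuous I}.
  by apply: parameterized_integral_continuous; [exact: ltW|exact: gauss_fun_integrable].
have [|e] := @IVT R I 0 b (y * c) (ltW b0) cI.
  rewrite gauss_primitive0 min_l ?gauss_primitive_ge0// max_r ?gauss_primitive_ge0//.
  by rewrite mulr_ge0 ?ltW.
rewrite in_itv/= => /andP[e0 _] Ie; exists e => //.
have sn : Num.sqrt pi != 0 :> R by rewrite gt_eqF.
by rewrite erfE// Ie /c; field.
Qed.

Lemma erfinv_gt0 (y : R) : 0 < y < 1 -> 0 < erfinv y.
Proof.
move=> y01; rewrite ltNge; apply/negP => /erf_le0; rewrite erfinvK// leNgt.
by case/andP: y01 => ->.
Qed.

Lemma mul_expR_cvg0 : x * expR (- x ^+ 2 / 2) @[x --> +oo] --> (0 : R).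
Proof.
have h : 2 * x^-1 @[x --> +oo] --> (0 : R).
  rewrite -[X in _ --> X](mulr0 2); apply: cvgM; first exact: cvg_cst.
  by apply/gtr0_cvgV0; [exact: nbhs_pinfty_gt|exact: cvg_id].
apply: (squeeze_cvgr _ (cvg_cst 0) h); near=> x.
have x0 : 0 < x by near: x; apply: nbhs_pinfty_gt.
apply/andP; split; first by rewrite mulr_ge0 ?expR_ge0// ltW.
rewrite /= ler_pdivlMr// mulrAC mulNr expRN ler_pdivrMr ?expR_gt0//.
by have := expR_ge1Dx (x ^+ 2 / 2); lra.
Unshelve. all: by end_near. Qed.

(** By symmetry the mean is twice an integral over [t, +oo[, where
    [(x ^+ 2 - t ^+ 2) * phi x] has an antiderivative: [1 - t ^+ 2] times a
    primitive of [phi], minus [x * phi x]. *)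
Lemma excess_mean (t : R) : 0 < t ->
  \int[gam]_x excess (t ^+ 2) x + (1 - erf (t / Num.sqrt 2)) * t ^+ 2 =
  1 - erf (t / Num.sqrt 2) + 2 * t * phi t.
Proof.
move=> t0; pose v := t ^+ 2; pose s2 : R := Num.sqrt 2; pose sp : R := Num.sqrt pi.
have s20 : 0 < s2 by rewrite sqrtr_gt0.
have sp0 : 0 < sp by rewrite sqrtr_gt0 pi_gt0.
have s2n : s2 != 0 by rewrite gt_eqF.
have spn : sp != 0 by rewrite gt_eqF.
have phiE x : phi x = (sp * s2)^-1 * expR (- x ^+ 2 / 2).
  by rewrite std_normal_pdfE -(mulr_natr pi 2) sqrtrM ?pi_ge0.
have s22 : s2 ^+ 2 = 2 by rewrite sqr_sqrtr.
have gE x : gauss_fun (x / s2) = expR (- x ^+ 2 / 2).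
  by rewrite /gauss_fun expr_div_n s22 mulNr.
(* The antiderivative, up to a constant. *)
pose F (x : R) : R := (1 - v) / sp * I (x / s2) - x * ((sp * s2)^-1 * expR (- x ^+ 2 / 2)).
have dF (x : R) : 0 < x -> is_derive x 1 F ((x ^+ 2 - v) * phi x).
  move=> x0.
  have dI : is_derive x 1 (fun y : R => I (y / s2)) (gauss_fun (x / s2) * s2^-1).
    apply: (@is_derive1_comp _ I (fun y : R => y / s2)).
      exact: (@gauss_primitive_is_derive (x / s2) (divr_gt0 x0 s20)).
    apply: is_derive_eq.
    by rewrite scaler0 add0r /GRing.scale/= mulr1.
  have dE : is_derive x 1 (fun y : R => expR (- y ^+ 2 / 2)) (expR (- x ^+ 2 / 2) * - x).
    apply: (@is_derive1_comp _ expR (fun y : R => - y ^+ 2 / 2)).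
    apply: is_derive_eq.
    by rewrite !scaler0 add0r /GRing.scale/=; field.
  apply: is_derive_eq; rewrite gE phiE /GRing.scale/=; field.
  by rewrite ?spn ?s2n.
have cphi : continuous phi by apply: continuous_normal_pdf; rewrite oner_neq0.
have Fy : F x @[x --> +oo] --> (1 - v) / 2.
  have -> : (1 - v) / 2 = (1 - v) / sp * (sp / 2) - 0 * (sp * s2)^-1.
    by rewrite mul0r subr0 mulrA divfK.
  apply: cvgB.
    apply: cvgM; first exact: cvg_cst.
    apply: (cvg_comp (fun x => x / s2) I); last exact: gauss_primitive_cvg.
    by apply: gt0_cvgMly; [rewrite invr_gt0|exact: cvg_id].
  under eq_fun do rewrite mulrCA mulrC.
  by apply: cvgM; [exact: mul_expR_cvg0|exact: cvg_cst].
have ftc : \int[mu]_(x in `[t, +oo[) ((x ^+ 2 - v) * phi x) = (1 - v) / 2 - F t.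
  apply: (@Rintegral_ge0_continuous_FTC2y _ (fun x => (x ^+ 2 - v) * phi x) F t).
  - move=> x tx; rewrite mulr_ge0 ?normal_pdf_ge0// subr_ge0 /v.
    by rewrite lerXn2r// nnegrE ?(ltW t0)// (le_trans (ltW t0)).
  - apply: continuous_subspaceT => x; apply: cvgM; last exact: cphi.
    by apply: cvgB; [exact: sqr_continuous|exact: cvg_cst].
  - exact: Fy.
  - by move=> x tx; have := dF x (lt_trans t0 tx).
  - apply: cvg_at_right_filter; apply: differentiable_continuous.
    by apply/derivable1_diffP; have := dF t t0.
  - move=> x; rewrite in_itv/= andbT => tx; rewrite derive1E.
    by have dFx := dF x (lt_trans t0 tx); rewrite derive_val.
have exE : \int[gam]_x excess v x = 2 * (\int[mu]_(x in `[t, +oo[) ((x ^+ 2 - v) * phi x)).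
  rewrite /Rintegral ge0_integral_normal_prob; last 2 first.
    by apply/measurable_EFinP; exact: measurable_excess.
    by move=> x; rewrite lee_fin excess_ge0.
  have -> : (\int[mu]_x ((excess v x)%:E * (phi x)%:E) = \int[mu]_x (excess v x * phi x)%:E)%E.
    exact: eq_integral.
  have evx x : excess v (- x) = excess v x by rewrite /excess sqrrN.
  rewrite ge0_symfun_integralT; last 3 first.
  - by move=> x; rewrite mulr_ge0 ?excess_ge0 ?normal_pdf_ge0.
  - move=> x; apply: cvgM; last exact: cphi.
    apply: (@continuous_max R R (fun x : R => x ^+ 2 - v) (fun=> 0) x); last exact: cvg_cst.
    by apply: cvgB; [exact: sqr_continuous|exact: cvg_cst].
  - by move=> x; rewrite /= evx !phiE sqrrN.
  rewrite [X in (_ * X)%E](_ : _ = (\int[mu]_(x in `[t, +oo[) ((x ^+ 2 - v) * phi x)%:E)%E).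
    by case: (integral _ _ _) => [r||]//=; rewrite ?gt0_muley ?gt0_muleNy ?lte_fin//= mulr0.
  rewrite integral_mkcond [RHS]integral_mkcond; apply: eq_integral => x _.
  rewrite !patchE; case: ifPn; rewrite ?inE ?notin_setE/= ?in_itv/= ?andbT.
    move=> x0; case: ifPn; rewrite ?inE ?notin_setE/= in_itv/= andbT => tx.
      congr (_ * _)%:E; apply/max_idPl; rewrite subr_ge0 /v.
      by rewrite lerXn2r// nnegrE ?(ltW t0)// (le_trans (ltW t0)).
    rewrite (_ : excess v x = 0) ?mul0r//; apply/max_idPr; rewrite subr_le0 /v.
    by rewrite lerXn2r// ?nnegrE ?(ltW t0)// leNgt; apply/negP => /ltW.
  move=> x0; case: ifPn => //; rewrite ?inE/= in_itv/= andbT => tx.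
  by case: x0; exact: le_trans (ltW t0) tx.
rewrite -/v exE ftc /F erfE; last by rewrite divr_ge0 ?ltW.
by rewrite -/s2 -/sp phiE; field; apply/andP.
Qed.

(** At this [t] a standard Gaussian exceeds [t] in absolute value with
    probability [beta].  The two terms in [t ^+ 2] then cancel, and what remains
    is the second moment of the Gaussian on that tail. *)
Lemma excess_mean_erfinv (beta : R) : 0 < beta < 1 ->
  let t := Num.sqrt 2 * erfinv (1 - beta) in
  \int[gam]_x excess (t ^+ 2) x + beta * t ^+ 2 =
  beta + 2 * erfinv (1 - beta) / (Num.sqrt pi * expR (erfinv (1 - beta) ^+ 2)).
Proof.
move=> /andP[b0 b1]; have b01 : 0 < 1 - beta < 1 by apply/andP; split; lra.
set e := erfinv _ => t.
have e0 : 0 < e by exact: erfinv_gt0.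
have s20 : 0 < Num.sqrt 2 :> R by rewrite sqrtr_gt0.
have sp0 : 0 < Num.sqrt pi :> R by rewrite sqrtr_gt0 pi_gt0.
have t0 : 0 < t by rewrite mulr_gt0.
have te : t / Num.sqrt 2 = e by rewrite /t mulrAC divff ?mul1r// gt_eqF.
have := excess_mean t0; rewrite te erfinvK// (_ : 1 - (1 - beta) = beta); last by lra.
move=> ->; congr (_ + _).
rewrite std_normal_pdfE -(mulr_natr pi 2) sqrtrM ?pi_ge0//.
have -> : - t ^+ 2 / 2 = - (e ^+ 2).
  by rewrite /t exprMn sqr_sqrtr// mulrC -mulrN mulKf.
rewrite expRN /t !invfM.
transitivity (Num.sqrt 2 * (Num.sqrt 2)^-1 *
  (2 * e * ((Num.sqrt pi)^-1 * (expR (e ^+ 2))^-1))); first by ring.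
by rewrite divff ?mul1r// gt_eqF.
Qed.

End error_function.

(** * Exponential tail in the proportional regime *)

Section excess_mgf_bound.
Variable R : realType.
Local Notation gam := (@normal_prob R 0 1).

(** Second order constant of the logarithm of [excess_mgf] at 0.  The factor 256
    comes from [(x ^+ 2 / 16) ^+ 2 <= expR (x ^+ 2 / 8)]. *)
Definition mgf_curv : R := 256 * \int[gam]_x expR (4^-1 * x ^+ 2).

Lemma mgf_curv_ge0 : 0 <= mgf_curv.
Proof.
apply: mulr_ge0; first exact: ler0n.
by apply: Rintegral_ge0 => x _; exact: expR_ge0.
Qed.

Lemma integrable_excess (v : R) : 0 <= v ->
  gam.-integrable setT (EFin \o excess v).
Proof.
move=> v0; apply: le_integrable (normal_prob_integrable_sqr R) => //.
  by apply/measurable_EFinP; exact: measurable_excess.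
move=> x _; rewrite lee_fin /= !ger0_norm ?sqr_ge0 ?excess_ge0//.
exact: excess_le.
Qed.

Lemma excess_mgf_le (c v : R) : 0 <= c <= 1 / 8 -> 0 <= v ->
  excess_mgf c v <= expR (c * (\int[gam]_x excess v x) + mgf_curv * c ^+ 2).
Proof.
move=> /andP[c0 c8] v0.
have i4 : gam.-integrable setT (EFin \o (fun x => expR (4^-1 * x ^+ 2))).
  by apply: normal_prob_integrable_expR_sqr; lra.
have ie := integrable_excess v0.
rewrite (le_trans _ (expR_ge1Dx _))// addrA /mgf_curv mulrAC -RintegralZl//.
rewrite -[X in X + _ + _](@Rintegral_cst_prob _ _ _ gam 1) -!RintegralZl//.
have i1 : gam.-integrable setT (EFin \o cst 1) by exact: integrable_cst_prob.
have i2 : gam.-integrable setT (EFin \o (fun x => c * excess v x)) by exact: integrable_EFinZ.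
have i3 : gam.-integrable setT (EFin \o (fun x => 256 * c ^+ 2 * expR (4^-1 * x ^+ 2))).
  exact: integrable_EFinZ.
rewrite -(RintegralD measurableT i1 i2) -(RintegralD measurableT (integrable_EFinD i1 i2) i3).
apply: le_Rintegral => //.
- by apply: integrable_expR_excess => //; apply/andP; split; lra.
- by apply: integrable_EFinD => //; exact: integrable_EFinD.
move=> x _; set y := c * excess v x.
have y0 : 0 <= y by rewrite mulr_ge0// excess_ge0.
have yx : y <= c * x ^+ 2 by rewrite ler_wpM2l// excess_le.
have x0 := sqr_ge0 x.
have := norm_expRB2_le y; rewrite ler_norml => /andP[_].
rewrite ger0_norm// => h.
suff : y ^+ 2 * expR y <= 256 * c ^+ 2 * expR (4^-1 * x ^+ 2) by rewrite /cst; lra.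
have e1 : x ^+ 2 / 16 <= expR (x ^+ 2 / 16) by have := expR_ge1Dx (x ^+ 2 / 16); lra.
have -> : expR (4^-1 * x ^+ 2) = expR (x ^+ 2 / 16) ^+ 2 * expR (x ^+ 2 / 8).
  by rewrite -expRM_natl -expRD; congr expR; field.
rewrite mulrA ler_pM ?sqr_ge0 ?expR_ge0//; last by rewrite ler_expR (le_trans yx)//; nra.
apply: (@le_trans _ _ ((c * x ^+ 2) ^+ 2)).
  by rewrite lerXn2r// nnegrE mulr_ge0.
have -> : (c * x ^+ 2) ^+ 2 = 256 * c ^+ 2 * (x ^+ 2 / 16) ^+ 2 by field.
apply: ler_wpM2l; first exact: mulr_ge0 (ler0n _ _) (sqr_ge0 _).
by rewrite lerXn2r// nnegrE ?expR_ge0// divr_ge0.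
Qed.

End excess_mgf_bound.

Section exponential_tail.
Variables (R : realType) (alpha beta : R).
Hypotheses (beta_gt0 : 0 < beta) (beta_lt1 : beta < 1) (alpha_gt0 : 0 < alpha).
Local Notation gam := (@normal_prob R 0 1).

Let e : R := erfinv (1 - beta).
(** The second moment of a standard Gaussian on its two-sided tail of probability
    [beta]. *)
Definition tail_moment : R := beta + 2 * e / (Num.sqrt pi * expR (e ^+ 2)).
Let v : R := (Num.sqrt 2 * e) ^+ 2.
Let rho : R := Num.sqrt alpha.
Let sig : R := Num.sqrt tail_moment.
Let Ev : R := \int[gam]_x excess v x.
Let K : R := mgf_curv R.

Lemma tail_moment_gt0 : 0 < tail_moment.
Proof.
have e0 : 0 < e by apply: erfinv_gt0; rewrite subr_gt0 beta_lt1/= ltrBlDr ltrDl.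
rewrite ltr_pwDl// mulr_ge0 ?invr_ge0 ?mulr_ge0 ?sqrtr_ge0 ?expR_ge0//.
exact: ltW.
Qed.

Let rho0 : 0 < rho. Proof. by rewrite sqrtr_gt0. Qed.
Let sig0 : 0 < sig. Proof. by rewrite sqrtr_gt0 tail_moment_gt0. Qed.
Let rho2 : rho ^+ 2 = alpha. Proof. by rewrite sqr_sqrtr// ltW. Qed.
Let sig2 : sig ^+ 2 = Ev + beta * v.
Proof.
rewrite sqr_sqrtr; last exact/ltW/tail_moment_gt0.
by rewrite /Ev /v excess_mean_erfinv// beta_gt0.
Qed.
Let v0 : 0 <= v. Proof. exact: sqr_ge0. Qed.
Let K0 : 0 <= K. Proof. exact: mgf_curv_ge0. Qed.

Lemma excess_mgf_pow_le (c w E : R) p (q : R) : 0 <= c <= 1 / 8 -> 0 <= w ->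
  \int[gam]_x excess w x <= E -> 0 <= E -> p%:R <= q ->
  excess_mgf c w ^+ p <= expR ((c * E + K * c ^+ 2) * q).
Proof.
move=> c18 w0 wE E0 pq; have /andP[c0 _] := c18.
apply: (@le_trans _ _ (expR (c * E + K * c ^+ 2) ^+ p)).
  rewrite lerXn2r ?nnegrE ?expR_ge0//.
    by apply: Rintegral_ge0 => x _; exact: expR_ge0.
  by rewrite (le_trans (excess_mgf_le c18 w0))// ler_expR lerD2r ler_wpM2l.
rewrite -expRM_natl ler_expR mulrC ler_wpM2l//.
by rewrite addr_ge0// mulr_ge0// sqr_ge0.
Qed.

(** The first order terms cancel because [rho ^+ 2 = alpha] and
    [sig ^+ 2 = Ev + beta * v]; what is left is [- eps * eta * n] and terms of
    second order in [eps], which cost at most half of it. *)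
Lemma exponent_le (n m k eps eta c1 c2 : R) :
  c1 = eps / (2 * rho) -> c2 = eps / (2 * sig) -> 0 <= n -> 0 < eps ->
  m <= alpha * n + 1 -> k <= beta * n + 1 ->
  eps * (K / 4 + K / (4 * sig ^+ 2)) <= eta / 2 ->
  eps * n * (rho / 2) + eps * n * (sig / 2) + c2 * (k * v) - eps * n * (rho + sig + eta)
  + ((c1 * 1 + K * c1 ^+ 2) * (alpha * n + 1) + (c2 * Ev + K * c2 ^+ 2) * n)
  <= (c2 * v + c1 + K * c1 ^+ 2) - eps * eta / 2 * n.
Proof.
move=> c1E c2E n0 eps0 mn kn epsK.
have c1a : c1 * alpha = eps * rho / 2 by rewrite c1E -rho2; field; rewrite gt_eqF.
have c2s : c2 * (Ev + beta * v) = eps * sig / 2 by rewrite c2E -sig2; field; rewrite gt_eqF.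
have c20 : 0 <= c2 by rewrite c2E divr_ge0 ?mulr_ge0// ltW.
have kv : c2 * (k * v) <= c2 * ((beta * n + 1) * v) by rewrite ler_wpM2l// ler_wpM2r.
have quad : K * c1 ^+ 2 * alpha + K * c2 ^+ 2 <= eps * eta / 2.
  have -> : K * c1 ^+ 2 * alpha + K * c2 ^+ 2 = eps * (eps * (K / 4 + K / (4 * sig ^+ 2))).
    by rewrite c1E c2E -rho2; field; rewrite !gt_eqF.
  by rewrite -mulrA ler_wpM2l ?(ltW eps0)// mulrC.
have quadn : (K * c1 ^+ 2 * alpha + K * c2 ^+ 2) * n <= eps * eta / 2 * n by rewrite ler_wpM2r.
have c1n : c1 * alpha * n = eps * rho / 2 * n by rewrite c1a.
have c2n : c2 * (Ev + beta * v) * n = eps * sig / 2 * n by rewrite c2s.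
lra.
Qed.

(** In [exceed_bound] all scales are multiples of [Num.sqrt n%:R]: [r] and [s] are
    the typical norms of [g] and of the [k] largest coordinates of [h], and
    [lam] is a small multiple. *)
Lemma xi_tail_exp (eta : R) : 0 < eta -> exists C delta, [/\ 0 <= C, 0 < delta &
  forall (k m n : nat) d (T : measurableType d) (P : probability T R)
    (A : 'I_m -> 'I_n -> {RV P >-> R}), iid_std_normal A -> (0 < n)%N ->
    m%:R <= alpha * n%:R + 1 -> k%:R <= beta * n%:R + 1 ->
    fine (P [set w | Num.sqrt n%:R * (rho + sig + eta) < xi_uric k A w]) <=
      C * expR (- (delta * n%:R))].
Proof.
move=> eta0; pose D := K / 4 + K / (4 * sig ^+ 2) + 1.
have D0 : 0 < D.
  by rewrite ltr_wpDl// addr_ge0// divr_ge0// mulr_ge0// sqr_ge0.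
pose eps := Num.min (Num.min (rho / 4) (sig / 4)) (eta / (2 * D)).
have eps0 : 0 < eps by rewrite !lt_min !divr_gt0// mulr_gt0.
have eps1 : eps <= rho / 4 by rewrite !ge_min lexx.
have eps2 : eps <= sig / 4 by rewrite !ge_min lexx orbT.
have eps3 : eps * (K / 4 + K / (4 * sig ^+ 2)) <= eta / 2.
  apply: (@le_trans _ _ (eps * D)); first by rewrite ler_wpM2l ?(ltW eps0)// lerDl.
  by rewrite -ler_pdivlMr// /eps !ge_min invfM mulrA lexx !orbT.
pose c1 := eps / (2 * rho); pose c2 := eps / (2 * sig).
have c10 : 0 < c1 by rewrite divr_gt0// mulr_gt0.
have c20 : 0 < c2 by rewrite divr_gt0// mulr_gt0.
have c18 : 0 <= c1 <= 1 / 8.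
  by rewrite ltW//= /c1 ler_pdivrMr ?mulr_gt0//; lra.
have c28 : 0 <= c2 <= 1 / 8.
  by rewrite ltW//= /c2 ler_pdivrMr ?mulr_gt0//; lra.
have k0 := kappa_gt0 R.
exists (2 / kappa R * expR (1 + (c2 * v + c1 + K * c1 ^+ 2))), (eps * eta / 2).
split; first by rewrite mulr_ge0 ?expR_ge0// divr_ge0// ltW.
  by rewrite divr_gt0// mulr_gt0.
move=> k m n d T P A Aiid n0 mn kn; set sn : R := Num.sqrt n%:R.
have sn0 : 0 < sn by rewrite sqrtr_gt0 ltr0n.
have sn2 : sn * sn = n%:R by rewrite -expr2 sqr_sqrtr.
apply: xi_tail.
- by rewrite mulr_ge0 ?(ltW sn0)// ltW// !addr_gt0.
- by rewrite mulr_ge0 ?expR_ge0// mulr_ge0 ?expR_ge0// divr_ge0// ltW.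
move=> N uv uvP.
have h1 i : l2norm (uv i).2 = 1 by have [] := uvP i.
have h2 i : l2norm (uv i).1 = 1 by have [] := uvP i.
have h3 i : (l0norm (uv i).2 <= k)%N by have [_ _ ->] := uvP i.
have lam0 : 0 < eps * sn by rewrite mulr_gt0.
have r0 : 0 < rho * sn by rewrite mulr_gt0.
have s0 : 0 < sig * sn by rewrite mulr_gt0.
have lr : eps * sn < rho * sn by rewrite ltr_pM2r//; lra.
have ls : eps * sn < sig * sn by rewrite ltr_pM2r//; lra.
have := exceed_bound Aiid h1 h2 h3 (sn * (rho + sig + eta)) lam0 r0 s0 v0 lr ls.
have -> : eps * sn / (2 * (rho * sn)) = c1 by rewrite /c1; field; rewrite !gt_eqF.
have -> : eps * sn / (2 * (sig * sn)) = c2 by rewrite /c2; field; rewrite !gt_eqF.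
move=> /le_trans; apply; rewrite -[leRHS]mulrA ler_wpM2l ?divr_ge0 ?(ltW k0)//.
have p1 : excess_mgf c1 0 ^+ m <= expR ((c1 * 1 + K * c1 ^+ 2) * (alpha * n%:R + 1)).
  apply: excess_mgf_pow_le => //.
  rewrite (le_trans _ (normal_prob_second_moment_le1 R))// le_eqVlt; apply/orP; left.
  by apply/eqP; apply: eq_Rintegral => x _; exact: excess0.
have p2 : excess_mgf c2 v ^+ n <= expR ((c2 * Ev + K * c2 ^+ 2) * n%:R).
  apply: excess_mgf_pow_le => //.
  by apply: Rintegral_ge0 => x _; exact: excess_ge0.
have mge0 c w : 0 <= excess_mgf c w by apply: Rintegral_ge0 => x _; exact: expR_ge0.
rewrite (le_trans (ler_wpM2l (expR_ge0 _) (ler_pM _ _ p1 p2))) ?exprn_ge0 ?mge0//.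
rewrite -!expRD ler_expR.
have := @exponent_le n%:R m%:R k%:R eps eta c1 c2 erefl erefl (ler0n _ _) eps0 mn kn eps3.
have -> : eps * sn * (rho * sn / 2 + sig * sn / 2 + k%:R * v / (2 * (sig * sn)) -
    sn * (rho + sig + eta)) =
  eps * n%:R * (rho / 2) + eps * n%:R * (sig / 2) + c2 * (k%:R * v)
    - eps * n%:R * (rho + sig + eta).
  by rewrite -sn2 /c2; field; rewrite !gt_eqF.
lra.
Qed.

End exponential_tail.

(** * The mean in terms of the tail *)

Section mean_bound.
Context d (T : measurableType d) (R : realType) (P : probability T R).
Variables (k m n : nat) (A : 'I_m -> 'I_n -> {RV P >-> R}).
Hypothesis Aiid : iid_std_normal A.
Local Notation gam := (@normal_prob R 0 1).
Local Notation xi := (xi_uric k A).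

Definition frobenius2 w : R := \sum_p \sum_q A p q w ^+ 2.

Lemma sqr_dot_le p (u v : 'cV[R]_p) : l2norm u = 1 -> dot u v ^+ 2 <= l2norm v ^+ 2.
Proof.
move=> u1; rewrite -(real_normK (num_real _)) lerXn2r ?nnegrE ?l2norm_ge0//.
rewrite ler_norml dot_le_l2norm// andbT lerNl.
have -> : - dot u v = dot u (-1 *: v).
  by rewrite /dot -sumrN; apply: eq_bigr => i _; rewrite mxE mulN1r mulrN.
by rewrite (le_trans (dot_le_l2norm _ u1))// l2normZ normrN1 mul1r.
Qed.

(** The Euclidean operator norm is at most the Frobenius norm. *)
Lemma xi_sqr_le w : xi w ^+ 2 <= frobenius2 w.
Proof.
have F0 : 0 <= frobenius2 w by apply: sumr_ge0 => p _; apply: sumr_ge0 => q _; exact: sqr_ge0.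
rewrite -(sqr_sqrtr F0) lerXn2r ?nnegrE ?sqrtr_ge0 ?xi_ge0//.
pose B : 'M[R]_(m, n) := \matrix_(i, j) A i j w.
rewrite -[xi w]/(sup (gains k B)).
have [->|/set0P S0] := eqVneq (gains k B) set0; first by rewrite sup0 sqrtr_ge0.
apply: ge_sup => // _ [x [x1 _] <-].
rewrite ler_wsqrtr//; apply: ler_sum => p _.
have := @sqr_dot_le n x (\col_q A p q w) x1.
rewrite !sqr_l2norm; under [in leRHS]eq_bigr do rewrite mxE.
apply: le_trans; rewrite le_eqVlt; apply/orP; left; apply/eqP; congr (_ ^+ 2).
by rewrite !mxE; apply: eq_bigr => q _; rewrite !mxE mulrC.
Qed.

Lemma measurable_frobenius2 : measurable_fun setT frobenius2.
Proof.
apply: measurable_sum => p; apply: measurable_sum => q.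
by apply: measurable_funX; exact: measurable_funP.
Qed.

Lemma entry_second_moment p q : (\int[P]_w (A p q w ^+ 2)%:E <= 1)%E.
Proof.
have msq : measurable_fun setT (fun x : R => (x ^+ 2)%:E).
  by apply/measurable_EFinP; exact: measurable_funX.
rewrite -(@ge0_integral_distribution _ _ _ _ _ P (A p q) (fun x => (x ^+ 2)%:E))//; last first.
  by move=> y; rewrite lee_fin sqr_ge0.
have -> : (\int[distribution P (A p q)]_x (x ^+ 2)%:E = \int[gam]_x (x ^+ 2)%:E)%E.
  have mid : measurable_fun [set: measurableTypeR R] (idfun : measurableTypeR R -> R).
    by move=> _ B mB; rewrite setTI.
  transitivity (\int[pushforward gam (idfun : measurableTypeR R -> R)]_x (x ^+ 2)%:E)%E.
    by apply: eq_measure_integral => B mB _; have [law _] := Aiid; exact: law.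
  by rewrite ge0_integral_pushforward// => y _; rewrite lee_fin sqr_ge0.
have igam := normal_prob_integrable_sqr R.
have fi : (\int[gam]_x (x ^+ 2)%:E)%E \is a fin_num by exact: integrable_fin_num.
by rewrite -(fineK fi) lee_fin; exact: normal_prob_second_moment_le1.
Qed.

Lemma frobenius2_mean : (\int[P]_w (frobenius2 w)%:E <= (m * n)%:R%:E)%E.
Proof.
have mA p q : measurable_fun setT (fun w => (A p q w ^+ 2)%:E).
  by apply/measurable_EFinP; apply: measurable_funX; exact: measurable_funP.
rewrite /frobenius2; under eq_integral do rewrite -sumEFin.
rewrite ge0_integral_sum//; last 2 first.
- move=> p; apply/measurable_EFinP; apply: measurable_sum => q.
  by apply: measurable_funX; exact: measurable_funP.
- by move=> p w _; rewrite lee_fin sumr_ge0// => q _; exact: sqr_ge0.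
apply: (@le_trans _ _ (\sum_(p < m) n%:R%:E)%E); last first.
  by rewrite sumEFin lee_fin sumr_const card_ord -mulrnA mulnC.
apply: lee_sum => p _; under eq_integral do rewrite -sumEFin.
rewrite ge0_integral_sum//; last by move=> q w _; rewrite lee_fin sqr_ge0.
apply: (@le_trans _ _ (\sum_(q < n) 1%:E)%E); last by rewrite sumEFin lee_fin sumr_const card_ord.
by apply: lee_sum => q _; exact: entry_second_moment.
Qed.

(** Above the level [a] the value is at most [(xi ^+ 2 / M + M) / 2], and the
    second moment is at most that of the Frobenius norm. *)
Lemma xi_mean_le (a M : R) : 0 <= a -> 0 < M ->
  ('E_P[xi] <= (a + (m * n)%:R / (2 * M) + M / 2 * fine (P [set w | a < xi w]%classic))%:E)%E.
Proof.
move=> a0 M0; set S := [set w | a < xi w]%classic.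
have mS : measurable S by exact: measurable_exceed_xi.
have mF := measurable_frobenius2.
have mI : measurable_fun setT (\1_S : T -> R) by exact: measurable_indic.
have F0 w : 0 <= frobenius2 w by apply: sumr_ge0 => p _; apply: sumr_ge0 => q _; exact: sqr_ge0.
have I0 w : 0 <= \1_S w :> R by rewrite indicE.
have c1 : 0 <= (2 * M)^-1 by rewrite invr_ge0 mulr_ge0// ltW.
have c2 : 0 <= M / 2 by rewrite divr_ge0// ltW.
rewrite unlock; apply: (@le_trans _ _
  (\int[P]_w ((a%:E + ((2 * M)^-1)%:E * (frobenius2 w)%:E) + (M / 2)%:E * (\1_S w)%:E))%E).
  apply: ge0_le_integral => //.
  - by move=> w _; rewrite lee_fin xi_ge0.
  - by apply/measurable_EFinP; exact: measurable_xi.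
  - apply/measurable_EFinP; apply: measurable_funD; first apply: measurable_funD => //.
      by apply: measurable_funM.
    by apply: measurable_funM.
  move=> w _; rewrite -!EFinM -!EFinD lee_fin /=.
  have h := xi_sqr_le w; have x0 := xi_ge0 k A w.
  rewrite indicE; case: (boolP (w \in S)) => [_|].
    have -> : (2 * M)^-1 * frobenius2 w = frobenius2 w / (2 * M) by rewrite mulrC.
    have : 0 <= (xi w - M) ^+ 2 / (2 * M) by rewrite divr_ge0 ?sqr_ge0// mulr_ge0// ltW.
    have -> : (xi w - M) ^+ 2 / (2 * M) = xi w ^+ 2 / (2 * M) - xi w + M / 2 by field; rewrite gt_eqF.
    have : xi w ^+ 2 / (2 * M) <= frobenius2 w / (2 * M) by rewrite ler_pM2r// invr_gt0 mulr_gt0.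
    rewrite mulr1; lra.
  rewrite notin_setE /S /= => /negP; rewrite -leNgt => xa.
  by rewrite mulr0 addr0 (le_trans xa)// lerDl mulr_ge0.
rewrite ge0_integralD//; last 4 first.
- by move=> w _; rewrite adde_ge0 ?lee_fin// mulr_ge0.
- apply/measurable_EFinP; apply: measurable_funD => //.
  by apply: measurable_funM.
- by move=> w _; rewrite lee_fin mulr_ge0.
- by apply/measurable_EFinP; apply: measurable_funM.
rewrite ge0_integralD//; last 2 first.
- by move=> w _; rewrite lee_fin mulr_ge0.
- by apply/measurable_EFinP; apply: measurable_funM.
have -> : (\int[P]__ a%:E = a%:E)%E by rewrite integral_cst// [X in (_ * X)%E]probability_setT mule1.
rewrite !ge0_integralZl//; last 3 first.
all: try by apply/measurable_EFinP.
all: try by move=> w _; rewrite lee_fin.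
rewrite integral_indic// setIT (EFinD _ (M / 2 * _)) (EFinD a) (EFinM (M / 2)) fineK ?fin_num_measure//.
apply: leeD => //; apply: leeD => //; rewrite EFinM muleC.
apply: lee_wpmul2r; first by rewrite lee_fin.
exact: frobenius2_mean.
Qed.

End mean_bound.

(** * Limits in the proportional regime *)

Section asymptotics.
Variable R : realType.

Lemma limn_esup_le_near (u : nat -> \bar R) (l : \bar R) :
  (\forall n \near \oo, (u n <= l)%E) -> (limn_esup u <= l)%E.
Proof.
move=> ul; rewrite /limn_esup /limf_esup; apply: ge_ereal_inf.
exists (ereal_sup (u @` [set n | (u n <= l)%E])); first by exists [set n | (u n <= l)%E].
by apply: ge_ereal_sup => _ [n /= un <-].
Qed.

Lemma sqr_expRN_le (x : R) : 0 <= x -> x ^+ 2 * expR (- x) <= 4.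
Proof.
move=> x0; rewrite expRN ler_pdivrMr ?expR_gt0//.
have -> : expR x = expR (x / 2) ^+ 2 by rewrite -expRM_natl; congr expR; field.
have -> : x ^+ 2 = 4 * (x / 2) ^+ 2 by field.
rewrite ler_wpM2l// lerXn2r ?nnegrE ?divr_ge0 ?expR_ge0//.
by have := expR_ge1Dx (x / 2); lra.
Qed.

Lemma near_sqrt_ge (B : R) : \forall n \near \oo, B <= Num.sqrt (n%:R : R).
Proof.
near=> n; have [B0|B0] := leP B 0; first exact: le_trans B0 (sqrtr_ge0 _).
rewrite -(ler_pXn2r (n := 2))// ?nnegrE ?(ltW B0) ?sqrtr_ge0// sqr_sqrtr//.
by near: n; exact: nbhs_infty_ger.
Unshelve. all: by end_near. Qed.

Lemma near_sqrt_lt (alpha c x : R) (m : nat -> nat) : 0 <= alpha ->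
  (forall n, alpha * n%:R - 1 <= (m n)%:R) -> 0 <= c -> 0 <= x -> c < x * Num.sqrt alpha ->
  \forall n \near \oo, Num.sqrt n%:R * c <= x * Num.sqrt (m n)%:R.
Proof.
move=> alpha0 mn c0 x0 cx.
have gap : 0 < x ^+ 2 * alpha - c ^+ 2.
  have -> : x ^+ 2 * alpha = (x * Num.sqrt alpha) ^+ 2 by rewrite exprMn sqr_sqrtr.
  by rewrite subr_gt0 ltrXn2r ?nnegrE ?mulr_ge0 ?sqrtr_ge0.
near=> n.
rewrite -(ler_pXn2r (n := 2))// ?nnegrE ?mulr_ge0 ?sqrtr_ge0//.
rewrite !exprMn !sqr_sqrtr//.
have : x ^+ 2 * (alpha * n%:R - 1) <= x ^+ 2 * (m n)%:R by rewrite ler_wpM2l ?sqr_ge0.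
have : x ^+ 2 / (x ^+ 2 * alpha - c ^+ 2) <= n%:R by near: n; exact: nbhs_infty_ger.
rewrite ler_pdivrMr//; lra.
Unshelve. all: by end_near. Qed.

Lemma cvg_expRN (C delta : R) : 0 < delta -> C * expR (- (delta * n%:R)) @[n --> \oo] --> 0.
Proof.
move=> d0; rewrite -(mulr0 C); apply: cvgM; first exact: cvg_cst.
have h : (fun n : nat => expR (- (delta * n%:R)) : R) = GRing.exp (expR (- delta)).
  by apply/funext => n; rewrite -expRM_natl mulrN mulrC.
rewrite h; apply: cvg_expr; rewrite ger0_norm ?expR_ge0// -[ltRHS]expR0 ltr_expR.
by rewrite oppr_lt0.
Qed.

End asymptotics.

Section proportional_regime.
Context (R : realType) (alpha beta : R) (beta_gt0 : 0 < beta)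
  (ab : beta < alpha) (alpha_lt1 : alpha < 1) (k m : nat -> nat)
  (hk : forall n : nat, `|(k n)%:R - beta * n%:R| < 1)
  (hm : forall n : nat, `|(m n)%:R - alpha * n%:R| < 1)
  (d : nat -> measure_display) (T : forall n : nat, measurableType (d n))
  (P : forall n : nat, probability (T n) R)
  (A : forall n : nat, 'I_(m n) -> 'I_n -> {RV (P n) >-> R})
  (hA : forall n : nat, iid_std_normal (@A n)).
Arguments A : clear implicits.
Arguments hA : clear implicits.
Local Notation rho := (Num.sqrt alpha).
Local Notation sig := (Num.sqrt (tail_moment beta)).
Local Notation bound := (uric_bound alpha beta).

Let beta_lt1 : beta < 1. Proof. exact: lt_trans ab alpha_lt1. Qed.
Let alpha_gt0 : 0 < alpha. Proof. exact: lt_trans beta_gt0 ab. Qed.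
Let rho_gt0 : 0 < rho. Proof. by rewrite sqrtr_gt0 alpha_gt0. Qed.
Let sig_gt0 : 0 < sig.
Proof. by rewrite sqrtr_gt0 tail_moment_gt0// beta_lt1. Qed.

Lemma uric_boundE : bound * rho = rho + sig.
Proof.
by rewrite /uric_bound -/(tail_moment beta); field; rewrite gt_eqF// rho_gt0.
Qed.

Lemma uric_bound_ge0 : 0 <= bound.
Proof. by rewrite addr_ge0// mulr_ge0 ?invr_ge0 ?sqrtr_ge0. Qed.

Let k_le n : (k n)%:R <= beta * n%:R + 1.
Proof. by have := hk n; rewrite ltr_norml => /andP[_]; lra. Qed.
Let m_le n : (m n)%:R <= alpha * n%:R + 1.
Proof. by have := hm n; rewrite ltr_norml => /andP[_]; lra. Qed.
Let m_ge n : alpha * n%:R - 1 <= (m n)%:R.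
Proof. by have := hm n; rewrite ltr_norml => /andP[]; lra. Qed.

Lemma cvg_prob_xi (x : R) : bound < x ->
  P n [set w | xi_uric (k n) (A n) w <= x * Num.sqrt (m n)%:R]%classic @[n --> \oo] --> 1%E.
Proof.
move=> bx; have r0 := rho_gt0; have s0 := sig_gt0.
(* Half of the gap is left for the rounding of [m n]. *)
pose eta := (x * rho - (rho + sig)) / 2.
have xr : rho + sig < x * rho by rewrite -uric_boundE ltr_pM2r.
have eta0 : 0 < eta by rewrite divr_gt0// subr_gt0.
have [C [delta [C0 delta0 H]]] := xi_tail_exp beta_gt0 beta_lt1 alpha_gt0 eta0.
have c1 : 1 - C * expR (- (delta * n%:R)) @[n --> \oo] --> (1 : R).
  by rewrite -[X in _ --> X]subr0; apply: cvgB; [exact: cvg_cst|exact: cvg_expRN].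
have x0 : 0 <= x by exact: le_trans uric_bound_ge0 (ltW bx).
pose B n := [set w | xi_uric (k n) (A n) w <= x * Num.sqrt (m n)%:R]%classic.
pose S n := [set w | Num.sqrt n%:R * (rho + sig + eta) < xi_uric (k n) (A n) w]%classic.
have mB n : measurable (B n).
  rewrite (_ : B n = ~` [set w | x * Num.sqrt (m n)%:R < xi_uric (k n) (A n) w]%classic).
    by apply: measurableC; exact: measurable_exceed_xi.
  by apply/seteqP; split => w /=; rewrite /B /=; [rewrite leNgt => /negP|move=> /negP; rewrite -leNgt].
have mS n : measurable (S n) by exact: measurable_exceed_xi.
have fB n : P n (B n) \is a fin_num by exact: fin_num_measure.
suff : fine (P n (B n)) @[n --> \oo] --> (1 : R).
  move=> h; have -> : (fun n => P n (B n)) = (fun n => (fine (P n (B n)))%:E).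
    by apply/funext => n; rewrite fineK.
  by apply: cvg_EFin => //; exact: nearW.
have c2 : (fun=> 1 : R) @ \oo --> (1 : R) by exact: cvg_cst.
apply: (squeeze_cvgr _ c1 c2); near=> n.
have n0 : (0 < n)%N by near: n; exact: nbhs_infty_gt.
apply/andP; split; last by rewrite -lee_fin fineK// probability_le1.
have nB : (~` B n `<=` S n)%classic.
  move=> w; rewrite /B /S /= => /negP; rewrite -ltNge => h; apply: le_lt_trans h.
  near: n; apply: near_sqrt_lt (ltW alpha_gt0) m_ge _ _ _ => //.
    by rewrite !addr_ge0// ltW.
  by rewrite /eta; lra.
rewrite lerBlDr -lerBlDl; apply: le_trans (H (k n) (m n) n _ _ _ _ (hA n) n0 (m_le n) (k_le n)).
rewrite -lee_fin EFinB fineK// -probability_setC// fineK ?fin_num_measure//.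
by apply: le_measure; rewrite ?inE//; exact: measurableC.
Unshelve. all: by end_near. Qed.

(** For [M = n ^+ 2] the second moment, of order [n ^+ 2], contributes a bounded
    amount, and so does the exponentially small tail. *)
Lemma mean_xi_le (eta : R) : 0 < eta -> exists B : R, forall n, (0 < n)%N ->
  ('E_(P n)[xi_uric (k n) (A n)] <= (Num.sqrt n%:R * (rho + sig + eta) + B)%:E)%E.
Proof.
move=> eta0; have r0 := rho_gt0; have s0 := sig_gt0.
have [C [delta [C0 delta0 H]]] := xi_tail_exp beta_gt0 beta_lt1 alpha_gt0 eta0.
exists (1 + 2 * C / delta ^+ 2) => n n0.
have nR : 1 <= (n%:R : R) by rewrite ler1n.
have M0 : 0 < (n%:R ^+ 2 : R) by rewrite exprn_gt0// ltr0n.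
have a0 : 0 <= Num.sqrt n%:R * (rho + sig + eta).
  by rewrite mulr_ge0 ?sqrtr_ge0// !addr_ge0// ltW.
apply: le_trans (xi_mean_le (k n) (hA n) a0 M0) _.
rewrite lee_fin -addrA lerD2l; apply: lerD.
  rewrite ler_pdivrMr; last by rewrite mulr_gt0.
  rewrite mul1r natrM expr2 mulrA ler_wpM2r//.
  have := m_le n; have : alpha * n%:R <= 1 * n%:R by rewrite ler_wpM2r// ltW.
  lra.
apply: (@le_trans _ _ (n%:R ^+ 2 / 2 * (C * expR (- (delta * n%:R))))).
  rewrite ler_wpM2l ?divr_ge0 ?(ltW M0)//.
  exact: H (hA n) n0 (m_le n) (k_le n).
have := @sqr_expRN_le R (delta * n%:R) (mulr_ge0 (ltW delta0) (ler0n _ _)).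
rewrite exprMn => h.
have -> : n%:R ^+ 2 / 2 * (C * expR (- (delta * n%:R))) =
    C / (2 * delta ^+ 2) * (delta ^+ 2 * n%:R ^+ 2 * expR (- (delta * n%:R))).
  by field; rewrite gt_eqF.
have -> : 2 * C / delta ^+ 2 = C / (2 * delta ^+ 2) * 4 by field; rewrite gt_eqF.
by rewrite ler_wpM2l// divr_ge0// mulr_ge0// sqr_ge0.
Qed.

Lemma limn_esup_mean_xi : (limn_esup (fun n : nat =>
     'E_(P n)[xi_uric (k n) (A n)] * ((Num.sqrt (m n)%:R)^-1)%:E)
   <= bound%:E)%E.
Proof.
have r0 := rho_gt0; have s0 := sig_gt0.
apply/lee_addgt0Pr => theta theta0; apply: limn_esup_le_near.
(* One third of the slack absorbs [eta], one the constant [B], and one the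
   rounding of [m n]. *)
pose eta := theta * rho / 3.
have eta0 : 0 < eta by rewrite divr_gt0// mulr_gt0.
have [B HB] := mean_xi_le eta0.
near=> n.
have n0 : (0 < n)%N by near: n; exact: nbhs_infty_gt.
have Bn : B / eta <= Num.sqrt n%:R by near: n; exact: near_sqrt_ge.
have m0 : 0 < (m n)%:R :> R.
  apply: lt_le_trans (m_ge n); rewrite subr_gt0 mulrC -ltr_pdivrMr ?alpha_gt0//.
  by near: n; exact: nbhs_infty_gtr.
rewrite -EFinD lee_pdivrMr ?sqrtr_gt0//.
apply: le_trans (HB n n0) _; rewrite lee_fin.
apply: (@le_trans _ _ (Num.sqrt n%:R * (rho + sig + 2 * eta))).
  by move: Bn; rewrite ler_pdivrMr//; lra.
near: n; apply: near_sqrt_lt (ltW alpha_gt0) m_ge _ _ _.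
- by rewrite !addr_ge0 ?mulr_ge0// ltW.
- by rewrite addr_ge0 ?uric_bound_ge0 ?ltW.
- by rewrite (mulrDl bound) uric_boundE /eta; have := mulr_gt0 theta0 r0; lra.
Unshelve. all: by end_near. Qed.

End proportional_regime.

Theorem lemma2 (R : realType) (alpha beta : R)
    (hbeta : 0 < beta) (hab : beta < alpha) (halpha : alpha < 1)
    (k m : nat -> nat)
    (hk : forall n : nat, `|(k n)%:R - beta * n%:R| < 1)
    (hm : forall n : nat, `|(m n)%:R - alpha * n%:R| < 1)
    (d : nat -> measure_display)
    (T : forall n : nat, measurableType (d n))
    (P : forall n : nat, probability (T n) R)
    (A : forall n : nat, 'I_(m n) -> 'I_n -> {RV (P n) >-> R})
    (hA : forall n : nat, iid_std_normal (A n)) :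
  (limn_esup (fun n : nat =>
     'E_(P n)[xi_uric (k n) (A n)] * ((Num.sqrt (m n)%:R)^-1)%:E)
   <= (uric_bound alpha beta)%:E)%E
  /\
  (forall xiu : R, uric_bound alpha beta < xiu ->
     (fun n : nat =>
        P n [set w | xi_uric (k n) (A n) w <= xiu * Num.sqrt (m n)%:R])
       @ \oo --> 1%E
     /\
     (fun n : nat =>
        P n [set w | xi_uric (k n) (A n) w ^+ 2 <= xiu ^+ 2 * (m n)%:R])
       @ \oo --> 1%E).
Proof.
split; first exact: (limn_esup_mean_xi hbeta hab halpha hk hm hA).
move=> x bx; have cvgP := cvg_prob_xi hbeta hab halpha hk hm hA bx.
split; first exact: cvgP.
have x0 : 0 <= x by rewrite (le_trans _ (ltW bx))// uric_bound_ge0.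
rewrite (_ : (fun n => P n [set w | xi_uric (k n) (A n) w ^+ 2 <= x ^+ 2 * (m n)%:R]) =
  (fun n => P n [set w | xi_uric (k n) (A n) w <= x * Num.sqrt (m n)%:R]))//.
apply/funext => n; congr (P n _); apply/seteqP; split => w /=.
  rewrite -{1}(sqr_sqrtr (ler0n R (m n))) -exprMn.
  by rewrite ler_pXn2r// nnegrE ?xi_ge0 ?mulr_ge0 ?sqrtr_ge0.
rewrite -{2}(sqr_sqrtr (ler0n R (m n))) -exprMn.
by rewrite ler_pXn2r// nnegrE ?xi_ge0 ?mulr_ge0 ?sqrtr_ge0.
Qed.
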